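(* Fix $\alpha>0$ and let $\bm{T}\colon\mathbb{R}^q\to\mathrm{Sym}_p(\mathbb{R})$ be measurable with $\mathbb{P}(\bm{T}(\bm{y})\neq \bm{0}_{p\times p})>0$ and $\|\bm{T}(\bm{y})\|_{\mathrm{op}}\le C_T$ almost surely for some finite $C_T>0$. Then there exists a unique analytic function $\bm{M}_\alpha\colon\mathbb{C}_+\to\mathbb{C}^{p\times p}$ that satisfies $$\bm{M}(z)^{-1}=-z\bm{I}_p+\mathbb{E}_{\bm{y}}\left[\bm{T}(\bm{y})\left(\bm{I}_p+\tfrac1\alpha\bm{M}(z)\bm{T}(\bm{y})\right)^{-1}\right],\quad z\in\mathbb{C}_+,$$ and belongs to the normalized matrix-valued Herglotz class, i.e. $\Im\bm{M}(z)\succeq\bm{0}$ for all $z\in\mathbb{C}_+$ and $\lim_{\eta\to\infty}i\eta\bm{M}(i\eta)=-\bm{I}_p$. In fact $\Im\bm{M}_\alpha(z)\succ\bm{0}$ for $z\in\mathbb{C}_+$. Moreover, there exists a unique positive semidefinite matrix-valued Borel measure $\bm{\Omega}_\alpha$ on $\mathbb{R}$ with total mass $\bm{\Omega}_\alpha(\mathbb{R})=\bm{I}_p$ such that, for every $z\in\mathbb{C}_+$, $$\bm{M}_\alpha(z)=\int_{\mathbb{R}}\frac{\bm{\Omega}_\alpha(\mathrm{d}\lambda)}{\lambda-z}.$$ Consequently $\mu_\alpha=\frac1p\operatorname{Tr}\bm{\Omega}_\alpha$ is a probability measure on $\mathbb{R}$ and its Stieltjes transform satisfies $$m_{\mu_\alpha}(z)=\int_{\mathbb{R}}\frac{\mu_\alpha(\mathrm{d}\lambda)}{\lambda-z}=\frac1p\operatorname{Tr}\bm{M}_\alpha(z),\qquad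 z\in\mathbb{C}_+.$$
   Context: $p,q,r\ge1$ are integers. $\bm{y}$ is a random vector in $\mathbb{R}^q$ with the marginal law determined by $\bm{s}\sim\mathcal{N}(\bm{0}_r,\bm{I}_r)$, $\bm{y}\mid\bm{s}\sim P_\ast(\cdot\mid\bm{s})$ for a fixed Markov kernel $P_\ast$; $\mathbb{E}_{\bm{y}}$ is expectation over $\bm{y}$. $\mathrm{Sym}_p(\mathbb{R})$ is the space of real symmetric $p\times p$ matrices. $\mathbb{C}_+=\{z\in\mathbb{C}\colon\Im z>0\}$, and for a complex square matrix $\Im\bm{X}=(\bm{X}-\bm{X}^\ast)/(2i)$. *)

(* Defs.v *)
From HB Require Import structures.
From mathcomp Require Export all_boot all_order all_algebra.
From mathcomp Require Export all_classical all_reals all_analysis.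
From mathcomp Require Export complex.

Export Order.TTheory GRing.Theory Num.Theory.
Export numFieldNormedType.Exports.

Set Implicit Arguments.
Unset Strict Implicit.
Unset Printing Implicit Defensive.

Local Open Scope classical_set_scope.
Local Open Scope complex_scope.
Local Open Scope sesquilinear_scope.
Local Open Scope ring_scope.

(* The topology of [R[i]] given by its norm is attached to the alias [R[i]^o];
   convergence in ['M[R[i]^o]_p] is entrywise. *)

Section Matrices.
Variable R : realType.

Definition upper_half : set R[i] := [set z | 0 < complex.Im z].

Definition l2norm n (x : 'cV[R]_n) : R := Num.sqrt (\sum_i x i 0 ^+ 2).

Definition opnorm m n (A : 'M[R]_(m, n)) : R :=
  sup [set l2norm (A *m x) | x in [set x | l2norm x <= 1]].

Variable p : nat.
Implicit Types X : 'M[R[i]]_p.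

Definition complexmx (A : 'M[R]_p) : 'M[R[i]]_p := map_mx (real_complex R) A.

Definition mxIm X : 'M[R[i]]_p := (2 * 'i%C)^-1 *: (X - X^t*).

Definition psdmx X :=
  X^t* = X /\ forall v : 'cV[R[i]]_p, 0 <= (v^t* *m X *m v) 0 0.

Definition posdefmx X :=
  X^t* = X /\ forall v : 'cV[R[i]]_p, v != 0 -> 0 < (v^t* *m X *m v) 0 0.

Definition analytic_on (D : set R[i]) (M : R[i] -> 'M[R[i]]_p) :=
  forall z0, D z0 -> exists2 rho : R, 0 < rho &
  exists a : nat -> 'M[R[i]]_p, forall z, `|z - z0| < rho%:C ->
  (series (fun n => (z - z0) ^+ n *: a n) : nat -> 'M[R[i]^o]_p) @ \oo
    --> (M z : 'M[R[i]^o]_p).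

Definition normalized_herglotz (M : R[i] -> 'M[R[i]]_p) :=
  (forall z, upper_half z -> psdmx (mxIm (M z))) /\
  ((fun eta : R => ('i%C * eta%:C) *: M ('i%C * eta%:C)) : R -> 'M[R[i]^o]_p)
    @ +oo --> (- 1%:M : 'M[R[i]^o]_p).

End Matrices.

Section Integrals.
Context d (T : measurableType d) (R : realType).

Definition Cintegrable (mu : {measure set T -> \bar R}) (f : T -> R[i]) :=
  mu.-integrable setT (fun x => (complex.Re (f x))%:E) /\
  mu.-integrable setT (fun x => (complex.Im (f x))%:E).

Definition Cintegral (mu : {measure set T -> \bar R}) (f : T -> R[i]) : R[i] :=
  (\int[mu]_x complex.Re (f x)) +i* (\int[mu]_x complex.Im (f x)).

Definition mxintegrable p (mu : {measure set T -> \bar R})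
    (X : T -> 'M[R[i]]_p) :=
  forall i j, Cintegrable mu (fun x => X x i j).

Definition mxintegral p (mu : {measure set T -> \bar R})
    (X : T -> 'M[R[i]]_p) : 'M[R[i]]_p :=
  \matrix_(i, j) Cintegral mu (fun x => X x i j).

(* [c] is the integral of [f] with respect to the complex measure [nu]: write
   [nu = m_0 + i m_1 - m_2 - i m_3] with finite positive measures [m_k] (as the
   Jordan decompositions of the real and imaginary parts of [nu] allow) and
   integrate [f] against each of them. [c] does not depend on the choice of the
   [m_k]. *)
Definition has_complex_integral (nu : set T -> R[i]) (f : T -> R[i])
    (c : R[i]) :=
  exists m : 'I_4 -> {finite_measure set T -> \bar R},
  [/\ forall A, measurable A ->
        nu A = \sum_(k < 4) 'i%C ^+ k * (fine (m k A))%:C,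
      forall k, Cintegrable (m k) f &
      c = \sum_(k < 4) 'i%C ^+ k * Cintegral (m k) f].

Definition has_mxintegral p (W : set T -> 'M[R[i]]_p) (f : T -> R[i])
    (X : 'M[R[i]]_p) :=
  forall i j, has_complex_integral (fun A => W A i j) f (X i j).

(* A measure with values in the positive semidefinite complex Hermitian matrices.
   Only the values of [W] on measurable sets are meaningful. *)
Definition psd_mxmeasure p (W : set T -> 'M[R[i]]_p) :=
  [/\ W set0 = 0,
      forall A, measurable A -> psdmx (W A) &
      forall F : nat -> set T, (forall n, measurable (F n)) -> trivIset setT F ->
        (series (fun n => W (F n)) : nat -> 'M[R[i]^o]_p) @ \oo
          --> (W (\bigcup_n F n) : 'M[R[i]^o]_p)].

End Integrals.

Definition stieltjes_kernel (R : realType) (z : R[i]) (x : R) : R[i] :=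
  (x%:C - z)^-1.

Definition stieltjes_representation (R : realType) p (M : R[i] -> 'M[R[i]]_p)
    (W : set R -> 'M[R[i]]_p) :=
  [/\ psd_mxmeasure W, W setT = 1%:M &
      forall z, upper_half z -> has_mxintegral W (stieltjes_kernel z) (M z)].

Section Model.
Context d (Omega : measurableType d) (R : realType) (P : probability Omega R).

(* N(0_r, I_r) is the product of [r] copies of N(0, 1). *)
Definition standard_gaussian r (s : {RV P >-> r.-tuple R}) :=
  forall A : 'I_r -> set R, (forall i, measurable (A i)) ->
  distribution P s [set t | forall i, A i (tnth t i)] =
  (\prod_(i < r) normal_prob 0 1 (A i))%E.

Definition has_conditional_law r q (s : {RV P >-> r.-tuple R})
    (y : {RV P >-> q.-tuple R}) (K : R.-pker (r.-tuple R) ~> (q.-tuple R)) :=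
  forall (A : set (r.-tuple R)) (B : set (q.-tuple R)),
  measurable A -> measurable B ->
  P (s @^-1` A `&` y @^-1` B) = (\int[distribution P s]_(x in A) K x B)%E.

(* The invertibility and integrability clauses say that both sides of the
   equation are defined ([invmx] and the integral are total functions). *)
Definition solves_at p (alpha : R) (S : Omega -> 'M[R]_p) (z : R[i])
    (X : 'M[R[i]]_p) :=
  let B w := 1%:M + (alpha^-1)%:C *: (X *m complexmx (S w)) in
  let G w := complexmx (S w) *m invmx (B w) in
  [/\ X \in unitmx,
      {ae P, forall w, B w \in unitmx},
      mxintegrable P G &
      invmx X = - z%:M + mxintegral P G].

Definition herglotz_solution p (alpha : R) (S : Omega -> 'M[R]_p)
    (M : R[i] -> 'M[R[i]]_p) :=
  [/\ analytic_on (@upper_half R) M,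
      forall z, upper_half z -> solves_at alpha S z (M z) &
      normalized_herglotz M].

End Model.

(* Main.v *)
From HB Require Import structures.
Require Import Defs.
From mathcomp Require Import ring lra measurable_realfun.

(** Put a = 1/alpha, E(M) = E[T (1 + a M T)^-1] and Phi_z(M) = (- z + E(M))^-1, so
    that the equation reads Phi_z(M) = M.  For Im z > 0 the map Phi_z preserves the
    set Q of the matrices M with Im <u, M u> >= (Im z) |M u|^2, and it contracts
    there: a bound 2 Re <u, (M - M') v> <= k (Im <u, M u> + Im <v, M' v>) for all u,
    v is inherited by Phi_z(M), Phi_z(M') with k replaced by r k, where r < 1.
    Hence Phi_z has exactly one fixed point in Q, the limit of the iterates of
    - 1/z, and every solution with Im M >= 0 lies in Q.

    When T takes finitely many values, the n-th iterate is a compression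
    V^* (A - z)^-1 V of the resolvent of a Hermitian matrix A, with V^* V = 1:
    Woodbury's identity handles E(M), a Schur complement handles Phi_z.  So its
    quadratic form at v is the Stieltjes transform of an atomic measure of mass
    |v|^2.  The identity 1 + z Phi_z(M) = Phi_z(M) E(M) makes these measures tight,
    and Helly's selection theorem passes first to bounded T and then to the fixed
    point.  Polarisation turns the scalar measures into a matrix measure.

    A combination of finite measures whose Stieltjes transform vanishes off the
    real line is zero: the functions 1/(1 + 2^-j t^(2^(3j+1))), where t is an affine
    function of x, are combinations of resolvents, and converge boundedly to the
    indicator function of a half-line.  This gives the positivity, the mass and the
    uniqueness of the matrix measure. *)

(** In norm, the Lipschitz constant found for Phi_z is a K^2 / (Im z)^2, with K a bound for E; near
    the real axis it need not be below 1. Distances are therefore measured relative to the imaginary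
    parts of the two points, in the spirit of the invariant metric of the Siegel half-space. On this
    scale E loses nothing: for G = T (1 + a M T)^-1 with T Hermitian, Im <x, G x> = - a Im <G x, M G
    x> exactly. The gain comes from the inversion: with x = Phi_z(M) u one has Im <u, x> = (Im z)
    |x|^2 - Im <x, E x>, where the first term is at least the fraction (Im z) / (|z| + K) of the
    sum, and r is what remains.

    Nothing about analyticity is needed to construct the measures: convergence of the iterates at
    each single z suffices for Helly's theorem, and analyticity is then read off from the integrals.

    Exponents that are powers of two allow the functions of the last step to be decomposed exactly:
    1 / (t^2 - b^2) splits into partial fractions with poles b and - b, and the splitting is
    repeated until only resolvents in x are left. *)

Set Implicit Arguments.
Unset Strict Implicit.
Unset Printing Implicit Defensive.

Local Open Scope classical_set_scope.
Local Open Scope complex_scope.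
Local Open Scope sesquilinear_scope.
Local Open Scope ring_scope.

(** * Hermitian forms *)

Notation Re := complex.Re.
Notation Im := complex.Im.

Section ComplexParts.
Variable R : realType.
Implicit Types (x y z : R[i]) (c : R).

Lemma ReD x y : Re (x + y) = Re x + Re y. Proof. by case: x y => ? ? []. Qed.
Lemma ImD x y : Im (x + y) = Im x + Im y. Proof. by case: x y => ? ? []. Qed.
Lemma ReN x : Re (- x) = - Re x. Proof. by case: x. Qed.
Lemma ImN x : Im (- x) = - Im x. Proof. by case: x. Qed.
Lemma ReB x y : Re (x - y) = Re x - Re y. Proof. by rewrite ReD ReN. Qed.
Lemma ImB x y : Im (x - y) = Im x - Im y. Proof. by rewrite ImD ImN. Qed.
Lemma ReM x y : Re (x * y) = Re x * Re y - Im x * Im y.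
Proof. by case: x y => ? ? []. Qed.
Lemma ImM x y : Im (x * y) = Re x * Im y + Im x * Re y.
Proof. by case: x y => ? ? [] ? ?. Qed.
Lemma Re_conj x : Re (Num.conj x) = Re x. Proof. by case: x. Qed.
Lemma Im_conj x : Im (Num.conj x) = - Im x. Proof. by case: x. Qed.
Lemma Re_sum I (r : seq I) (P : pred I) (F : I -> R[i]) :
  Re (\sum_(i <- r | P i) F i) = \sum_(i <- r | P i) Re (F i).
Proof. exact: (big_morph _ ReD). Qed.
Lemma Im_sum I (r : seq I) (P : pred I) (F : I -> R[i]) :
  Im (\sum_(i <- r | P i) F i) = \sum_(i <- r | P i) Im (F i).
Proof. exact: (big_morph _ ImD). Qed.
Lemma ReZ c x : Re (c%:C * x) = c * Re x.
Proof. by rewrite ReM /= mul0r subr0. Qed.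
Lemma ImZ c x : Im (c%:C * x) = c * Im x.
Proof. by rewrite ImM /= mul0r addr0. Qed.
Lemma complex_ext x y : Re x = Re y -> Im x = Im y -> x = y.
Proof. by case: x y => ? ? [] ? ? /= -> ->. Qed.
Lemma ReV x : Re x^-1 = Re x / (Re x ^+ 2 + Im x ^+ 2). Proof. by case: x. Qed.
Lemma ImV x : Im x^-1 = - Im x / (Re x ^+ 2 + Im x ^+ 2).
Proof. by case: x => a b /=; rewrite mulNr. Qed.
Lemma Re_normr_le x : `|Re x|%:C <= `|x|. Proof. exact: normc_ge_Re. Qed.
Lemma conj_real c : Num.conj c%:C = c%:C :> R[i].
Proof. by apply: complex_ext; rewrite ?Re_conj ?Im_conj /= ?oppr0. Qed.
End ComplexParts.

(* [rip] and [iip] are the real and imaginary parts of the inner product [u^* v]. *)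
HB.lock Definition rip (R : realType) n (u v : 'cV[R[i]]_n) : R :=
  Re ((u^t* *m v) 0 0).
HB.lock Definition iip (R : realType) n (u v : 'cV[R[i]]_n) : R :=
  Im ((u^t* *m v) 0 0).
HB.lock Definition nv (R : realType) n (u : 'cV[R[i]]_n) : R :=
  Num.sqrt (rip u u).

Section InnerProduct.
Variable R : realType.
Local Notation C := R[i].

Lemma ripE n (u v : 'cV[C]_n) :
  rip u v = \sum_i (Re (u i 0) * Re (v i 0) + Im (u i 0) * Im (v i 0)).
Proof.
rewrite rip.unlock mxE Re_sum; apply: eq_bigr => i _.
by rewrite !mxE ReM Re_conj Im_conj mulNr opprK.
Qed.

Lemma iipE n (u v : 'cV[C]_n) :
  iip u v = \sum_i (Re (u i 0) * Im (v i 0) - Im (u i 0) * Re (v i 0)).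
Proof.
rewrite iip.unlock mxE Im_sum; apply: eq_bigr => i _.
by rewrite !mxE ImM Re_conj Im_conj mulNr.
Qed.

Section Bilinear.
Variable n : nat.
Implicit Types u v w : 'cV[C]_n.

Lemma ripDr u v w : rip u (v + w) = rip u v + rip u w.
Proof. by rewrite rip.unlock mulmxDr mxE ReD. Qed.
Lemma ripDl u v w : rip (v + w) u = rip v u + rip w u.
Proof. by rewrite rip.unlock linearD map_mxD mulmxDl mxE ReD. Qed.
Lemma ripNr u v : rip u (- v) = - rip u v.
Proof. by rewrite rip.unlock mulmxN mxE ReN. Qed.
Lemma ripNl u v : rip (- u) v = - rip u v.
Proof. by rewrite rip.unlock linearN map_mxN mulNmx mxE ReN. Qed.
Lemma ripBr u v w : rip u (v - w) = rip u v - rip u w.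
Proof. by rewrite ripDr ripNr. Qed.
Lemma ripBl u v w : rip (v - w) u = rip v u - rip w u.
Proof. by rewrite ripDl ripNl. Qed.
Lemma ripZr (c : R) u v : rip u (c%:C *: v) = c * rip u v.
Proof. by rewrite rip.unlock -scalemxAr mxE ReZ. Qed.
Lemma ripC u v : rip u v = rip v u.
Proof. by rewrite !ripE; apply: eq_bigr => i _; congr (_ + _); rewrite mulrC. Qed.
Lemma ripZl (c : R) u v : rip (c%:C *: u) v = c * rip u v.
Proof. by rewrite ripC ripZr ripC. Qed.
Lemma rip0r u : rip u 0 = 0. Proof. by rewrite rip.unlock mulmx0 mxE. Qed.
Lemma iipDr u v w : iip u (v + w) = iip u v + iip u w.
Proof. by rewrite iip.unlock mulmxDr mxE ImD. Qed.
Lemma iipC u v : iip u v = - iip v u.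
Proof.
rewrite !iipE -sumrN; apply: eq_bigr => i _.
by rewrite opprB; congr (_ - _); rewrite mulrC.
Qed.
Lemma iipDl u v w : iip (v + w) u = iip v u + iip w u.
Proof. by rewrite iipC iipDr opprD -!iipC. Qed.
Lemma iipNr u v : iip u (- v) = - iip u v.
Proof. by rewrite iip.unlock mulmxN mxE ImN. Qed.
Lemma iipNl u v : iip (- u) v = - iip u v.
Proof. by rewrite iipC iipNr -iipC. Qed.
Lemma iipBr u v w : iip u (v - w) = iip u v - iip u w.
Proof. by rewrite iipDr iipNr. Qed.
Lemma iipBl u v w : iip (v - w) u = iip v u - iip w u.
Proof. by rewrite iipDl iipNl. Qed.
Lemma iipZr (c : R) u v : iip u (c%:C *: v) = c * iip u v.
Proof. by rewrite iip.unlock -scalemxAr mxE ImZ. Qed.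
Lemma iipZl (c : R) u v : iip (c%:C *: u) v = c * iip u v.
Proof. by rewrite iipC iipZr -mulrN -iipC. Qed.
Lemma iip_rip u v : iip u v = rip u (- 'i%C *: v).
Proof.
by rewrite iip.unlock rip.unlock -scalemxAr !mxE ReM /= !oppr0 mul0r sub0r mulN1r opprK.
Qed.

Lemma rip_ge0 u : 0 <= rip u u.
Proof.
by rewrite ripE; apply: sumr_ge0 => i _; rewrite -!expr2 addr_ge0 ?sqr_ge0.
Qed.
Lemma nv_ge0 u : 0 <= nv u. Proof. by rewrite nv.unlock sqrtr_ge0. Qed.
Lemma sqr_nv u : nv u ^+ 2 = rip u u. Proof. by rewrite nv.unlock sqr_sqrtr ?rip_ge0. Qed.
Lemma rip_eq0 u : rip u u = 0 -> u = 0.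
Proof.
rewrite ripE => /eqP; rewrite psumr_eq0; last first.
  by move=> i _; rewrite -!expr2 addr_ge0 ?sqr_ge0.
move=> /allP h; apply/matrixP => i j; rewrite ord1 mxE.
move: (h i); rewrite mem_index_enum => /(_ isT) /=.
rewrite -!expr2 paddr_eq0 ?sqr_ge0// !sqrf_eq0 => /andP[/eqP a /eqP b].
exact: complex_ext.
Qed.
Lemma nv_eq0 u : nv u = 0 -> u = 0.
Proof. by move=> h; apply: rip_eq0; rewrite -sqr_nv h expr0n. Qed.
Lemma nv0 : nv (0 : 'cV[C]_n) = 0. Proof. by rewrite nv.unlock rip0r sqrtr0. Qed.
Lemma nv_gt0 u : u != 0 -> 0 < nv u.
Proof.
move=> u0; rewrite lt_neqAle nv_ge0 andbT; apply: contra u0 => /eqP h.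
by rewrite (nv_eq0 (esym h)).
Qed.
Lemma rip_gt0 u : u != 0 -> 0 < rip u u.
Proof. by move=> u0; rewrite -sqr_nv exprn_gt0 // nv_gt0. Qed.

Lemma rip_le u v : rip u v <= nv u * nv v.
Proof.
have [->|v0] := eqVneq v 0; first by rewrite rip0r nv0 mulr0.
have vv := rip_gt0 v0.
have := rip_ge0 (u - (rip u v / rip v v)%:C *: v).
rewrite ripBl !ripBr ripZl !ripZr ripZl (ripC v u) => h.
have {h} : rip u v ^+ 2 <= rip u u * rip v v.
  have aux (x y z : R) : 0 < z ->
      x - y / z * y - (y / z * y - y / z * (y / z * z)) = x - y ^+ 2 / z.
    by move=> z0; field; rewrite gt_eqF.
  move: h; set b := rip u v; set c := rip v v in vv *; set d := rip u u.
  by move: b c d vv => b c d vv; rewrite aux // subr_ge0 ler_pdivrMr.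
rewrite -!sqr_nv -exprMn => h.
apply: le_trans (ler_norm _) _.
by rewrite -(@ler_pXn2r _ 2) ?nnegrE ?mulr_ge0 ?nv_ge0 // -normrX ger0_norm ?sqr_ge0.
Qed.

Lemma nvN u : nv (- u) = nv u. Proof. by rewrite nv.unlock ripNl ripNr opprK. Qed.
Lemma nvZ (c : C) u : nv (c *: u) = Normc.normc c * nv u.
Proof.
rewrite nv.unlock; have -> : rip (c *: u) (c *: u) = (Re c ^+ 2 + Im c ^+ 2) * rip u u.
  rewrite !ripE mulr_sumr; apply: eq_bigr => i _; rewrite !mxE !ReM !ImM; ring.
by rewrite sqrtrM ?addr_ge0 ?sqr_ge0//; case: c.
Qed.
Lemma nvZr (c : R) u : nv (c%:C *: u) = `|c| * nv u.
Proof. by rewrite nvZ /= [0 ^+ 2]expr0n addr0 sqrtr_sqr. Qed.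
Lemma nv_Ni u : nv (- 'i%C *: u) = nv u.
Proof. by rewrite nvZ /= oppr0 sqrrN expr0n expr1n add0r sqrtr1 mul1r. Qed.
Lemma norm_rip_le u v : `|rip u v| <= nv u * nv v.
Proof.
rewrite ler_norml rip_le andbT lerNl -ripNr; apply: le_trans (rip_le _ _) _.
by rewrite nvN.
Qed.
Lemma norm_iip_le u v : `|iip u v| <= nv u * nv v.
Proof. by rewrite iip_rip; apply: le_trans (norm_rip_le _ _) _; rewrite nv_Ni. Qed.
Lemma nvD u v : nv (u + v) <= nv u + nv v.
Proof.
rewrite -(@ler_pXn2r _ 2) ?nnegrE ?addr_ge0 ?nv_ge0 // sqr_nv ripDl !ripDr.
have := rip_le u v; rewrite (ripC v u) -!sqr_nv; nra.
Qed.
Lemma nvB u v : nv (u - v) <= nv u + nv v.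
Proof. by apply: le_trans (nvD _ _) _; rewrite nvN. Qed.

End Bilinear.

Section Adjoint.
Variables m n : nat.
Implicit Types X : 'M[C]_(m, n).

Lemma adjM l (X : 'M[C]_(m, n)) (Y : 'M[C]_(n, l)) :
  (X *m Y)^t* = Y^t* *m X^t*.
Proof. by rewrite trmx_mul map_mxM. Qed.
Lemma adjD X (Y : 'M[C]_(m, n)) : (X + Y)^t* = X^t* + Y^t*.
Proof. by rewrite linearD map_mxD. Qed.
Lemma adjN X : (- X)^t* = - X^t*.
Proof. by rewrite linearN map_mxN. Qed.
Lemma adjB X (Y : 'M[C]_(m, n)) : (X - Y)^t* = X^t* - Y^t*.
Proof. by rewrite adjD adjN. Qed.
Lemma adjZ (c : C) X : (c *: X)^t* = Num.conj c *: X^t*.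
Proof. by rewrite linearZ map_mxZ. Qed.
Lemma rip_adj X u v : rip (X *m u) v = rip u (X^t* *m v).
Proof. by rewrite rip.unlock adjM mulmxA. Qed.
Lemma iip_adj X u v : iip (X *m u) v = iip u (X^t* *m v).
Proof. by rewrite iip.unlock adjM mulmxA. Qed.
End Adjoint.

Lemma rip_adjr m n (X : 'M[C]_(m, n)) u v : rip u (X *m v) = rip (X^t* *m u) v.
Proof. by rewrite rip_adj trmxCK. Qed.
Lemma iip_adjr m n (X : 'M[C]_(m, n)) u v : iip u (X *m v) = iip (X^t* *m u) v.
Proof. by rewrite iip_adj trmxCK. Qed.

Lemma adj1 n : (1%:M : 'M[C]_n)^t* = 1%:M.
Proof. by rewrite trmx1 map_mx1. Qed.

Lemma adj_scalar n (c : C) : (c%:M : 'M[C]_n)^t* = (Num.conj c)%:M.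
Proof. by rewrite tr_scalar_mx map_scalar_mx. Qed.

Lemma iip_herm n (A : 'M[C]_n) u : A^t* = A -> iip u (A *m u) = 0.
Proof.
move=> hA; have : iip u (A *m u) = - iip u (A *m u).
  by rewrite {1}iipC iip_adj hA.
lra.
Qed.

Lemma iip_scalar n (z : C) (u : 'cV[C]_n) : iip u (z *: u) = Im z * rip u u.
Proof.
rewrite iipE ripE mulr_sumr; apply: eq_bigr => i _; rewrite !mxE ImM ReM; ring.
Qed.

Lemma unitmx_inj n (A : 'M[C]_n) :
  (forall v : 'cV[C]_n, A *m v = 0 -> v = 0) -> A \in unitmx.
Proof.
move=> h; rewrite -unitmx_tr -row_free_unit; apply/inj_row_free => v hv.
have := h v^T; rewrite -[A]trmxK -trmx_mul hv trmx0 => /(_ erefl).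
by move/(congr1 trmx); rewrite trmxK trmx0.
Qed.

Lemma unitmx_nv n (A : 'M[C]_n) (c : R) : 0 < c ->
  (forall v, c * nv v <= nv (A *m v)) -> A \in unitmx.
Proof.
move=> c0 h; apply: unitmx_inj => v Av; apply: nv_eq0.
have := h v; rewrite Av nv0 => hv; apply/eqP.
by rewrite eq_le nv_ge0 andbT -(ler_pM2l c0) mulr0.
Qed.

Definition bnd m n (X : 'M[C]_(m, n)) (c : R) := forall u, nv (X *m u) <= c * nv u.

Lemma bndM l m n (X : 'M[C]_(l, m)) (Y : 'M[C]_(m, n)) c c' : 0 <= c ->
  bnd X c -> bnd Y c' -> bnd (X *m Y) (c * c').
Proof.
move=> c0 hX hY u; rewrite -mulmxA; apply: le_trans (hX _) _.
by rewrite -mulrA ler_wpM2l.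
Qed.

Lemma bndD m n (X Y : 'M[C]_(m, n)) c c' : bnd X c -> bnd Y c' -> bnd (X + Y) (c + c').
Proof.
move=> hX hY u; rewrite mulmxDl; apply: le_trans (nvD _ _) _.
by rewrite mulrDl lerD.
Qed.

Lemma bndN m n (X : 'M[C]_(m, n)) c : bnd X c -> bnd (- X) c.
Proof. by move=> hX u; rewrite mulNmx nvN. Qed.

Lemma bndB m n (X Y : 'M[C]_(m, n)) c c' : bnd X c -> bnd Y c' -> bnd (X - Y) (c + c').
Proof. by move=> hX hY; exact: bndD hX (bndN hY). Qed.

Lemma bndZ m n (X : 'M[C]_(m, n)) c (a : C) : bnd X c -> bnd (a *: X) (Normc.normc a * c).
Proof.
move=> hX u; rewrite -scalemxAl nvZ -mulrA ler_wpM2l //.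
by case: a => ? ?; rewrite sqrtr_ge0.
Qed.

Lemma bnd1 n : bnd (1%:M : 'M[C]_n) 1.
Proof. by move=> u; rewrite mul1mx mul1r. Qed.

Lemma bnd_le m n (X : 'M[C]_(m, n)) c c' : c <= c' -> bnd X c -> bnd X c'.
Proof.
by move=> cc h u; apply: le_trans (h u) _; rewrite ler_wpM2r ?nv_ge0.
Qed.

Lemma bnd_rip m n (X : 'M[C]_(m, n)) c : 0 <= c ->
  (forall u v, rip u (X *m v) <= c * (nv u * nv v)) -> bnd X c.
Proof.
move=> c0 h v; have := h (X *m v) v; rewrite -sqr_nv.
have [->|] := eqVneq (nv (X *m v)) 0; first by rewrite mulr_ge0 ?nv_ge0.
move=> n0; have np : 0 < nv (X *m v) by rewrite lt_neqAle eq_sym n0 nv_ge0.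
by rewrite mulrCA expr2 ler_pM2l.
Qed.

Lemma rip_bnd m n (X : 'M[C]_(m, n)) c u v : bnd X c ->
  rip u (X *m v) <= c * (nv u * nv v).
Proof.
move=> h; apply: le_trans (rip_le _ _) _.
by rewrite mulrCA ler_wpM2l ?nv_ge0.
Qed.

Lemma nv_delta n (i : 'I_n) : nv (delta_mx i 0 : 'cV[C]_n) = 1.
Proof.
rewrite nv.unlock ripE (bigD1 i) //= big1 ?addr0 => [|j ji]; last first.
  by rewrite !mxE (negbTE ji) /= !mul0r addr0.
by rewrite !mxE !eqxx /= mulr1 mulr0 addr0 sqrtr1.
Qed.

Lemma rip_delta m n (X : 'M[C]_(m, n)) i j :
  rip (delta_mx i 0) (X *m delta_mx j 0) = Re (X i j).
Proof.
rewrite ripE (bigD1 i) //= big1 ?addr0 => [|k ki]; last first.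
  by rewrite !mxE (negbTE ki) /= !mul0r addr0.
by rewrite -colE !mxE !eqxx /= mul1r mul0r addr0.
Qed.

Lemma iip_delta m n (X : 'M[C]_(m, n)) i j :
  iip (delta_mx i 0) (X *m delta_mx j 0) = Im (X i j).
Proof.
rewrite iipE (bigD1 i) //= big1 ?addr0 => [|k ki]; last first.
  by rewrite !mxE (negbTE ki) /= !mul0r subr0.
by rewrite -colE !mxE !eqxx /= mul1r mul0r subr0.
Qed.

Lemma bnd_Re m n (X : 'M[C]_(m, n)) c i j : bnd X c -> `|Re (X i j)| <= c.
Proof.
move=> h; rewrite -rip_delta; apply: le_trans (norm_rip_le _ _) _.
by rewrite nv_delta mul1r; apply: le_trans (h _) _; rewrite nv_delta mulr1.
Qed.

Lemma bnd_Im m n (X : 'M[C]_(m, n)) c i j : bnd X c -> `|Im (X i j)| <= c.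
Proof.
move=> h; rewrite -iip_delta; apply: le_trans (norm_iip_le _ _) _.
by rewrite nv_delta mul1r; apply: le_trans (h _) _; rewrite nv_delta mulr1.
Qed.

Lemma normc_le (x : C) : Normc.normc x <= `|Re x| + `|Im x|.
Proof.
case: x => a b /=; rewrite -[X in _ <= X]ger0_norm ?addr_ge0 // -sqrtr_sqr.
rewrite ler_sqrt ?sqr_ge0 // -[a ^+ 2]real_normK ?num_real//.
rewrite -[b ^+ 2]real_normK ?num_real//.
have := normr_ge0 a; have := normr_ge0 b; nra.
Qed.

Lemma nv_entries n (u : 'cV[C]_n) : nv u <= \sum_i Normc.normc (u i 0).
Proof.
have h0 x : 0 <= Normc.normc (x : C) by case: x => ? ?; apply: sqrtr_ge0.
have -> : u = \sum_i u i 0 *: delta_mx i 0.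
  apply/matrixP => i j; rewrite ord1 summxE (bigD1 i) //= big1 ?addr0.
    by rewrite !mxE !eqxx mulr1.
  by move=> k ki; rewrite !mxE eq_sym (negbTE ki) mulr0.
suff H (s : seq 'I_n) (f : 'I_n -> C) : nv (\sum_(i <- s) f i *: delta_mx i 0 : 'cV[C]_n)
    <= \sum_(i <- s) Normc.normc (f i).
  apply: le_trans (H _ _) _; rewrite le_eqVlt; apply/orP; left; apply/eqP.
  apply: eq_bigr => i _; congr (Normc.normc _).
  rewrite summxE (bigD1 i) //= big1 ?addr0; first by rewrite !mxE !eqxx mulr1.
  by move=> k ki; rewrite !mxE eq_sym (negbTE ki) mulr0.
elim: s => [|i s IH]; first by rewrite !big_nil nv0.
rewrite !big_cons; apply: le_trans (nvD _ _) _; rewrite lerD //.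
by rewrite nvZ nv_delta mulr1.
Qed.

Lemma normc_entry n (u : 'cV[C]_n) i : Normc.normc (u i 0) <= nv u.
Proof.
rewrite nv.unlock ripE (bigD1 i) //= -!expr2.
have -> (x : C) : Normc.normc x = Num.sqrt (Re x ^+ 2 + Im x ^+ 2) by case: x.
have h : 0 <= \sum_(j < n | j != i) (Re (u j 0) * Re (u j 0) + Im (u j 0) * Im (u j 0)).
  by apply: sumr_ge0 => k _; rewrite -!expr2 addr_ge0 ?sqr_ge0.
by rewrite ler_sqrt ?lerDl // !addr_ge0 ?sqr_ge0.
Qed.

(** Each entry has modulus at most 2 c, and each coordinate of [u] has modulus at most [nv u]; the
    bound sums this over all m n entries. *)
Lemma bnd_entries m n (X : 'M[C]_(m, n)) c : 0 <= c ->
  (forall i j, `|Re (X i j)| <= c /\ `|Im (X i j)| <= c) ->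
  bnd X (m%:R * n%:R * (2 * c)).
Proof.
move=> c0 h u; apply: le_trans (nv_entries _) _.
have -> : m%:R * n%:R * (2 * c) * nv u = \sum_(i < m) \sum_(j < n) (2 * c * nv u).
  by rewrite !sumr_const !card_ord -mulrnA -[RHS]mulr_natl mulnC natrM !mulrA.
apply: ler_sum => i _; rewrite mxE.
have h0 x : 0 <= Normc.normc (x : C) by case: x => ? ?; apply: sqrtr_ge0.
have H (s : seq 'I_n) (f : 'I_n -> C) :
    Normc.normc (\sum_(j <- s) f j) <= \sum_(j <- s) Normc.normc (f j).
  elim: s => [|j s IH]; first by rewrite !big_nil Normc.normc0.
  by rewrite !big_cons; apply: le_trans (le_normcD _ _) _; rewrite lerD.
apply: le_trans (H _ _) _; apply: ler_sum => j _.
rewrite Normc.normcM; apply: ler_pM => //; last exact: normc_entry.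
apply: le_trans (normc_le _) _; have [] := h i j; lra.
Qed.

End InnerProduct.

(** * The map Phi for a fixed matrix T *)

HB.lock Definition Bmx (R : realType) p (a : R) (M T : 'M[R[i]]_p) :=
  1%:M + a%:C *: (M *m T).
HB.lock Definition Gmx (R : realType) p (a : R) (M T : 'M[R[i]]_p) :=
  T *m invmx (Bmx a M T).

Section Transform.
Variables (R : realType) (p : nat) (a : R).
Hypothesis a_gt0 : 0 < a.
Local Notation C := R[i].
Implicit Types (M N T E X : 'M[C]_p) (u v : 'cV[C]_p) (y c K : R).

(* [Im M >= y M^* M]; for invertible [M] this says [Im M^-1 <= - y]. *)
Definition Qy y M := forall u, y * rip (M *m u) (M *m u) <= iip u (M *m u).

Local Notation Bmx := (Bmx a).
Local Notation Gmx := (Gmx a).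

Lemma BmxE M T : Bmx M T = 1%:M + a%:C *: (M *m T). Proof. by rewrite Bmx.unlock. Qed.

Lemma Gmx_mulB M T : Bmx M T \in unitmx -> Gmx M T *m Bmx M T = T.
Proof. by move=> h; rewrite Gmx.unlock mulmxKV. Qed.

Lemma Gmx_left M T : Bmx M T \in unitmx ->
  Gmx M T = T - a%:C *: (Gmx M T *m M *m T).
Proof.
move=> h; have := Gmx_mulB h; move: (Gmx M T) => G hG.
by rewrite -{1}hG BmxE mulmxDr mulmx1 -scalemxAr mulmxA addrK.
Qed.

(** Push-through identity T (1 + a M T)^-1 = (1 + a T M)^-1 T, put in a form that does not invert 1
    + a T M. *)
Lemma Gmx_right M T : Bmx M T \in unitmx ->
  Gmx M T = T - a%:C *: (T *m M *m Gmx M T).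
Proof.
move=> h; have := Gmx_mulB h; move: (Gmx M T) => G hG.
have e : (T - a%:C *: (T *m M *m G)) *m Bmx M T = T.
  rewrite mulmxBl -scalemxAl -[_ *m G *m _]mulmxA hG.
  by rewrite BmxE mulmxDr mulmx1 -scalemxAr mulmxA addrK.
exact: (can_inj (@mulmxK _ p p _ h) (etrans hG (esym e))).
Qed.

(** With w = G u and v = u - a M w one has w = T v. As T is Hermitian, <v, T v> is real, so only a
    <M w, w> contributes to the imaginary part of <u, w>. *)
Lemma iip_G M T u : T^t* = T -> Bmx M T \in unitmx ->
  iip u (Gmx M T *m u) = - (a * iip (Gmx M T *m u) (M *m (Gmx M T *m u))).
Proof.
move=> hT hB; set w := Gmx M T *m u.
pose v := u - a%:C *: (M *m w).
have wv : w = T *m v.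
  rewrite /w {1}Gmx_right // mulmxBl -scalemxAl /v mulmxBr -scalemxAr.
  by rewrite !mulmxA.
have -> : iip u w = iip v w + a * iip (M *m w) w.
  by rewrite /v iipBl iipZl subrK.
by rewrite {1}wv iip_herm // add0r (iipC (M *m w)) mulrN.
Qed.

(** The companion of [iip_G] for w = G^* u. In the contraction estimate the left vector is hit by an
    adjoint and the right one is not, so both versions are needed. *)
Lemma iip_Gadj M T u : T^t* = T -> Bmx M T \in unitmx ->
  iip u (Gmx M T *m u) =
  - (a * iip ((Gmx M T)^t* *m u) (M *m ((Gmx M T)^t* *m u))).
Proof.
move=> hT hB; set w := (Gmx M T)^t* *m u.
pose v := u - a%:C *: (M^t* *m w).
have wv : w = T *m v.
  rewrite /w {1}Gmx_left // adjB adjZ conj_real !adjM hT mulmxBl -scalemxAl.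
  by rewrite /v mulmxBr -scalemxAr /w !mulmxA.
rewrite iip_adjr -/w iipC.
have -> : iip u w = iip v w + a * iip (M^t* *m w) w.
  by rewrite /v iipBl iipZl subrK.
by rewrite {1}wv iip_herm // add0r iip_adj trmxCK.
Qed.

(** A kernel vector v satisfies v = - a M w with w = T v. Since <v, T v> is real, Im <w, M w> = 0,
    and then [Qy] forces M w = 0. *)
Lemma Bmx_unit y M T : 0 < y -> Qy y M -> T^t* = T -> Bmx M T \in unitmx.
Proof.
move=> y0 hM hT; apply: unitmx_inj => v.
rewrite BmxE mulmxDl mul1mx -scalemxAl -mulmxA; set w := T *m v => e.
have ve : v = - (a%:C *: (M *m w)) by apply/eqP; rewrite -addr_eq0 e.
have h0 : iip w (M *m w) = 0.
  have := iip_herm v hT; rewrite -/w {1}ve iipNl iipZl (iipC _ w) => /eqP.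
  by rewrite mulrN opprK mulf_eq0 gt_eqF //= => /eqP.
have : M *m w = 0.
  apply: rip_eq0; apply/eqP; rewrite eq_le rip_ge0 andbT.
  by rewrite -(ler_pM2l y0) mulr0 -h0.
by move=> Mw; rewrite ve Mw scaler0 oppr0.
Qed.

(* An upper bound for the norm of [T (1 + a M T)^-1] when [M] satisfies [Qy y] and
   [|T| <= c]. *)
Definition Kbound c y := 2 * c + c ^+ 2 * a / y.

Lemma Kbound_ge0 c y : 0 <= c -> 0 < y -> 0 <= Kbound c y.
Proof.
move=> c0 y0; rewrite /Kbound addr_ge0 ?mulr_ge0 ?exprn_ge0 ?invr_ge0 //.
  exact: ltW.
exact: ltW.
Qed.

(** For w = G u, the equation w = T (u - a M w) gives |w| <= c (|u| + a |M w|), and [iip_G] with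
    [Qy] gives a y |M w|^2 <= |u| |w|. The second inequality controls M w in the first, without any
    smallness of T. *)
Lemma Gmx_bnd y c M T : 0 < y -> 0 <= c -> Qy y M -> T^t* = T -> bnd T c ->
  bnd (Gmx M T) (Kbound c y).
Proof.
move=> y0 c0 hM hT bT u; have hB := Bmx_unit y0 hM hT.
set w := Gmx M T *m u.
have e1 : nv w <= c * (nv u + a * nv (M *m w)).
  have e : w = T *m (u - a%:C *: (M *m w)).
    by rewrite /w {1}Gmx_right // mulmxBl -scalemxAl mulmxBr -scalemxAr !mulmxA.
  rewrite {1}e.
  apply: le_trans (bT _) _; rewrite ler_wpM2l //.
  apply: le_trans (nvB _ _) _; by rewrite lerD2l nvZr gtr0_norm.
have e2 : a * (y * nv (M *m w) ^+ 2) <= nv u * nv w.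
  apply: (@le_trans _ _ (a * iip w (M *m w))).
    by rewrite ler_pM2l // sqr_nv; apply: hM.
  rewrite -[X in X <= _]opprK -iip_G // -/w.
  by have := norm_iip_le u w; rewrite ler_norml => /andP[h _]; rewrite lerNl.
have := nv_ge0 u; have := nv_ge0 w; have := nv_ge0 (M *m w).
move: (nv u) (nv w) (nv (M *m w)) e1 e2 => U W X e1 e2 X0 W0 U0.
(* Weighted AM-GM absorbs half of [W]. *)
have e3 : 2 * (c * a * X) <= c ^+ 2 * a / y * U + W.
  have [W00|Wn] := eqVneq W 0.
    have -> : X = 0.
      move: e2; rewrite W00 mulr0 (pmulr_rle0 _ a_gt0) (pmulr_rle0 _ y0).
      by rewrite le_eqVlt ltNge sqr_ge0 orbF sqrf_eq0 => /eqP.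
    by rewrite !mulr0 W00 addr0 !mulr_ge0 ?sqr_ge0 ?invr_ge0 // ltW.
  have Wp : 0 < W by rewrite lt_neqAle eq_sym Wn.
  rewrite -(@ler_pM2r _ W) //.
  apply: (@le_trans _ _ ((c * a * X) ^+ 2 + W ^+ 2)).
    rewrite -subr_ge0; have := sqr_ge0 (c * a * X - W); nra.
  rewrite mulrDl -expr2 lerD2r.
  have -> : c ^+ 2 * a / y * U * W = c ^+ 2 * a / y * (U * W) by rewrite mulrA.
  have -> : (c * a * X) ^+ 2 = c ^+ 2 * a / y * (a * (y * X ^+ 2)).
    by field; rewrite gt_eqF.
  by rewrite ler_wpM2l // !mulr_ge0 ?sqr_ge0 ?invr_ge0 // ltW.
rewrite /Kbound; move: e3; set k := c ^+ 2 * a / y; nra.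
Qed.

(** A resolvent identity in both arguments. When T = T', only a G (M - M') G' is left, with G on the
    outer left and G' on the outer right, which is what [iip_Gadj] and [iip_G] convert back into
    forms. *)
Lemma Gmx_lip M M' T T' : Bmx M T \in unitmx -> Bmx M' T' \in unitmx ->
  Gmx M' T' - Gmx M T =
  (1%:M - a%:C *: (Gmx M T *m M)) *m (T' - T) *m
    (1%:M - a%:C *: (M' *m Gmx M' T'))
  + a%:C *: (Gmx M T *m (M - M') *m Gmx M' T').
Proof.
move=> h h'; set G := Gmx M T; set G' := Gmx M' T'.
have e1 : (1%:M - a%:C *: (G *m M)) *m T = G.
  by rewrite mulmxBl mul1mx -scalemxAl -Gmx_left.
have e2 : T' *m (1%:M - a%:C *: (M' *m G')) = G'.
  by rewrite mulmxBr mulmx1 -scalemxAr mulmxA -Gmx_right.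
move: e1 e2; set L := 1%:M - _ *: (G *m M); set Q := 1%:M - a%:C *: (M' *m G') => e1 e2.
rewrite (mulmxBr L) e1 (mulmxBl (L *m T')) -(mulmxA L) e2 /L /Q.
rewrite mulmxBl mul1mx (mulmxBr G) mulmx1 -scalemxAl -scalemxAr.
rewrite (mulmxBr G) mulmxBl scalerBr !mulmxA.
move: (a%:C *: (G *m M *m G')) (a%:C *: (G *m M' *m G')) => X Y.
by apply/matrixP => i j; rewrite !mxE; ring.
Qed.

(* In the applications [E] is the expectation of [Gmx M T]. *)
Section FixedPointMap.
Variables (z : C) (E : 'M[C]_p).
Hypothesis z_gt0 : 0 < Im z.
Hypothesis E_le0 : forall u, iip u (E *m u) <= 0.
Let H := - z%:M + E.

Let iip_H u : iip u (H *m u) = - (Im z * rip u u) + iip u (E *m u).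
Proof. by rewrite /H mulmxDl mulNmx mul_scalar_mx iipDr iipNr iip_scalar. Qed.

Lemma phi_coercive u : Im z * nv u <= nv (H *m u).
Proof.
have [->|u0] := eqVneq u 0; first by rewrite mulmx0 !nv0 mulr0.
rewrite -(ler_pM2l (nv_gt0 u0)); apply: le_trans (norm_iip_le _ _).
rewrite -normrN; apply: le_trans (ler_norm _); rewrite iip_H -sqr_nv.
have := E_le0 u; nra.
Qed.

Lemma phi_unit : H \in unitmx.
Proof. exact: unitmx_nv z_gt0 phi_coercive. Qed.

Lemma phi_bnd : bnd (invmx H) (Im z)^-1.
Proof.
move=> u; rewrite mulrC ler_pdivlMr // mulrC.
by apply: le_trans (phi_coercive _) _; rewrite mulmxA mulmxV ?phi_unit // mul1mx.
Qed.

Lemma phi_form u : let v := invmx H *m u in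
  iip u v = Im z * rip v v - iip v (E *m v).
Proof.
move=> v; have {1}-> : u = H *m v by rewrite mulmxA mulmxV ?phi_unit // mul1mx.
by rewrite iipC iip_H opprD opprK.
Qed.

Lemma phi_form_adj u : let v := (invmx H)^t* *m u in
  iip u (invmx H *m u) = Im z * rip v v - iip v (E *m v).
Proof.
move=> v; have uv : u = H^t* *m v.
  by rewrite mulmxA -adjM mulVmx ?phi_unit // adj1 mul1mx.
rewrite (iip_adjr (invmx H)) -/v {1}uv -(iip_adj H) iipC.
by rewrite iip_H opprD opprK.
Qed.

Lemma phi_Qy : Qy (Im z) (invmx H).
Proof.
move=> u; rewrite phi_form /=; have := E_le0 (invmx H *m u); lra.
Qed.

Lemma bnd_H K : bnd E K -> bnd H (Normc.normc z + K).
Proof.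
move=> bE; apply: bndD => //; apply: bndN => u.
by rewrite mul_scalar_mx nvZ.
Qed.

(** Here u = H v has norm at most (|z| + K) |v|, which turns [phi_Qy] into a bound by |u|^2. It
    gives strict positivity of Im M and lets a norm bound start the contraction argument. *)
Lemma phi_lower K u : 0 <= K -> bnd E K ->
  Im z / (Normc.normc z + K) ^+ 2 * rip u u <= iip u (invmx H *m u).
Proof.
move=> K0 bE; apply: le_trans (phi_Qy u); rewrite -mulrA ler_pM2l //.
set v := invmx H *m u; have uv : u = H *m v.
  by rewrite mulmxA mulmxV ?phi_unit // mul1mx.
have z0 : 0 < Normc.normc z.
  by case: (z) z_gt0 => x y /= y0; rewrite sqrtr_gt0 ltr_wpDl ?sqr_ge0 ?exprn_gt0.
have hu : nv u <= (Normc.normc z + K) * nv v by rewrite {1}uv; exact: bnd_H.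
have k0 : 0 < Normc.normc z + K by rewrite ltr_wpDr.
rewrite mulrC ler_pdivrMr ?exprn_gt0 // [X in _ <= X]mulrC -!sqr_nv -exprMn.
by rewrite ler_pXn2r ?nnegrE ?mulr_ge0 ?nv_ge0 // ltW.
Qed.

(** The form equals - Im <v, H v>, hence is at most |H| |v|^2. Compared with [phi_form_adj], this
    says that (Im z) |v|^2 is at least the fraction (Im z) / (|z| + K) of the form, which is the
    origin of [contraction_rate]. *)
Lemma phi_upper_adj K u : bnd E K ->
  iip u (invmx H *m u) <=
  (Normc.normc z + K) * rip ((invmx H)^t* *m u) ((invmx H)^t* *m u).
Proof.
move=> bE; rewrite phi_form_adj; set v := _ *m u.
have <- : - iip v (H *m v) = Im z * rip v v - iip v (E *m v).
  by rewrite iip_H opprD opprK.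
apply: le_trans (ler_norm _) _; rewrite normrN.
apply: le_trans (norm_iip_le _ _) _; rewrite -sqr_nv expr2 mulrCA ler_wpM2l ?nv_ge0 //.
exact: bnd_H.
Qed.

Lemma phi_upper K u : bnd E K ->
  iip u (invmx H *m u) <=
  (Normc.normc z + K) * rip (invmx H *m u) (invmx H *m u).
Proof.
move=> bE; rewrite phi_form; set v := _ *m u.
have <- : - iip v (H *m v) = Im z * rip v v - iip v (E *m v).
  by rewrite iip_H opprD opprK.
apply: le_trans (ler_norm _) _; rewrite normrN.
apply: le_trans (norm_iip_le _ _) _; rewrite -sqr_nv expr2 mulrCA ler_wpM2l ?nv_ge0 //.
exact: bnd_H.
Qed.

End FixedPointMap.

Lemma phi_diff (z : C) E1 E2 : - z%:M + E1 \in unitmx -> - z%:M + E2 \in unitmx ->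
  invmx (- z%:M + E1) - invmx (- z%:M + E2) =
  invmx (- z%:M + E1) *m (E2 - E1) *m invmx (- z%:M + E2).
Proof.
move=> u1 u2; have -> : E2 - E1 = (- z%:M + E2) - (- z%:M + E1).
  by apply/matrixP => i j; rewrite !mxE; ring.
by rewrite mulmxBr mulmxBl mulVmx // mul1mx -mulmxA mulmxV // mulmx1.
Qed.

End Transform.

(** * Complex and matrix integrals *)

Section ComplexIntegral.
Context d (T : measurableType d) (R : realType).
Implicit Types (f g : T -> R[i]) (mu : {measure set T -> \bar R}).

Definition Cmeas f :=
  measurable_fun setT (fun x => Re (f x)) /\ measurable_fun setT (fun x => Im (f x)).

Lemma Cmeas_cst c : Cmeas (fun=> c). Proof. by split. Qed.
Lemma eq_Cmeas f g : f =1 g -> Cmeas f -> Cmeas g.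
Proof. by move=> /funext ->. Qed.
Lemma CmeasD f g : Cmeas f -> Cmeas g -> Cmeas (fun x => f x + g x).
Proof.
move=> [fr fi] [gr gi]; split.
  by under eq_fun do rewrite ReD; exact: measurable_funD.
by under eq_fun do rewrite ImD; exact: measurable_funD.
Qed.
Lemma CmeasN f : Cmeas f -> Cmeas (fun x => - f x).
Proof.
move=> [fr fi]; split.
  by under eq_fun do rewrite ReN; exact: measurable_funN.
by under eq_fun do rewrite ImN; exact: measurable_funN.
Qed.
Lemma CmeasM f g : Cmeas f -> Cmeas g -> Cmeas (fun x => f x * g x).
Proof.
move=> [fr fi] [gr gi]; split.
  under eq_fun do rewrite ReM.
  by apply: measurable_funB; exact: measurable_funM.
under eq_fun do rewrite ImM.
by apply: measurable_funD; exact: measurable_funM.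
Qed.
Lemma Cmeas_sum I (r : seq I) (P : pred I) (F : I -> T -> R[i]) :
  (forall i, P i -> Cmeas (F i)) -> Cmeas (fun x => \sum_(i <- r | P i) F i x).
Proof.
move=> h; elim: r => [|i r IH].
  by apply: (@eq_Cmeas (fun=> 0)); [move=> x; rewrite big_nil|exact: Cmeas_cst].
case Pi : (P i).
  apply: (@eq_Cmeas (fun x => F i x + \sum_(j <- r | P j) F j x)).
    by move=> x; rewrite big_cons Pi.
  exact: CmeasD (h i Pi) IH.
by apply: eq_Cmeas IH => x; rewrite big_cons Pi.
Qed.
Lemma Cmeas_prod I (r : seq I) (P : pred I) (F : I -> T -> R[i]) :
  (forall i, P i -> Cmeas (F i)) -> Cmeas (fun x => \prod_(i <- r | P i) F i x).
Proof.
move=> h; elim: r => [|i r IH].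
  by apply: (@eq_Cmeas (fun=> 1)); [move=> x; rewrite big_nil|exact: Cmeas_cst].
case Pi : (P i).
  apply: (@eq_Cmeas (fun x => F i x * \prod_(j <- r | P j) F j x)).
    by move=> x; rewrite big_cons Pi.
  exact: CmeasM (h i Pi) IH.
by apply: eq_Cmeas IH => x; rewrite big_cons Pi.
Qed.

Lemma measurable_invr (h : T -> R) :
  measurable_fun setT h -> measurable_fun setT (fun x => (h x)^-1).
Proof.
move=> mh; have mi : measurable_fun setT (fun y : R => y^-1).
  (* [y / (y^2 + 1/(n+1))] is continuous in [y] and tends to [y^-1], including [0^-1 = 0] *)
  apply: (@measurable_fun_cvg _ _ _ _ (fun n (y : R) => y * (y ^+ 2 + n.+1%:R^-1)^-1)).
    move=> n; apply: continuous_measurable_fun => y.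
    apply: cvgM; first exact: cvg_id.
    apply: cvgV; first by rewrite gt_eqF // ltr_wpDl ?sqr_ge0.
    apply: cvgD; last exact: cvg_cst.
    by apply: cvgM; exact: cvg_id.
  move=> y _; have [->|y0] := eqVneq y 0.
    rewrite invr0; apply: (@cvg_trans _ ((fun=> 0 : R) @ \oo)); last exact: cvg_cst.
    by apply: near_eq_cvg; near=> n; rewrite mul0r.
  have -> : y^-1 = y * (y ^+ 2 + 0)^-1 by rewrite addr0; field.
  apply: cvgM; first exact: cvg_cst.
  apply: cvgV; first by rewrite addr0 sqrf_eq0.
  apply: cvgD; first exact: cvg_cst.
  exact: cvg_harmonic.
exact: measurableT_comp.
Unshelve. all: by end_near. Qed.

Lemma CmeasV f : Cmeas f -> Cmeas (fun x => (f x)^-1).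
Proof.
move=> [fr fi].
have m2 : measurable_fun setT (fun x => (Re (f x) ^+ 2 + Im (f x) ^+ 2)^-1).
  by apply: measurable_invr; apply: measurable_funD; exact: measurable_funX.
split.
  by under eq_fun do rewrite ReV; exact: measurable_funM.
under eq_fun do rewrite ImV.
by apply: measurable_funM => //; exact: measurable_funN.
Qed.

Lemma eq_Cintegrable mu f g : f =1 g -> Cintegrable mu f -> Cintegrable mu g.
Proof. by move=> /funext ->. Qed.

Lemma CintegrableD mu f g :
  Cintegrable mu f -> Cintegrable mu g -> Cintegrable mu (fun x => f x + g x).
Proof.
move=> [fr fi] [gr gi]; split.
  under eq_fun do rewrite ReD EFinD; exact: integrableD.
under eq_fun do rewrite ImD EFinD; exact: integrableD.
Qed.

Lemma CintegrableZ mu c f : Cintegrable mu f -> Cintegrable mu (fun x => c * f x).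
Proof.
move=> [fr fi]; split.
  under eq_fun do rewrite ReM EFinB.
  by apply: integrableB => //; under eq_fun do rewrite EFinM; exact: integrableZl.
under eq_fun do rewrite ImM EFinD.
by apply: integrableD => //; under eq_fun do rewrite EFinM; exact: integrableZl.
Qed.

Lemma Cintegrable0 mu : Cintegrable mu (fun=> 0).
Proof. by split; exact: integrable0. Qed.

Lemma CintegralD mu f g : Cintegrable mu f -> Cintegrable mu g ->
  Cintegral mu (fun x => f x + g x) = Cintegral mu f + Cintegral mu g.
Proof.
move=> [fr fi] [gr gi]; apply: complex_ext; rewrite ?ReD ?ImD /=.
  by under eq_Rintegral do rewrite ReD; rewrite RintegralD.
by under eq_Rintegral do rewrite ImD; rewrite RintegralD.
Qed.

Lemma CintegralZ mu c f : Cintegrable mu f ->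
  Cintegral mu (fun x => c * f x) = c * Cintegral mu f.
Proof.
move=> [fr fi].
have fz (k : R) (h : T -> R) : mu.-integrable setT (EFin \o h) ->
    mu.-integrable setT (EFin \o (fun x => k * h x)).
  by move=> ih; rewrite /comp; under eq_fun do rewrite EFinM; exact: integrableZl.
apply: complex_ext; rewrite ?ReM ?ImM /=.
  under eq_Rintegral do rewrite ReM.
  by rewrite RintegralB // ?RintegralZl //; exact: fz.
under eq_Rintegral do rewrite ImM.
by rewrite RintegralD // ?RintegralZl //; exact: fz.
Qed.

Lemma eq_Cintegral mu f g : f =1 g -> Cintegral mu f = Cintegral mu g.
Proof. by move=> /funext ->. Qed.

Lemma Cintegral0 mu : Cintegral mu (fun=> 0) = 0.
Proof. by apply: complex_ext => /=; rewrite /Rintegral integral0. Qed.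

Lemma Cintegrable_sum mu I (r : seq I) (P : pred I) (F : I -> T -> R[i]) :
  (forall i, P i -> Cintegrable mu (F i)) ->
  Cintegrable mu (fun x => \sum_(i <- r | P i) F i x).
Proof.
move=> h; elim: r => [|i r IH].
  by apply: (@eq_Cintegrable _ (fun=> 0)); [move=> x; rewrite big_nil|exact: Cintegrable0].
case Pi : (P i).
  apply: (@eq_Cintegrable _ (fun x => F i x + \sum_(j <- r | P j) F j x)).
    by move=> x; rewrite big_cons Pi.
  exact: CintegrableD (h i Pi) IH.
by apply: eq_Cintegrable IH => x; rewrite big_cons Pi.
Qed.

Lemma Cintegral_sum mu I (r : seq I) (P : pred I) (F : I -> T -> R[i]) :
  (forall i, P i -> Cintegrable mu (F i)) ->
  Cintegral mu (fun x => \sum_(i <- r | P i) F i x) =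
  \sum_(i <- r | P i) Cintegral mu (F i).
Proof.
move=> h; elim: r => [|i r IH].
  by rewrite big_nil -[RHS](Cintegral0 mu); apply: eq_Cintegral => x; rewrite big_nil.
rewrite big_cons; case Pi : (P i); rewrite -IH.
  rewrite -CintegralD; [|exact: h|exact: Cintegrable_sum].
  by apply: eq_Cintegral => x; rewrite big_cons Pi.
by apply: eq_Cintegral => x; rewrite big_cons Pi.
Qed.

Lemma bounded_integrable mu (h : T -> R) (c : R) : (mu setT < +oo)%E ->
  measurable_fun setT h -> (forall x, `|h x| <= c) -> mu.-integrable setT (EFin \o h).
Proof.
move=> muf mh hc; apply: measurable_bounded_integrable => //.
exists c; split; first exact: num_real.
by move=> M cM x _; apply: le_trans (hc x) _; exact: ltW.
Qed.

Lemma Cintegrable_bounded mu f (c : R) : (mu setT < +oo)%E ->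
  Cmeas f -> (forall x, `|Re (f x)| <= c /\ `|Im (f x)| <= c) -> Cintegrable mu f.
Proof.
move=> muf [fr fi] h; split.
  by apply: (@bounded_integrable _ _ c) => // x; case: (h x).
by apply: (@bounded_integrable _ _ c) => // x; case: (h x).
Qed.

Lemma Cintegral_ae mu f g : Cmeas f -> Cmeas g -> {ae mu, forall x, f x = g x} ->
  Cintegral mu f = Cintegral mu g.
Proof.
move=> [fr fi] [gr gi] fg; apply: complex_ext; congr fine; apply: ae_eq_integral => //.
- exact/measurable_EFinP.
- exact/measurable_EFinP.
- by apply: filterS fg => x /= -> _.
- exact/measurable_EFinP.
- exact/measurable_EFinP.
- by apply: filterS fg => x /= -> _.
Qed.

End ComplexIntegral.

Section MatrixIntegral.
Context d (T : measurableType d) (R : realType) (mu : {measure set T -> \bar R}).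
Variable p : nat.
Implicit Types (G : T -> 'M[R[i]]_p) (u v : 'cV[R[i]]_p).

Lemma form_sum (X : 'M[R[i]]_p) u v :
  (u^t* *m X *m v) 0 0 = \sum_i \sum_j Num.conj (u i 0) * v j 0 * X i j.
Proof.
rewrite mxE exchange_big /=; apply: eq_bigr => j _; rewrite mxE mulr_suml.
by apply: eq_bigr => i _; rewrite !mxE mulrAC.
Qed.

Lemma form_mxintegral G u v : mxintegrable mu G ->
  (u^t* *m mxintegral mu G *m v) 0 0 =
  Cintegral mu (fun w => (u^t* *m G w *m v) 0 0).
Proof.
move=> hG; rewrite form_sum; under eq_Cintegral do rewrite form_sum.
have h i j : Cintegrable mu (fun w => Num.conj (u i 0) * v j 0 * G w i j).
  exact/CintegrableZ.
rewrite Cintegral_sum => [|i _]; last by apply: Cintegrable_sum => j _; exact: h.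
apply: eq_bigr => i _; rewrite Cintegral_sum => [|j _]; last exact: h.
by apply: eq_bigr => j _; rewrite mxE CintegralZ.
Qed.

Lemma form_integrable G u v : mxintegrable mu G ->
  Cintegrable mu (fun w => (u^t* *m G w *m v) 0 0).
Proof.
move=> hG; apply: eq_Cintegrable => [w|]; first by rewrite form_sum.
by apply: Cintegrable_sum => i _; apply: Cintegrable_sum => j _; exact: CintegrableZ.
Qed.

Lemma rip_mxintegral G u v : mxintegrable mu G ->
  rip u (mxintegral mu G *m v) = \int[mu]_w rip u (G w *m v).
Proof.
move=> hG; rewrite rip.unlock mulmxA form_mxintegral //=.
by apply: eq_Rintegral => w _; rewrite mulmxA.
Qed.

Lemma iip_mxintegral G u v : mxintegrable mu G ->
  iip u (mxintegral mu G *m v) = \int[mu]_w iip u (G w *m v).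
Proof.
move=> hG; rewrite iip.unlock mulmxA form_mxintegral //=.
by apply: eq_Rintegral => w _; rewrite mulmxA.
Qed.

Lemma rip_integrable G u v : mxintegrable mu G ->
  mu.-integrable setT (EFin \o (fun w => rip u (G w *m v))).
Proof.
move=> /(form_integrable u v)[+ _]; apply: eq_integrable => // w _ /=.
by rewrite rip.unlock mulmxA.
Qed.

Lemma iip_integrable G u v : mxintegrable mu G ->
  mu.-integrable setT (EFin \o (fun w => iip u (G w *m v))).
Proof.
move=> /(form_integrable u v)[_]; apply: eq_integrable => // w _ /=.
by rewrite iip.unlock mulmxA.
Qed.

End MatrixIntegral.

(** * The fixed point *)

Section Expectation.
Context d (Omega : measurableType d) (R : realType) (P : probability Omega R).
Variables (p : nat) (a : R).
Hypothesis a_gt0 : 0 < a.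
Local Notation C := R[i].
Implicit Types (S : Omega -> 'M[R]_p) (M : 'M[C]_p) (u v : 'cV[C]_p) (y c : R).

Definition GS S M w := Gmx a M (complexmx (S w)).
Definition ES S M := mxintegral P (GS S M).
Definition Phi S (z : C) M := invmx (- z%:M + ES S M).

(** The conditions hold at every point, not just almost everywhere, so that the pointwise estimates
    need no exceptional set. *)
Record regular S c := Regular {
  reg_sym : forall w, (S w)^T = S w;
  reg_meas : forall i j, measurable_fun setT (fun w => S w i j);
  reg_bnd : forall w, bnd (complexmx (S w)) c }.

Lemma complexmx_adj (A : 'M[R]_p) : (complexmx A)^t* = complexmx A^T.
Proof. by apply/matrixP => i j; rewrite !mxE conj_real. Qed.

Lemma P_fin : (P setT < +oo)%E. Proof. by rewrite probability_setT ltry. Qed.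

Lemma Cmeas_det n (A : Omega -> 'M[C]_n) :
  (forall i j, Cmeas (fun w => A w i j)) -> Cmeas (fun w => \det (A w)).
Proof.
move=> h; apply: Cmeas_sum => s _; apply: CmeasM; first exact: Cmeas_cst.
by apply: Cmeas_prod => i _.
Qed.

Lemma Cmeas_mulmx l m n (A : Omega -> 'M[C]_(l, m)) (B : Omega -> 'M[C]_(m, n)) :
  (forall i j, Cmeas (fun w => A w i j)) -> (forall i j, Cmeas (fun w => B w i j)) ->
  forall i j, Cmeas (fun w => (A w *m B w) i j).
Proof.
move=> hA hB i j.
apply: (@eq_Cmeas _ _ _ (fun w => \sum_k A w i k * B w k j)).
  by move=> w; rewrite mxE.
by apply: Cmeas_sum => k _; exact: CmeasM.
Qed.

(* [invmx A = A] on singular matrices, where [(\det A)^-1 * \det A = 0]. *)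
Lemma Cmeas_invmx n (A : Omega -> 'M[C]_n) : (forall i j, Cmeas (fun w => A w i j)) ->
  forall i j, Cmeas (fun w => invmx (A w) i j).
Proof.
move=> h i j; have mdet := Cmeas_det h.
apply: (@eq_Cmeas _ _ _ (fun w => (\det (A w))^-1 *
    ((-1) ^+ (j + i) * \det (row' j (col' i (A w)))) +
    (1 + - ((\det (A w))^-1 * \det (A w))) * A w i j)).
  move=> w; rewrite /invmx unitmxE unitfE; case: eqVneq => [->|d0].
    by rewrite invr0 !mul0r oppr0 addr0 mul1r add0r.
  by rewrite mulVf // subrr mul0r addr0 !mxE.
apply: CmeasD; last first.
  apply: CmeasM => //; apply: CmeasD; first exact: Cmeas_cst.
  by apply: CmeasN; apply: CmeasM => //; exact: CmeasV.
apply: CmeasM; first exact: CmeasV.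
apply: CmeasM; first exact: Cmeas_cst.
apply: Cmeas_det => k l; apply: eq_Cmeas (h (lift j k) (lift i l)) => w.
by rewrite !mxE.
Qed.

Lemma GS_meas S M : (forall i j, measurable_fun setT (fun w => S w i j)) ->
  forall i j, Cmeas (fun w => GS S M w i j).
Proof.
move=> mS i j; rewrite /GS Gmx.unlock.
have mT k l : Cmeas (fun w => complexmx (S w) k l).
  apply: (@eq_Cmeas _ _ _ (fun w => (S w k l)%:C)); first by move=> w; rewrite mxE.
  by split => /=; [exact: mS | exact: measurable_cst].
apply: Cmeas_mulmx => //; apply: Cmeas_invmx => // k l.
rewrite Bmx.unlock.
apply: (@eq_Cmeas _ _ _ (fun w => (1%:M : 'M[C]_p) k l + a%:C * (M *m complexmx (S w)) k l)).
  by move=> w; rewrite !mxE.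
apply: CmeasD; first exact: Cmeas_cst.
apply: CmeasM; first exact: Cmeas_cst.
by apply: Cmeas_mulmx => // i' j'; exact: Cmeas_cst.
Qed.

Section Regular.
Variables (S : Omega -> 'M[R]_p) (c y : R) (M : 'M[C]_p).
Hypothesis rS : regular S c.
Hypothesis c0 : 0 <= c.
Hypothesis y0 : 0 < y.
Hypothesis hM : Qy y M.
Local Notation K := (Kbound a c y).

Let T_herm w : (complexmx (S w))^t* = complexmx (S w).
Proof. by rewrite complexmx_adj (reg_sym rS). Qed.

Lemma GS_unit w : Bmx a M (complexmx (S w)) \in unitmx.
Proof. by apply: Bmx_unit y0 hM _. Qed.

Lemma GS_bnd w : bnd (GS S M w) K.
Proof. by apply: Gmx_bnd => //; apply: reg_bnd rS w. Qed.

Lemma GS_int : mxintegrable P (GS S M).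
Proof.
move=> i j; apply: (@Cintegrable_bounded _ _ _ _ _ K); first exact: P_fin.
  exact: (GS_meas M (reg_meas rS)).
by move=> w; split; [apply: bnd_Re | apply: bnd_Im]; exact: GS_bnd.
Qed.

Lemma GS_iip_le0 u w : iip u (GS S M w *m u) <= 0.
Proof.
rewrite /GS iip_G ?GS_unit // oppr_le0 mulr_ge0 //; first exact: ltW.
by apply: (le_trans _ (hM _)); rewrite mulr_ge0 ?rip_ge0 // ltW.
Qed.

Lemma ES_iip_le0 u : iip u (ES S M *m u) <= 0.
Proof.
rewrite iip_mxintegral; last exact: GS_int.
rewrite -oppr_ge0 -mulN1r -RintegralZl //; last exact: iip_integrable GS_int.
by apply: Rintegral_ge0 => w _; rewrite mulN1r oppr_ge0 GS_iip_le0.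
Qed.

End Regular.

Lemma mxintegral_bnd (G : Omega -> 'M[C]_p) c : 0 <= c -> mxintegrable P G ->
  (forall w, bnd (G w) c) -> bnd (mxintegral P G) c.
Proof.
move=> c0 iG hG; apply: bnd_rip => // u v; rewrite rip_mxintegral //.
have -> : c * (nv u * nv v) = \int[P]_w (c * (nv u * nv v)).
  by rewrite Rintegral_cst // [X in fine X](@probability_setT _ _ _ P) mulr1.
apply: le_Rintegral => //.
- exact: rip_integrable.
- by apply: (@bounded_integrable _ _ _ _ _ `|c * (nv u * nv v)|); first exact: P_fin.
- by move=> w _; exact: rip_bnd.
Qed.

Lemma mxintegralB (G H : Omega -> 'M[C]_p) : mxintegrable P G -> mxintegrable P H ->
  mxintegrable P (fun w => G w - H w) /\
  mxintegral P (fun w => G w - H w) = mxintegral P G - mxintegral P H.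
Proof.
move=> iG iH.
have iN i j : Cintegrable P (fun w => -1 * H w i j) by exact: CintegrableZ.
split.
  move=> i j; apply: eq_Cintegrable (CintegrableD (iG i j) (iN i j)) => w.
  by rewrite !mxE mulN1r.
apply/matrixP => i j; rewrite !mxE -[X in _ - X]mul1r -mulNr -CintegralZ //.
by rewrite -CintegralD //; apply: eq_Cintegral => w; rewrite !mxE mulN1r.
Qed.

Lemma ES_bnd S c y M : regular S c -> 0 <= c -> 0 < y -> Qy y M ->
  bnd (ES S M) (Kbound a c y).
Proof.
move=> rS c0 y0 hM; apply: mxintegral_bnd; first exact: Kbound_ge0.
  exact: GS_int rS c0 y0 hM.
by move=> w; exact: GS_bnd rS c0 y0 hM w.
Qed.

Section PhiFacts.
Variables (S : Omega -> 'M[R]_p) (c y : R) (z : C).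
Hypothesis rS : regular S c.
Hypothesis c0 : 0 <= c.
Hypothesis y0 : 0 < y.
Hypothesis z0 : 0 < Im z.
Local Notation K := (Kbound a c y).

Lemma Phi_Qy M : Qy y M -> Qy (Im z) (Phi S z M).
Proof. by move=> hM; apply: phi_Qy => // u; exact: ES_iip_le0 rS c0 y0 hM u. Qed.

Lemma Phi_bnd M : Qy y M -> bnd (Phi S z M) (Im z)^-1.
Proof. by move=> hM; apply: phi_bnd => // u; exact: ES_iip_le0 rS c0 y0 hM u. Qed.

Lemma Phi_unit M : Qy y M -> - z%:M + ES S M \in unitmx.
Proof. by move=> hM; apply: phi_unit => // u; exact: ES_iip_le0 rS c0 y0 hM u. Qed.

Lemma Phi_lower M u : Qy y M ->
  Im z / (Normc.normc z + K) ^+ 2 * rip u u <= iip u (Phi S z M *m u).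
Proof.
move=> hM; apply: phi_lower => //; [|exact: Kbound_ge0|exact: ES_bnd].
by move=> v; exact: ES_iip_le0 rS c0 y0 hM v.
Qed.

Definition contraction_rate := 1 - Im z / (Normc.normc z + K).

Lemma normc_gt0 : 0 < Normc.normc z.
Proof.
by case: (z) z0 => s t /= t0; rewrite sqrtr_gt0 ltr_wpDl ?sqr_ge0 ?exprn_gt0.
Qed.

Lemma normc_K_gt0 : 0 < Normc.normc z + K.
Proof. by rewrite ltr_wpDr ?Kbound_ge0 // normc_gt0. Qed.

Lemma contraction_rate_ge0 : 0 <= contraction_rate.
Proof.
rewrite /contraction_rate subr_ge0 ler_pdivrMr ?normc_K_gt0 // mul1r.
apply: ler_wpDr; first exact: Kbound_ge0.
case: (z) => s t /=; apply: le_trans (ler_norm _) _; rewrite -sqrtr_sqr.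
by rewrite ler_sqrt ?addr_ge0 ?sqr_ge0 // lerDr sqr_ge0.
Qed.

Lemma contraction_rate_lt1 : contraction_rate < 1.
Proof. by rewrite /contraction_rate ltrBlDr ltrDl divr_gt0 ?normc_K_gt0. Qed.

(** By [phi_diff] the difference is Phi_1 (E_2 - E_1) Phi_2. Put x = Phi_1^* u and t = Phi_2 v.
    Under the integral, [Gmx_lip] leaves a G_1 (M1 - M2) G_2, and the hypothesis at G_1^* x and G_2
    t returns exactly - k times the forms of G_1 at x and of G_2 at t. So far nothing is lost; the
    factor [contraction_rate] comes from passing from E to Phi. *)
Lemma Phi_contract M1 M2 (k : R) : Qy y M1 -> Qy y M2 -> 0 <= k ->
  (forall u v, 2 * rip u ((M1 - M2) *m v) <=
               k * (iip u (M1 *m u) + iip v (M2 *m v))) ->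
  forall u v, 2 * rip u ((Phi S z M1 - Phi S z M2) *m v) <=
    k * contraction_rate *
    (iip u (Phi S z M1 *m u) + iip v (Phi S z M2 *m v)).
Proof.
move=> h1 h2 k0 hD u v.
have e1 u' : iip u' (ES S M1 *m u') <= 0 by exact: ES_iip_le0 rS c0 y0 h1 u'.
have e2 u' : iip u' (ES S M2 *m u') <= 0 by exact: ES_iip_le0 rS c0 y0 h2 u'.
have T_herm w : (complexmx (S w))^t* = complexmx (S w).
  by rewrite complexmx_adj (reg_sym rS).
have u1 w := GS_unit rS y0 h1 w; have u2 w := GS_unit rS y0 h2 w.
have i1 := GS_int rS c0 y0 h1; have i2 := GS_int rS c0 y0 h2.
rewrite {1}/Phi {1}/Phi phi_diff; [|exact: phi_unit|exact: phi_unit].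
rewrite -/(Phi S z M1) -/(Phi S z M2) -!mulmxA rip_adjr.
set x := _ *m u; set t := _ *m v.
have [iB <-] := mxintegralB i2 i1; rewrite rip_mxintegral //.
have key w : 2 * rip x ((GS S M2 w - GS S M1 w) *m t) <=
    - k * (iip x (GS S M1 w *m x) + iip t (GS S M2 w *m t)).
  rewrite /GS (Gmx_lip (u1 w) (u2 w)) subrr mulmx0 mul0mx add0r.
  rewrite -scalemxAl ripZr -!mulmxA rip_adjr.
  rewrite (iip_Gadj x (T_herm w) (u1 w)) (iip_G t (T_herm w) (u2 w)).
  rewrite mulrCA -opprD -mulrDr mulrNN [X in _ <= X]mulrCA ler_pM2l //.
have le1 : 2 * \int[P]_w rip x ((GS S M2 w - GS S M1 w) *m t) <=
    - k * (iip x (ES S M1 *m x) + iip t (ES S M2 *m t)).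
  rewrite !iip_mxintegral // -RintegralD //; try exact: iip_integrable.
  rewrite -!RintegralZl //; first last.
  - exact: rip_integrable.
  - rewrite /comp; under eq_fun do rewrite EFinD.
    by apply: integrableD => //; exact: iip_integrable.
  apply: le_Rintegral => //.
  - rewrite /comp; under eq_fun do rewrite EFinM.
    by apply: integrableZl => //; exact: rip_integrable.
  - rewrite /comp; under eq_fun do rewrite EFinM EFinD.
    apply: integrableZl => //; apply: integrableD => //; exact: iip_integrable.
apply: le_trans le1 _.
have K1 := ES_bnd rS c0 y0 h1; have K2 := ES_bnd rS c0 y0 h2.
have f1 := phi_form_adj z0 e1 u; have f2 := phi_form z0 e2 v.
rewrite -/(Phi S z M1) /= -/x in f1; rewrite -/(Phi S z M2) /= -/t in f2.
have g1 := phi_upper_adj z0 e1 u K1; have g2 := phi_upper z0 e2 v K2.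
rewrite -/(Phi S z M1) -/x in g1; rewrite -/(Phi S z M2) -/t in g2.
(* The forms of - E at x and t are those of Phi minus (Im z) |x|^2 and (Im z) |t|^2; [aux] bounds
   the subtracted terms below by a fraction of the forms of Phi. *)
have aux X s : X <= (Normc.normc z + K) * s ->
    Im z / (Normc.normc z + K) * X <= Im z * s.
  move=> h; rewrite -mulrA ler_pM2l // mulrC ler_pdivrMr ?normc_K_gt0 //.
  by rewrite mulrC.
have {}g1 := aux _ _ g1; have {}g2 := aux _ _ g2.
rewrite mulNr -mulrN -mulrA ler_wpM2l // /contraction_rate.
move: f1 f2 g1 g2; rewrite -/t; move: (Im z) (Im z / _).
move: (iip u _) (iip v _) (rip x x) (rip t t) (iip x _) (iip t _).
move=> A1 A2 B1 B2 E1 E2 yz e; lra.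
Qed.

End PhiFacts.
End Expectation.

(** * Limits of matrices in operator norm *)

Section MatrixLimits.
Variables (R : realType) (p : nat).
Local Notation C := R[i].
Implicit Types (X : nat -> 'M[C]_p) (L D : 'M[C]_p) (u v : 'cV[C]_p).

Lemma le0_geometric (x c r : R) : 0 <= r -> r < 1 ->
  (forall n, x <= c * r ^+ n) -> x <= 0.
Proof.
move=> r0 r1 h; have hc : geometric c r @ \oo --> (0 : R).
  by apply: cvg_geometric; rewrite ger0_norm.
by apply: (cvgr_to_ge hc); apply: nearW => n; exact: h.
Qed.

Lemma form_eq0 D : (forall u v, rip u (D *m v) <= 0) -> D = 0.
Proof.
move=> h; apply/matrixP => i j; rewrite mxE.
have e v : D *m v = 0.
  by apply: rip_eq0; apply/eqP; rewrite eq_le rip_ge0 andbT h.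
by have /matrixP/(_ i 0) := e (delta_mx j 0); rewrite -colE !mxE.
Qed.

Lemma form_bnd D (k : R) : 0 < k ->
  (forall u v, 2 * rip u (D *m v) <= k * (rip u u + rip v v)) -> bnd D k.
Proof.
(* For u = k^-1 D v the left side becomes 2 k |u|^2, so the inequality reads |u| <= |v|. *)
move=> k0 h v; have := h ((k^-1)%:C *: (D *m v)) v.
rewrite !ripZl ripZr -!sqr_nv.
have -> : 2 * (k^-1 * nv (D *m v) ^+ 2) = k * (2 * (nv (D *m v) / k) ^+ 2).
  by field; rewrite gt_eqF.
have -> : k^-1 * (k^-1 * nv (D *m v) ^+ 2) = (nv (D *m v) / k) ^+ 2.
  by field; rewrite gt_eqF.
rewrite ler_pM2l // => {}h.
have {h} : (nv (D *m v) / k) ^+ 2 <= nv v ^+ 2 by lra.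
rewrite ler_pXn2r ?nnegrE ?divr_ge0 ?nv_ge0 //; last exact: ltW.
by rewrite ler_pdivrMr // mulrC.
Qed.

(** Starts the induction on powers of the contraction rate: when both forms dominate c0 times the
    squared norm, any norm bound is a bound relative to them, as 2 |u| |v| <= |u|^2 + |v|^2. *)
Lemma bnd_form D (k c0 : R) (f g : 'cV[C]_p -> R) : 0 <= k -> 0 < c0 -> bnd D k ->
  (forall u, c0 * rip u u <= f u) -> (forall v, c0 * rip v v <= g v) ->
  forall u v, 2 * rip u (D *m v) <= k / c0 * (f u + g v).
Proof.
move=> k0 c00 hD hf hg u v; have := rip_bnd u v hD.
have h1 : c0 * (rip u u + rip v v) <= f u + g v by rewrite mulrDr lerD.
have h2 : 2 * (nv u * nv v) <= rip u u + rip v v.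
  rewrite -!sqr_nv; have := sqr_ge0 (nv u - nv v); nra.
move=> h3; rewrite -mulrA.
apply: (@le_trans _ _ (k * (rip u u + rip v v))).
  apply: (@le_trans _ _ (k * (2 * (nv u * nv v)))); last by rewrite ler_wpM2l.
  by rewrite mulrCA ler_pM2l.
by rewrite ler_wpM2l // mulrC ler_pdivlMr // mulrC.
Qed.

Definition tends X L := forall e : R, 0 < e ->
  exists N, forall n, (N <= n)%N -> bnd (X n - L) e.

Lemma bndBC (D L : 'M[C]_p) c : bnd (D - L) c -> bnd (L - D) c.
Proof. by move=> h; rewrite -opprB; exact: bndN. Qed.

Lemma tends_shift X L : tends X L -> tends (fun n => X n.+1) L.
Proof. by move=> h e /h[N hN]; exists N => n Nn; apply: hN; exact: leqW. Qed.

Lemma bnd_eps (D : 'M[C]_p) : (forall e : R, 0 < e -> bnd D e) -> D = 0.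
Proof.
move=> h; apply: form_eq0 => u v.
apply/ler_addgt0Pr => e e0; rewrite add0r.
apply: le_trans (rip_bnd u v (h (e / (1 + nv u * nv v)) _)) _.
  by rewrite divr_gt0 // ltr_wpDr ?mulr_ge0 ?nv_ge0.
rewrite -mulrA ger_pMr // mulrC ler_pdivrMr ?ltr_wpDr ?mulr_ge0 ?nv_ge0 //.
by rewrite mul1r lerDr.
Qed.

Lemma tends_unique X L L' : tends X L -> tends X L' -> L = L'.
Proof.
move=> h h'; apply/eqP; rewrite -subr_eq0; apply/eqP; apply: bnd_eps => e e0.
have e2 : 0 < e / 2 by rewrite divr_gt0.
have [N hN] := h _ e2; have [N' hN'] := h' _ e2.
have -> : L - L' = (X (N + N')%N - L') - (X (N + N')%N - L).
  by rewrite opprB [RHS]addrC addrA subrK.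
rewrite [e]splitr; apply: bndB; [apply: hN'|apply: hN].
  exact: leq_addl.
exact: leq_addr.
Qed.

Lemma eventually_forall_fin (I : finType) (Q : I -> nat -> Prop) :
  (forall i, exists N, forall n, (N <= n)%N -> Q i n) ->
  exists N, forall n, (N <= n)%N -> forall i, Q i n.
Proof.
move=> /choice[f hf]; exists (\max_i f i)%N => n Nn i.
by apply: hf; apply: leq_trans Nn; exact: leq_bigmax.
Qed.

Lemma tends_entries X L :
  (forall i j, (fun n => Re (X n i j)) @ \oo --> Re (L i j)) ->
  (forall i j, (fun n => Im (X n i j)) @ \oo --> Im (L i j)) -> tends X L.
Proof.
move=> hr hi e e0; pose d := e / (1 + p%:R * p%:R * 2).
have pp : 0 < 1 + p%:R * p%:R * 2 :> R by rewrite ltr_wpDr ?mulr_ge0.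
have d0 : 0 < d by rewrite divr_gt0.
have : exists N, forall n, (N <= n)%N -> forall ij : 'I_p * 'I_p,
    `|Re ((X n - L) ij.1 ij.2)| <= d /\ `|Im ((X n - L) ij.1 ij.2)| <= d.
  apply: eventually_forall_fin => -[i j] /=.
  have /cvgrPdist_le/(_ _ d0)[N1 _ h1] := hr i j.
  have /cvgrPdist_le/(_ _ d0)[N2 _ h2] := hi i j.
  exists (maxn N1 N2) => n; rewrite geq_max => /andP[n1 n2].
  have := h1 n n1; have := h2 n n2; rewrite /= !mxE ReB ImB.
  by rewrite [in X in X -> _]distrC => -> ; rewrite distrC => ->.
move=> [N hN]; exists N => n Nn.
apply: bnd_le (bnd_entries (ltW d0) (fun i j => hN n Nn (i, j))).
have -> : e = (1 + p%:R * p%:R * 2) * d by rewrite /d mulrC divfK // gt_eqF.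
by rewrite mulrA ler_pM2r // lerDr.
Qed.

Lemma geometric_cvg (f : nat -> R) (c r : R) : 0 <= r -> r < 1 ->
  (forall n, `|f n.+1 - f n| <= c * r ^+ n) -> cvgn f.
Proof.
move=> r0 r1 h.
have -> : f = (fun n => f 0%N + series (telescope f) n).
  by apply/funext => n; rewrite -eq_sum_telescope.
apply: is_cvgD; first exact: is_cvg_cst.
apply: normed_cvg.
apply: (@series_le_cvg _ _ (geometric c r)).
- by move=> n /=.
- by move=> n /=; apply: le_trans (h n).
- by move=> n; exact: h.
- by apply: is_cvg_geometric_series; rewrite ger0_norm.
Qed.

Lemma tends_geometric X (c r : R) : 0 <= r -> r < 1 ->
  (forall n, bnd (X n.+1 - X n) (c * r ^+ n)) -> exists L, tends X L.
Proof.
move=> r0 r1 h.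
have hr i j : cvgn (fun n => Re (X n i j)).
  apply: (@geometric_cvg _ c r) => // n; rewrite -ReB.
  by have := bnd_Re i j (h n); rewrite !mxE.
have hi i j : cvgn (fun n => Im (X n i j)).
  apply: (@geometric_cvg _ c r) => // n; rewrite -ImB.
  by have := bnd_Im i j (h n); rewrite !mxE.
exists (\matrix_(i, j) (limn (fun n => Re (X n i j)) +i* limn (fun n => Im (X n i j)))).
by apply: tends_entries => i j; rewrite mxE /=; [exact: hr | exact: hi].
Qed.

Lemma Qy_bnd (M : 'M[C]_p) (y : R) : 0 < y -> Qy y M -> bnd M y^-1.
Proof.
move=> y0 hM u; have [->|n0] := eqVneq (nv (M *m u)) 0.
  by rewrite mulr_ge0 ?nv_ge0 // invr_ge0 ltW.
have np : 0 < nv (M *m u) by rewrite lt_neqAle eq_sym n0 nv_ge0.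
rewrite mulrC ler_pdivlMr // mulrC -(ler_pM2r np) -mulrA -expr2 sqr_nv.
apply: le_trans (hM u) _; apply: le_trans (ler_norm _) _; exact: norm_iip_le.
Qed.

Lemma tends_Qy X L (y : R) : 0 < y -> (forall n, Qy y (X n)) -> tends X L -> Qy y L.
Proof.
move=> y0 hX hL u; rewrite -sqr_nv.
apply/ler_addgt0Pr => e e0.
set N2 := nv u; have N0 : 0 <= N2 := nv_ge0 u.
(* The coefficient 3 + y collects the errors, in units of e' |u|^2: one from replacing X_k by L in
   the form, two from the cross term of the square (using y |X_k u| <= |u|), and y from the
   quadratic term (using e' <= 1). *)
pose m := 1 + (3 + y) * N2 ^+ 2.
have m0 : 0 < m by rewrite ltr_wpDr // mulr_ge0 ?sqr_ge0 //; lra.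
pose e' := Num.min 1 (e / m).
have e'0 : 0 < e' by rewrite lt_min ltr01 divr_gt0.
have [k /(_ k (leqnn k)) hk] := hL e' e'0.
have e'1 : e' <= 1 by rewrite ge_min lexx.
have e'm : e' * m <= e by rewrite -ler_pdivlMr // ge_min lexx orbT.
have h1 : nv (L *m u) <= nv (X k *m u) + e' * N2.
  have -> : L *m u = X k *m u - (X k - L) *m u.
    by rewrite mulmxBl opprB [RHS]addrC subrK.
  by apply: le_trans (nvB _ _) _; rewrite lerD2l.
have h2 : iip u (X k *m u) <= iip u (L *m u) + e' * N2 ^+ 2.
  rewrite -lerBlDl -iipBr -mulmxBl; apply: le_trans (ler_norm _) _.
  apply: le_trans (norm_iip_le _ _) _; rewrite expr2 mulrCA ler_wpM2l //.
have h3 : y * nv (X k *m u) ^+ 2 <= iip u (X k *m u) by rewrite sqr_nv; exact: hX.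
have h4 : y * nv (X k *m u) <= N2.
  have := Qy_bnd y0 (hX k) u; rewrite mulrC ler_pdivlMr // => h.
  by rewrite mulrC.
have := nv_ge0 (X k *m u); have := nv_ge0 (L *m u).
move: (nv (L *m u)) (nv (X k *m u)) (iip u (L *m u)) (iip u (X k *m u)) h1 h2 h3 h4.
move=> A B I J h1 h2 h3 h4 A0 B0.
have {}h1 : y * A ^+ 2 <= y * (B + e' * N2) ^+ 2.
  by rewrite ler_pM2l // ler_pXn2r // nnegrE // addr_ge0 // mulr_ge0 // ltW.
have h5 : y * B * (e' * N2) <= N2 * (e' * N2).
  by rewrite ler_wpM2r // mulr_ge0 // ltW.
have h6 : y * (e' * N2) ^+ 2 <= y * (e' * N2 ^+ 2).
  rewrite ler_pM2l // exprMn ler_wpM2r ?sqr_ge0 // expr2 ger_pMl //.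
have : e' <= e' * m - e' * ((3 + y) * N2 ^+ 2) by rewrite /m; lra.
rewrite /m in e'm; nra.
Qed.

End MatrixLimits.

Section Iteration.
Context d (Omega : measurableType d) (R : realType) (P : probability Omega R).
Variables (p : nat) (a : R).
Hypothesis a_gt0 : 0 < a.
Local Notation C := R[i].
Implicit Types (S : Omega -> 'M[R]_p) (M : 'M[C]_p) (u v : 'cV[C]_p).
Local Notation Phi := (Phi P a).
Local Notation ES := (ES P a).

Definition iterate S (z : C) n : 'M[C]_p := iter n (Phi S z) (- z^-1)%:M.

(** Used both to approximate T and to pass to the limit in M. The factors 1 + a K / y bound 1 - a G
    M and 1 - a M' G' in [Gmx_lip], a K^2 bounds the term with M - M', and (Im z)^-2 comes from the
    two outer factors of [phi_diff]. *)
Lemma Phi_lipschitz S S' (c y : R) (z : C) M M' (dl et : R) : regular S c -> regular S' c ->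
  0 <= c -> 0 < y -> 0 < Im z -> Qy y M -> Qy y M' -> 0 <= dl -> 0 <= et ->
  (forall w, bnd (complexmx (S' w) - complexmx (S w)) dl) -> bnd (M - M') et ->
  let K := Kbound a c y in
  bnd (Phi S' z M' - Phi S z M)
    ((Im z)^-1 ^+ 2 * ((1 + a * (K / y)) ^+ 2 * dl + a * K ^+ 2 * et)).
Proof.
move=> rS rS' c0 y0 z0 hM hM' dl0 et0 hS hMM K.
have K0 : 0 <= K by exact: Kbound_ge0.
have b0 : 0 <= (1 + a * (K / y)) ^+ 2 * dl + a * K ^+ 2 * et.
  apply: addr_ge0; apply: mulr_ge0 => //; first exact: sqr_ge0.
  by apply: mulr_ge0; [exact: ltW|exact: sqr_ge0].
have iz0 : 0 <= (Im z)^-1 by rewrite invr_ge0 ltW.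
have i1 := GS_int P a_gt0 rS c0 y0 hM; have i2 := GS_int P a_gt0 rS' c0 y0 hM'.
have u1 := Phi_unit P a_gt0 rS c0 y0 z0 hM.
have u2 := Phi_unit P a_gt0 rS' c0 y0 z0 hM'.
rewrite {1}/Phi {1}/Phi phi_diff //.
rewrite [(Im z)^-1 ^+ 2]expr2 [X in bnd _ X]mulrAC.
rewrite -/(Phi S' z M') -/(Phi S z M).
apply: bndM; [by rewrite mulr_ge0| |exact (Phi_bnd P a_gt0 rS c0 y0 z0 hM)].
apply: bndM => //; first exact (Phi_bnd P a_gt0 rS' c0 y0 z0 hM').
have [iB <-] := mxintegralB i1 i2; apply: mxintegral_bnd => // w.
apply: bndBC.
rewrite /GS (Gmx_lip (GS_unit a_gt0 rS y0 hM w) (GS_unit a_gt0 rS' y0 hM' w)).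
have bG := GS_bnd a_gt0 rS c0 y0 hM w; have bG' := GS_bnd a_gt0 rS' c0 y0 hM' w.
have bM := Qy_bnd y0 hM; have bM' := Qy_bnd y0 hM'.
have na : Normc.normc a%:C = a by rewrite /= [0 ^+ 2]expr0n addr0 sqrtr_sqr gtr0_norm.
have bZ (X : 'M[C]_p) k : bnd X k -> bnd (a%:C *: X) (a * k).
  by move=> h; rewrite -{2}na; exact: bndZ.
have y'0 : 0 <= y^-1 by rewrite invr_ge0 ltW.
have bL : bnd (1%:M - a%:C *: (GS a S M w *m M)) (1 + a * (K / y)).
  by apply: bndB; [exact: bnd1|apply: bZ; exact: bndM].
have bL' : bnd (1%:M - a%:C *: (M' *m GS a S' M' w)) (1 + a * (K / y)).
  apply: bndB; [exact: bnd1|apply: bZ].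
  by rewrite mulrC; exact: bndM.
have l0 : 0 <= 1 + a * (K / y) by rewrite addr_ge0 // mulr_ge0 ?mulr_ge0 // ltW.
apply: bndD.
  rewrite expr2 mulrAC; apply: bndM => //; first by rewrite mulr_ge0.
  exact (bndM l0 bL (hS w)).
rewrite expr2 -mulrA; apply: bZ.
rewrite [K * K * et]mulrAC; apply: bndM => //; first by rewrite mulr_ge0.
exact: bndM.
Qed.

Section Fixed.
Variables (S : Omega -> 'M[R]_p) (c : R) (z : C).
Hypothesis rS : regular S c.
Hypothesis c0 : 0 <= c.
Hypothesis z0 : 0 < Im z.
Local Notation y := (Im z).
Local Notation K := (Kbound a c y).
Let rate := contraction_rate a c y z.

(** For the scalar - 1/z the inequality is an equality: Im (- 1/z) = (Im z) |1/z|^2. *)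
Lemma start_Qy : Qy y ((- z^-1)%:M : 'M[C]_p).
Proof.
move=> u; rewrite mul_scalar_mx iip_scalar -!sqr_nv nvZ exprMn.
have n0 := normc_gt0 z0.
have -> : Im (- z^-1) = y * (Normc.normc (- z^-1)) ^+ 2.
  have s0 : 0 < Re z ^+ 2 + Im z ^+ 2 by rewrite ltr_wpDl ?sqr_ge0 ?exprn_gt0.
  have -> (x : C) : Normc.normc x ^+ 2 = Re x ^+ 2 + Im x ^+ 2.
    by case: x => ? ? /=; rewrite sqr_sqrtr ?addr_ge0 ?sqr_ge0.
  by rewrite ImN ReN ImV ReV; field; rewrite gt_eqF.
by rewrite mulrA.
Qed.

Lemma iterate_Qy n : Qy y (iterate S z n).
Proof.
by elim: n => [|n IH]; [exact: start_Qy|exact (Phi_Qy P a_gt0 rS c0 z0 z0 IH)].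
Qed.

(** Both points being fixed, [Phi_contract] reproduces its own hypothesis with a smaller constant;
    iterating it brings the relative distance down to 0. *)
Lemma Phi_fixed_unique M1 M2 : Qy y M1 -> Qy y M2 ->
  Phi S z M1 = M1 -> Phi S z M2 = M2 -> M1 = M2.
Proof.
move=> h1 h2 f1 f2.
have lo1 u := Phi_lower P a_gt0 rS c0 z0 z0 u h1.
have lo2 u := Phi_lower P a_gt0 rS c0 z0 z0 u h2.
rewrite f1 in lo1; rewrite f2 in lo2.
have l0 : 0 < Im z / (Normc.normc z + K) ^+ 2.
  by rewrite divr_gt0 // exprn_gt0 // normc_K_gt0.
have bD : bnd (M1 - M2) (y^-1 + y^-1) by apply: bndB; exact: Qy_bnd.
have y2 : 0 <= y^-1 + y^-1 by rewrite addr_ge0 // invr_ge0 ltW.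
have h0 := bnd_form y2 l0 bD lo1 lo2; set k := _ / _ in h0.
have k0 : 0 <= k by rewrite divr_ge0 // ltW.
have hn n : forall u v, 2 * rip u ((M1 - M2) *m v) <=
     k * rate ^+ n * (iip u (M1 *m u) + iip v (M2 *m v)).
  elim: n => [|n IH] u v; first by rewrite expr0 mulr1; exact: h0.
  have kn : 0 <= k * rate ^+ n by rewrite mulr_ge0 // exprn_ge0 // contraction_rate_ge0.
  have := Phi_contract P a_gt0 rS c0 z0 z0 h1 h2 kn IH u v.
  by rewrite f1 f2 exprSr mulrA.
apply/eqP; rewrite -subr_eq0; apply/eqP; apply: form_eq0 => u v.
rewrite -(ler_pM2l (_ : 0 < 2)) // mulr0.
apply: (@le0_geometric _ _ (k * (iip u (M1 *m u) + iip v (M2 *m v))) rate).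
- exact: contraction_rate_ge0.
- exact: contraction_rate_lt1.
- by move=> n; rewrite mulrAC; exact: hn.
Qed.

Lemma iterate_cvg : exists L, tends (iterate S z) L.
Proof.
have h0 := iterate_Qy 0; have h1 := iterate_Qy 1.
have l1 : 0 < Im z / (Normc.normc z + K) ^+ 2.
  by rewrite divr_gt0 // exprn_gt0 // normc_K_gt0.
have n0 := normc_gt0 z0.
(* The exact value of Im (- 1/z), hence the lower bound for the form of the starting point;
   [phi_lower] serves the first iterate. *)
pose l0 := Im z / Normc.normc z ^+ 2.
have l00 : 0 < l0 by rewrite divr_gt0 // exprn_gt0.
pose l := Num.min l0 (Im z / (Normc.normc z + K) ^+ 2).
have lp : 0 < l by rewrite lt_min l00.
have lo1 u : l * rip u u <= iip u (iterate S z 1 *m u).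
  apply: le_trans (Phi_lower P a_gt0 rS c0 z0 z0 u h0).
  by rewrite ler_wpM2r ?rip_ge0 // ge_min lexx orbT.
have lo0 u : l * rip u u <= iip u (iterate S z 0 *m u).
  rewrite /iterate /= mul_scalar_mx iip_scalar ler_wpM2r ?rip_ge0 //.
  rewrite ge_min ImN ImV mulNr opprK /l0.
  suff -> : Normc.normc z ^+ 2 = Re z ^+ 2 + Im z ^+ 2 by rewrite lexx.
  by case: (z) => ? ? /=; rewrite sqr_sqrtr ?addr_ge0 ?sqr_ge0.
have bD : bnd (iterate S z 1 - iterate S z 0) (y^-1 + y^-1) by apply: bndB; exact: Qy_bnd.
have y1 : 0 < y^-1 by rewrite invr_gt0.
have y2 : 0 < y^-1 + y^-1 by rewrite addr_gt0.
have hh := bnd_form (ltW y2) lp bD lo1 lo0; set k := _ / _ in hh.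
have k0 : 0 < k by rewrite mulr_gt0 ?invr_gt0.
clearbody k; have r0 : 0 <= rate by exact: contraction_rate_ge0.
have r1 : rate < 1 by exact: contraction_rate_lt1.
have hn n : forall u v, 2 * rip u ((iterate S z n.+1 - iterate S z n) *m v) <=
     k * rate ^+ n * (iip u (iterate S z n.+1 *m u) + iip v (iterate S z n *m v)).
  elim: n => [|n IH] u v; first by rewrite expr0 mulr1; exact: hh.
  have kn : 0 <= k * rate ^+ n by rewrite mulr_ge0 ?exprn_ge0 // ltW.
  have := Phi_contract P a_gt0 rS c0 z0 z0 (iterate_Qy n.+1) (iterate_Qy n) kn IH u v.
  by rewrite exprSr mulrA.
have hb M u : Qy y M -> iip u (M *m u) <= y^-1 * rip u u.
  move=> hM; apply: le_trans (ler_norm _) _; apply: le_trans (norm_iip_le _ _) _.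
  by rewrite -sqr_nv expr2 mulrCA ler_wpM2l ?nv_ge0 //; exact: Qy_bnd.
(* [form_bnd] asks for a positive constant whereas [rate] may be 0, so a rate strictly between
   [rate] and 1 is used. *)
have r01 : 0 < (1 + rate) / 2 by rewrite divr_gt0 // ltr_wpDr.
have rh : (1 + rate) / 2 < 1 by rewrite ltr_pdivrMr // mul1r; lra.
apply: (@tends_geometric _ _ _ (k / y) ((1 + rate) / 2)) => // [|n].
  exact: ltW.
apply: form_bnd => [|u v]; first by rewrite mulr_gt0 ?divr_gt0 ?exprn_gt0.
apply: le_trans (hn n u v) _.
apply: (@le_trans _ _ (k * ((1 + rate) / 2) ^+ n *
   (iip u (iterate S z n.+1 *m u) + iip v (iterate S z n *m v)))).
  apply: ler_wpM2r.
    have f0 m w : 0 <= iip w (iterate S z m *m w).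
      apply: (le_trans _ (iterate_Qy m w)).
      by rewrite mulr_ge0 ?rip_ge0 // ltW.
    exact: addr_ge0.
  rewrite ler_pM2l // lerXn2r ?nnegrE //; first exact: ltW.
  lra.
rewrite [k / y * _]mulrAC -[_ / y * _]mulrA ler_pM2l ?mulr_gt0 ?exprn_gt0 //.
by rewrite mulrDr lerD //; apply: hb; exact: iterate_Qy.
Qed.

Lemma iterate_lim_fixed L : tends (iterate S z) L -> Qy y L /\ Phi S z L = L.
Proof.
move=> hL; have QL : Qy y L by apply: tends_Qy z0 iterate_Qy hL.
split => //; apply: tends_unique (tends_shift hL).
set t := y^-1 ^+ 2 * (a * K ^+ 2).
have t0 : 0 <= t.
  apply: mulr_ge0; first exact: sqr_ge0.
  by apply: mulr_ge0; [exact: ltW|exact: sqr_ge0].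
move=> e e0; have e1 : 0 < e / (1 + t) by rewrite divr_gt0 // ltr_wpDr.
have [N hN] := hL _ e1; exists N => n Nn.
have bS w : bnd (complexmx (S w) - complexmx (S w)) 0.
  by move=> u; rewrite subrr mul0mx nv0 mul0r.
have := Phi_lipschitz rS rS c0 z0 z0 QL (iterate_Qy n) (lexx _) (ltW e1) bS
  (bndBC (hN n Nn)).
rewrite /= mulr0 add0r; apply: bnd_le.
have -> : y^-1 ^+ 2 * (a * K ^+ 2 * (e / (1 + t))) = t * e / (1 + t).
  by rewrite /t !mulrA.
by rewrite ler_pdivrMr ?ltr_wpDr // [X in X <= _]mulrC ler_pM2l // lerDr.
Qed.

End Fixed.

Lemma iterate_approx (Sk : nat -> Omega -> 'M[R]_p) S c (z : C) (dl : nat -> R) n :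
  regular S c -> (forall k, regular (Sk k) c) -> 0 <= c -> 0 < Im z ->
  (forall k, 0 <= dl k) -> dl @ \oo --> 0 ->
  (forall k w, bnd (complexmx (Sk k w) - complexmx (S w)) (dl k)) ->
  tends (fun k => iterate (Sk k) z n) (iterate S z n).
Proof.
move=> rS rSk c0 z0 dl0 dlc hS; elim: n => [|n IH].
  move=> e e0; exists 0%N => k _ u.
  by rewrite /iterate /= subrr mul0mx nv0 mulr_ge0 ?nv_ge0 // ltW.
set K := Kbound a c (Im z).
set A := (Im z)^-1 ^+ 2 * (1 + a * (K / Im z)) ^+ 2.
set B := (Im z)^-1 ^+ 2 * (a * K ^+ 2).
have A0 : 0 <= A by rewrite mulr_ge0 ?sqr_ge0.
have B0 : 0 <= B.
  apply: mulr_ge0; first exact: sqr_ge0.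
  by apply: mulr_ge0; [exact: ltW|exact: sqr_ge0].
move=> e e0; pose e1 := e / (1 + A + B).
have AB : 0 < 1 + A + B by rewrite -addrA ltr_wpDr // addr_ge0.
have e10 : 0 < e1 by rewrite divr_gt0.
have [N hN] := IH _ e10.
have /cvgrPdist_le/(_ _ e10)[N' _ hN'] := dlc.
exists (maxn N N') => k; rewrite geq_max => /andP[Nk N'k].
have := Phi_lipschitz rS (rSk k) c0 z0 z0 (iterate_Qy rS c0 z0 n)
  (iterate_Qy (rSk k) c0 z0 n) (dl0 k) (ltW e10) (hS k) (bndBC (hN k Nk)).
apply: bnd_le; set X := (X in X <= _).
have -> : X = A * dl k + B * e1 by rewrite /X /A /B mulrDr !mulrA.
have := hN' k N'k; rewrite /= sub0r normrN ger0_norm // => dk.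
have -> : e = (1 + A + B) * e1 by rewrite /e1 mulrC divfK // gt_eqF.
rewrite !mulrDl -addrA ler_wpDl ?mul1r //; first exact: ltW.
by rewrite lerD2r ler_wpM2l.
Qed.

End Iteration.

(** * Compressed resolvents *)

Section Resolvents.
Variable R : realType.
Local Notation C := R[i].

Lemma resolvent_unit n (A : 'M[C]_n) (z : C) : A^t* = A -> 0 < Im z ->
  A - z%:M \in unitmx.
Proof.
move=> hA z0; apply: unitmx_inj => v /(congr1 (iip v)).
rewrite mulmxBl mul_scalar_mx iipBr iip_herm // iip_scalar iip_rip scaler0 rip0r.
move=> /eqP; rewrite sub0r oppr_eq0 mulf_eq0 gt_eqF //= => /eqP.
exact: rip_eq0.
Qed.

Lemma invmx_mulE n m (B : 'M[C]_n) (X V : 'M[C]_(n, m)) : B \in unitmx ->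
  B *m X = V -> invmx B *m V = X.
Proof. by move=> uB <-; rewrite mulKmx. Qed.

(** The dimension n is existential because the constructions enlarge the space: sums become direct
    sums, and a Schur complement adds m coordinates. *)
Definition resolvent m (F : C -> 'M[C]_m) :=
  exists n (A : 'M[C]_n) (V : 'M[C]_(n, m)), A^t* = A /\
  forall z, 0 < Im z -> F z = V^t* *m invmx (A - z%:M) *m V.

Definition unital_resolvent m (F : C -> 'M[C]_m) :=
  exists n (A : 'M[C]_n) (V : 'M[C]_(n, m)), [/\ A^t* = A, V^t* *m V = 1%:M &
  forall z, 0 < Im z -> F z = V^t* *m invmx (A - z%:M) *m V].

Lemma resolvent0 m : resolvent (fun=> 0 : 'M[C]_m).
Proof.
exists 0%N, 0, 0; split; first by apply/matrixP => -[].
by move=> z _; rewrite mulmx0.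
Qed.

Lemma resolvent_ext m (F G : C -> 'M[C]_m) :
  (forall z, 0 < Im z -> F z = G z) -> resolvent F -> resolvent G.
Proof.
move=> e [n [A [V [hA h]]]]; exists n, A, V; split => // z z0.
by rewrite -e // h.
Qed.

Lemma unital_resolvent_ext m (F G : C -> 'M[C]_m) :
  (forall z, 0 < Im z -> F z = G z) -> unital_resolvent F -> unital_resolvent G.
Proof.
move=> e [n [A [V [hA hV h]]]]; exists n, A, V; split => // z z0.
by rewrite -e // h.
Qed.

Lemma resolvent_conj m (B : 'M[C]_m) F : resolvent F ->
  resolvent (fun z => B^t* *m F z *m B).
Proof.
move=> [n [A [V [hA h]]]]; exists n, A, (V *m B); split => // z z0.
by rewrite h // adjM !mulmxA.
Qed.

Lemma resolventZ m (c : R) F : 0 <= c -> resolvent F ->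
  resolvent (fun z => c%:C *: (F z : 'M[C]_m)).
Proof.
move=> c0 /(resolvent_conj (Num.sqrt c)%:C%:M); apply: resolvent_ext => z _.
rewrite adj_scalar conj_real mul_scalar_mx mul_mx_scalar scalerA.
by rewrite -rmorphM -expr2 sqr_sqrtr.
Qed.

Lemma resolventD m (F G : C -> 'M[C]_m) : resolvent F -> resolvent G ->
  resolvent (fun z => F z + G z).
Proof.
move=> [n [A [V [hA hF]]]] [n' [A' [V' [hA' hG]]]].
exists (n + n')%N, (block_mx A 0 0 A'), (col_mx V V').
have hb : (block_mx A 0 0 A')^t* = block_mx A 0 0 A'.
  by rewrite tr_block_mx map_block_mx !trmx0 !map_mx0 hA hA'.
split=> // z z0; have uA := resolvent_unit hA z0; have uA' := resolvent_unit hA' z0.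
rewrite -mulmxA.
have -> : invmx (block_mx A 0 0 A' - z%:M) *m col_mx V V' =
    col_mx (invmx (A - z%:M) *m V) (invmx (A' - z%:M) *m V').
  apply: invmx_mulE; first exact: resolvent_unit.
  rewrite scalar_mx_block opp_block_mx add_block_mx !oppr0 !addr0.
  by rewrite mul_block_col !mul0mx addr0 add0r !mulKVmx.
by rewrite tr_col_mx map_row_mx mul_row_col hF // hG // !mulmxA.
Qed.

Lemma resolvent_sum m (I : Type) (s : seq I) (F : I -> C -> 'M[C]_m) :
  (forall i, resolvent (F i)) -> resolvent (fun z => \sum_(i <- s) F i z).
Proof.
move=> h; elim: s => [|i s IH].
  by apply: resolvent_ext (resolvent0 m) => z _; rewrite big_nil.
apply: resolvent_ext (resolventD (h i) IH) => z _.
by rewrite big_cons.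
Qed.

(* Woodbury's identity: [M T (1 + a M T)^-1] only perturbs the resolvent of [A]. *)
Lemma Gmx_resolvent p n (a : R) (A : 'M[C]_n) (V : 'M[C]_(n, p)) (T : 'M[C]_p) (z : C) :
  A^t* = A -> T^t* = T -> 0 < Im z ->
  let M := V^t* *m invmx (A - z%:M) *m V in
  let A' := A + a%:C *: (V *m T *m V^t*) in
  Bmx a M T \in unitmx ->
  A'^t* = A' /\
  Gmx a M T = T - a%:C *: (T *m V^t* *m invmx (A' - z%:M) *m V *m T).
Proof.
move=> hA hT z0 M A' uB.
have hA' : A'^t* = A'.
  by rewrite adjD adjZ conj_real !adjM trmxCK hA hT !mulmxA.
split=> //; set G' := RHS.
have uA := resolvent_unit hA z0; have uA' := resolvent_unit hA' z0.
have e : G' *m Bmx a M T = T.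
  rewrite BmxE mulmxDr mulmx1 -scalemxAr.
  set Rz := invmx (A - z%:M) in M uB *; set R' := invmx (A' - z%:M).
  (* The resolvent identity for A and A', whose difference is a V T V^*. *)
  have key : a%:C *: (R' *m (V *m T *m V^t*) *m Rz) = Rz - R'.
    have -> : a%:C *: (R' *m (V *m T *m V^t*) *m Rz) =
        R' *m ((A' - z%:M) - (A - z%:M)) *m Rz.
      have -> : A' - z%:M - (A - z%:M) = a%:C *: (V *m T *m V^t*).
        by rewrite opprB addrA subrK /A' addrAC subrr add0r.
      by rewrite -scalemxAr -scalemxAl.
    by rewrite mulmxBr mulmxBl mulVmx // mul1mx -mulmxA mulmxV // mulmx1.
  pose P1 := T *m V^t*; pose Q1 := V *m T.
  have e1 : G' = T - a%:C *: (P1 *m R' *m Q1) by rewrite /G' /P1 /Q1 !mulmxA.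
  have e2 : M *m T = V^t* *m Rz *m Q1 by rewrite /M /Q1 !mulmxA.
  have e3 : P1 *m R' *m Q1 *m (V^t* *m Rz *m Q1) =
      P1 *m (R' *m (V *m T *m V^t*) *m Rz) *m Q1 by rewrite /P1 /Q1 !mulmxA.
  have e4 : T *m (V^t* *m Rz *m Q1) = P1 *m Rz *m Q1 by rewrite /P1 !mulmxA.
  have e5 (X : 'M[C]_n) : a%:C *: (P1 *m X *m Q1) = P1 *m (a%:C *: X) *m Q1.
    by rewrite -scalemxAr -scalemxAl.
  rewrite e1 e2 (mulmxBl T) -scalemxAl e3 e4.
  rewrite (e5 (R' *m (V *m T *m V^t*) *m Rz)) key (mulmxBr P1) mulmxBl.
  by rewrite subKr subrK.
by rewrite -[G'](mulmxK uB) e Gmx.unlock.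
Qed.

(* Schur complement: [F z] is the off-diagonal contribution [V^* (A - z)^-1 V] to the
   corner of the resolvent of [[B, V^*], [V, A]]. *)
Lemma schur_resolvent m (B : 'M[C]_m) F : B^t* = B -> resolvent F ->
  (forall z, 0 < Im z -> - z%:M + (B - F z) \in unitmx) ->
  unital_resolvent (fun z => invmx (- z%:M + (B - F z))).
Proof.
move=> hB [n [A [V [hA hF]]]] uH.
exists (m + n)%N, (block_mx B (V^t* ) V A), (col_mx 1%:M 0).
have hb : (block_mx B (V^t* ) V A)^t* = block_mx B (V^t* ) V A.
  by rewrite tr_block_mx map_block_mx trmxCK hA hB.
split=> //.
  by rewrite tr_col_mx map_row_mx mul_row_col adj1 mulmx1 mulmx0 addr0.
move=> z z0; have uA := resolvent_unit hA z0.
set X := invmx (- z%:M + (B - F z)).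
rewrite -mulmxA.
have -> : invmx (block_mx B (V^t* ) V A - z%:M) *m col_mx 1%:M 0 =
    col_mx X (- (invmx (A - z%:M) *m V *m X)).
  apply: invmx_mulE; first exact: resolvent_unit.
  rewrite scalar_mx_block opp_block_mx add_block_mx !oppr0 !addr0.
  rewrite mul_block_col !mulmxN !mulmxA mulmxV // mul1mx subrr.
  by rewrite -mulmxBl -hF // -addrA addrCA mulmxV // uH.
by rewrite tr_col_mx map_row_mx mul_row_col adj1 mul1mx trmx0 map_mx0 mul0mx addr0.
Qed.

(** Diagonalise A = Q^* D Q: the atoms are the eigenvalues and the weights are the squared moduli of
    the coordinates of Q x. *)
Lemma resolvent_atoms n (A : 'M[C]_n) (x : 'cV[C]_n) : A^t* = A ->
  exists (w lam : 'I_n -> R), [/\ forall k, 0 <= w k, \sum_k w k = rip x x &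
    forall z, 0 < Im z ->
      (x^t* *m invmx (A - z%:M) *m x) 0 0 =
      \sum_k (w k)%:C * stieltjes_kernel z (lam k)].
Proof.
move=> hA.
have herm : A \is hermsymmx.
  by apply/is_hermitianmxP; rewrite expr0 scale1r hA.
have uP := spectral_unitarymx A; set Q := spectralmx A in uP.
have /orthomx_spectralP := hermitian_normalmx herm; rewrite -/Q invmx_unitary //.
set D := spectral_diag A => eA.
have realD k : (Re (D 0 k))%:C = D 0 k.
  have /mxOverP/(_ 0 k) := hermitian_spectral_diag_real herm.
  exact: RRe_real.
pose c := Q *m x.
exists (fun k => Re (c k 0) ^+ 2 + Im (c k 0) ^+ 2), (fun k => Re (D 0 k)).
have QQ : Q^t* *m Q = 1%:M.
  by rewrite -invmx_unitary // mulVmx // unitarymx_unit.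
have cE : rip c c = rip x x by rewrite /c rip_adj mulmxA QQ mul1mx.
split.
- by move=> k; rewrite addr_ge0 ?sqr_ge0.
- by rewrite -cE ripE; apply: eq_bigr => k _; rewrite -!expr2.
move=> z z0; have uA := resolvent_unit hA z0.
have nz k : D 0 k - z != 0.
  apply/eqP => /(congr1 (@Im R)); rewrite -realD ImB /= => /eqP.
  by rewrite sub0r oppr_eq0 gt_eqF.
have -> : invmx (A - z%:M) = Q^t* *m diag_mx (\row_k (D 0 k - z)^-1) *m Q.
  have e : (A - z%:M) *m (Q^t* *m diag_mx (\row_k (D 0 k - z)^-1) *m Q) = 1%:M.
    have -> : A - z%:M = Q^t* *m (diag_mx D - z%:M) *m Q.
      by rewrite mulmxBr mulmxBl -eA mul_mx_scalar -scalemxAl QQ scalemx1.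
    have QQ' : Q *m Q^t* = 1%:M by apply/unitarymxP.
    rewrite !mulmxA -[_ *m Q *m Q^t*]mulmxA QQ' mulmx1.
    rewrite -[_ *m _ *m diag_mx (\row__ _)]mulmxA.
    suff -> : (diag_mx D - z%:M) *m diag_mx (\row_k (D 0 k - z)^-1) = 1%:M.
      by rewrite mulmx1 QQ.
    have -> : diag_mx D - z%:M = diag_mx (\row_k (D 0 k - z)).
      apply/matrixP => i j; rewrite !mxE -mulrnBl.
      by case: eqP => [->|]; rewrite ?mulr1n ?mulr0n.
    apply/matrixP => i j; rewrite mul_diag_mx !mxE.
    by case: eqP => [->|]; rewrite ?mulr1n ?mulr0n ?mulr0 // mulfV.
  by rewrite -[LHS]mulmx1 -e mulKmx.
have -> : x^t* *m (Q^t* *m diag_mx (\row_k (D 0 k - z)^-1) *m Q) *m x =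
    c^t* *m diag_mx (\row_k (D 0 k - z)^-1) *m c.
  by rewrite /c adjM !mulmxA.
rewrite form_sum; apply: eq_bigr => k _.
rewrite (bigD1 k) //= big1 ?addr0 => [|j jk]; last first.
  by rewrite !mxE eq_sym (negbTE jk) mulr0n mulr0.
rewrite !mxE eqxx mulr1n /stieltjes_kernel realD; congr (_ * _).
apply: complex_ext; rewrite ?ReM ?ImM Re_conj Im_conj /=; ring.
Qed.

End Resolvents.

(** * Matrix fields with finitely many values *)

Section Discrete.
Context d (Omega : measurableType d) (R : realType) (P : probability Omega R).
Variables (p : nat) (a : R) (I : finType) (code : Omega -> I) (tau : I -> 'M[R]_p).
Hypothesis a_gt0 : 0 < a.
Hypothesis code_meas : forall i, measurable (code @^-1` [set i]).
Hypothesis tau_sym : forall i, (tau i)^T = tau i.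
Local Notation C := R[i].
Let S w := tau (code w).
Let pr i := fine (P (code @^-1` [set i])).

Lemma Cintegral_finite (g : I -> C) :
  Cintegral P (fun w => g (code w)) = \sum_i (pr i)%:C * g i.
Proof.
pose h i w : C := (\1_(code @^-1` [set i]) w)%:C.
have hint i : Cintegrable P (h i).
  apply: (@Cintegrable_bounded _ _ _ _ _ 1); first exact: P_fin.
    by split => /=; [exact: measurable_indic|exact: measurable_cst].
  move=> w /=; rewrite normr0; split => //; rewrite indicE; case: (_ \in _).
    by rewrite normr1.
  by rewrite normr0.
rewrite (@eq_Cintegral _ _ _ _ _ (fun w => \sum_i g i * h i w)); last first.
  move=> w; rewrite (bigD1 (code w)) //= big1 ?addr0 => [|i ni].
    by rewrite /h indicE mem_set //= mulr1.
  rewrite /h indicE memNset ?mulr0 //= => e.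
  by rewrite e eqxx in ni.
rewrite Cintegral_sum => [|i _]; last exact: CintegrableZ.
apply: eq_bigr => i _; rewrite CintegralZ // mulrC; congr (_ * _).
apply: complex_ext => /=.
  by rewrite /Rintegral integral_indic // setIT.
by rewrite Rintegral_cst // mul0r.
Qed.

Lemma ES_finite (M : 'M[C]_p) :
  ES P a S M = \sum_i (pr i)%:C *: Gmx a M (complexmx (tau i)).
Proof.
apply/matrixP => k l; rewrite mxE summxE.
rewrite (Cintegral_finite (fun i => Gmx a M (complexmx (tau i)) k l)).
by apply: eq_bigr => i _; rewrite mxE.
Qed.

(** [Gmx_resolvent] writes E(F z) as B0 - Q z: B0 is the Hermitian mean of the values of T, and Q z
    is a sum of compressed resolvents of the matrices A + a V T_i V^*. This is the shape that
    [schur_resolvent] inverts. *)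
Lemma Phi_resolvent (c : R) (F : C -> 'M[C]_p) : regular S c -> 0 <= c ->
  (forall z, 0 < Im z -> Qy (Im z) (F z)) ->
  unital_resolvent F -> unital_resolvent (fun z => Phi P a S z (F z)).
Proof.
move=> rS c0 QF [n [A [V [hA hV hF]]]].
have pr0 i : 0 <= pr i by rewrite fine_ge0.
have T_herm i : (complexmx (tau i))^t* = complexmx (tau i).
  by rewrite complexmx_adj tau_sym.
pose A' i := A + a%:C *: (V *m complexmx (tau i) *m V^t*).
pose B0 := \sum_i (pr i)%:C *: complexmx (tau i).
pose Q z := \sum_i (pr i)%:C *: (a%:C *: ((complexmx (tau i))^t* *m
   (V^t* *m invmx (A' i - z%:M) *m V) *m complexmx (tau i))).
have hA' i : (A' i)^t* = A' i.
  by rewrite adjD adjZ conj_real !adjM trmxCK hA T_herm !mulmxA.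
have resQ : resolvent Q.
  apply: resolvent_sum => i; apply: resolventZ => //; apply: resolventZ; first exact: ltW.
  by apply: resolvent_conj; exists n, (A' i), V; split.
have hB0 : B0^t* = B0.
  rewrite /B0 (big_morph (fun X : 'M[C]_p => X^t* ) (@adjD R p p) (id1 := 0)).
    by apply: eq_bigr => i _; rewrite adjZ conj_real T_herm.
  by rewrite trmx0 map_mx0.
have EE z : 0 < Im z -> ES P a S (F z) = B0 - Q z.
  move=> z0; rewrite ES_finite /B0 /Q -sumrB; apply: eq_bigr => i _.
  rewrite -scalerBr; congr (_ *: _).
  have uB : Bmx a (F z) (complexmx (tau i)) \in unitmx.
    exact: Bmx_unit a_gt0 _ _ _ z0 (QF z z0) (T_herm i).
  rewrite hF // in uB *.
  have [_ ->] := Gmx_resolvent hA (T_herm i) z0 uB.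
  by rewrite T_herm !mulmxA.
apply: (@unital_resolvent_ext _ _ (fun z => invmx (- z%:M + (B0 - Q z)))).
  by move=> z z0; rewrite /Phi EE.
apply: schur_resolvent => // z z0; rewrite -EE //.
exact: (Phi_unit P a_gt0 rS c0 z0 z0 (QF z z0)).
Qed.

Lemma iterate_resolvent (c : R) n : regular S c -> 0 <= c ->
  unital_resolvent (fun z => iterate P a S z n).
Proof.
move=> rS c0; elim: n => [|n IH].
  exists p, 0, 1%:M; split; [by rewrite trmx0 map_mx0|by rewrite adj1 mulmx1|].
  move=> z z0; rewrite adj1 mul1mx mulmx1 sub0r /iterate /=.
  have nz : z != 0 by apply/eqP => e; move: z0; rewrite e ltxx.
  have u : (0 : 'M[C]_p) - z%:M \in unitmx.
    by apply: resolvent_unit => //; rewrite trmx0 map_mx0.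
  rewrite sub0r in u.
  rewrite -[RHS]mulmx1; apply/esym/invmx_mulE => //.
  by rewrite -rmorphN /= -scalar_mxM mulrNN mulfV.
apply: (Phi_resolvent rS c0) => // z z0.
exact (iterate_Qy P a_gt0 rS c0 z0 n).
Qed.

End Discrete.

(** * Injectivity of the Stieltjes transform *)

Section BoundedConvergence.
Context d (T : measurableType d) (R : realType).
Variable m : {finite_measure set T -> \bar R}.

Lemma finite_measure_lty : (m setT < +oo)%E.
Proof. by rewrite ltey_eq fin_num_measure. Qed.

Lemma bounded_cvg (f_ : nat -> T -> R) (f : T -> R) (c : R) :
  (forall n, measurable_fun setT (f_ n)) -> (forall n x, `|f_ n x| <= c) ->
  (forall x, f_ n x @[n --> \oo] --> f x) ->
  (\int[m]_x f_ n x) @[n --> \oo] --> \int[m]_x f x.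
Proof.
move=> mf hc hf.
have mff : measurable_fun setT f by apply: (measurable_fun_cvg mf) => x _; exact: hf.
have fc x : `|f x| <= c.
  have : `|f_ n x| @[n --> \oo] --> `|f x| by apply: cvg_norm; exact: hf.
  by move/cvgr_to_le; apply; apply: nearW => n.
have mi := bounded_integrable finite_measure_lty mff fc.
apply: fine_cvg; rewrite fineK; last exact: integrable_fin_num.
apply: (@dominated_cvg _ _ _ _ _ measurableT (fun n x => (f_ n x)%:E) _ (fun=> c%:E)) => //.
- by move=> n; exact/measurable_EFinP.
- by move=> x _; apply: cvg_EFin; [exact: nearW|exact: hf].
- apply: (@bounded_integrable _ _ _ _ (fun=> c) `|c|) => //; exact: finite_measure_lty.
- by move=> n x _; rewrite lee_fin.
Qed.

End BoundedConvergence.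

Section Kernel.
Variable R : realType.
Implicit Types (z a b : R[i]) (x t : R).

Lemma Re_kernel z x : Re (stieltjes_kernel z x) =
  (x - Re z) / ((x - Re z) ^+ 2 + Im z ^+ 2).
Proof.
by rewrite /stieltjes_kernel ReV !ReB !ImB /= sub0r sqrrN.
Qed.

Lemma Im_kernel z x : Im (stieltjes_kernel z x) =
  Im z / ((x - Re z) ^+ 2 + Im z ^+ 2).
Proof.
by rewrite /stieltjes_kernel ImV !ReB !ImB /= sub0r opprK sqrrN.
Qed.

Lemma kernel_denom_gt0 z x : Im z != 0 -> 0 < (x - Re z) ^+ 2 + Im z ^+ 2.
Proof. by move=> z0; rewrite ltr_wpDl ?sqr_ge0 // exprn_even_gt0. Qed.

Lemma kernel_bound z x : Im z != 0 ->
  `|Re (stieltjes_kernel z x)| <= `|Im z|^-1 /\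
  `|Im (stieltjes_kernel z x)| <= `|Im z|^-1.
Proof.
move=> z0; have D0 := kernel_denom_gt0 x z0; rewrite Re_kernel Im_kernel.
have n0 : 0 < `|Im z| by rewrite normr_gt0.
rewrite !normrM !normfV !(gtr0_norm D0).
rewrite !ler_pdivrMr // ![`|Im z|^-1 * _]mulrC !ler_pdivlMr //.
rewrite -[(x - Re z) ^+ 2]real_normK ?num_real // -[Im z ^+ 2]real_normK ?num_real //.
have := sqr_ge0 (`|x - Re z| - `|Im z|).
have := sqr_ge0 (x - Re z); have := sqr_ge0 (Im z).
have := normr_ge0 (x - Re z); move: `|x - Re z| `|Im z| n0 => s t t0 s0 _ _ h.
by split; nra.
Qed.

Lemma Cmeas_real (h : R -> R) : measurable_fun setT h ->
  Cmeas (fun x => (h x)%:C : R[i]).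
Proof. by move=> mh; split => //=; exact: measurable_cst. Qed.

Lemma kernel_meas z (h : R -> R) : measurable_fun setT h ->
  Cmeas (fun x => stieltjes_kernel z (h x)).
Proof.
move=> mh; apply: CmeasV; apply: CmeasD; last exact: Cmeas_cst.
exact: Cmeas_real.
Qed.

Lemma kernel_integrable (m : {finite_measure set R -> \bar R}) z (h : R -> R) :
  Im z != 0 -> measurable_fun setT h ->
  Cintegrable m (fun x => stieltjes_kernel z (h x)).
Proof.
move=> z0 mh; apply: (@Cintegrable_bounded _ _ _ _ _ (`|Im z|^-1)).
- exact: finite_measure_lty.
- exact: kernel_meas.
- by move=> x; exact: kernel_bound.
Qed.

Lemma kernel_neq0 z x : Im z != 0 -> x%:C - z != 0.
Proof.
move=> z0; apply/eqP => /(congr1 (@Im R)); rewrite ImB /= => /eqP.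
by rewrite sub0r oppr_eq0 (negbTE z0).
Qed.

(** Partial fractions for 1/(t^2 - b^2). Repeated with successive square roots of the pole, it
    descends from t^(2^k) to t; a square root of a non-real number is again non-real. *)
Lemma kernel_sqr b t : Im b != 0 ->
  stieltjes_kernel (b ^+ 2) (t ^+ 2) =
  (2 * b)^-1 * (stieltjes_kernel b t - stieltjes_kernel (- b) t).
Proof.
move=> b0; rewrite /stieltjes_kernel rmorphXn /= opprK.
have h1 := kernel_neq0 t b0.
have h2 : t%:C + b != 0.
  by have := @kernel_neq0 (- b) t; rewrite opprK ImN oppr_eq0; apply.
have bn : b != 0 by apply: contraNneq b0 => ->.
have h3 : t%:C ^+ 2 - b ^+ 2 != 0 by rewrite subr_sqr mulf_neq0.
by field; rewrite h1 h2 bn h3.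
Qed.

End Kernel.

Section StieltjesInjective.
Variables (R : realType) (I : finType) (c : I -> R[i]).
Variable m : I -> {finite_measure set R -> \bar R}.
Hypothesis transform0 : forall z, Im z != 0 ->
  \sum_l c l * Cintegral (m l) (stieltjes_kernel z) = 0.

Let L (f : R -> R[i]) := \sum_l c l * Cintegral (m l) f.

Let L_ext f g : f =1 g -> L f = L g.
Proof. by move=> /funext->. Qed.

Let LZB k f g : (forall l, Cintegrable (m l) f) -> (forall l, Cintegrable (m l) g) ->
  L (fun x => k * (f x - g x)) = k * (L f - L g).
Proof.
move=> hf hg; rewrite /L -sumrB mulr_sumr; apply: eq_bigr => l _.
have hN : Cintegrable (m l) (fun x => -1 * g x) by exact: CintegrableZ.
rewrite CintegralZ; last first.
  by apply: eq_Cintegrable (CintegrableD (hf l) hN) => x; rewrite mulN1r.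
rewrite (@eq_Cintegral _ _ _ _ _ (fun x => f x + -1 * g x)); last first.
  by move=> x; rewrite mulN1r.
by rewrite CintegralD // CintegralZ //; ring.
Qed.

Let q (x0 w : R) k x := ((x - x0) / w) ^+ (2 ^ k).

Let q_meas x0 w k : measurable_fun setT (q x0 w k).
Proof.
apply: measurable_funX; apply: measurable_funM; last exact: measurable_cst.
by apply: measurable_funB; [exact: measurable_id|exact: measurable_cst].
Qed.

(* [1/(t^(2^k) - a)] is a linear combination of resolvents off the real line. *)
Lemma power_transform0 x0 w k a : 0 < w -> Im a != 0 ->
  L (fun x => stieltjes_kernel a (q x0 w k x)) = 0.
Proof.
move=> w0; elim: k a => [|k IH] a a0.
  have z0 : Im (x0%:C + w%:C * a) != 0 by rewrite ImD ImZ /= add0r mulf_neq0 // gt_eqF.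
  rewrite (L_ext (g := fun x => w%:C *
     (stieltjes_kernel (x0%:C + w%:C * a) x - 0))); last first.
    move=> x; rewrite subr0 /q expn0 expr1 /stieltjes_kernel.
    have wC : w%:C != 0 :> R[i] by rewrite eq_complex /= gt_eqF.
    have -> : ((x - x0) / w)%:C - a = w%:C^-1 * (x%:C - (x0%:C + w%:C * a)).
      rewrite rmorphM rmorphB fmorphV /=; field.
      by rewrite wC.
    by rewrite invfM invrK.
  rewrite LZB; [|by move=> l; exact: kernel_integrable|by move=> l; exact: Cintegrable0].
  rewrite /L transform0 // sub0r big1 ?oppr0 ?mulr0 // => l _.
  by rewrite Cintegral0 mulr0.
pose b := sqrtc a; have ba : b ^+ 2 = a by rewrite sqr_sqrtc.
have b0 : Im b != 0.
  by apply: contraNneq a0 => b0; rewrite -ba expr2 ImM b0 mulr0 mul0r addr0.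
have nb0 : Im (- b) != 0 by rewrite ImN oppr_eq0.
rewrite (L_ext (g := fun x => (2 * b)^-1 * (stieltjes_kernel b (q x0 w k x) -
    stieltjes_kernel (- b) (q x0 w k x)))); last first.
  move=> x; rewrite -kernel_sqr // ba.
  by rewrite /q -exprM -expnSr.
rewrite LZB; [|by move=> l; exact: kernel_integrable|by move=> l; exact: kernel_integrable].
by rewrite !IH // subr0 mulr0.
Qed.

Lemma bernoulli (x : R) n : 0 <= x -> 1 + n%:R * x <= (1 + x) ^+ n.
Proof.
move=> x0; elim: n => [|n IH]; first by rewrite mul0r addr0 expr0.
rewrite exprSr; apply: (@le_trans _ _ ((1 + n%:R * x) * (1 + x))); last first.
  by rewrite ler_wpM2r // addr_ge0.
rewrite -natr1; have := mulr_ge0 (ler0n R n) (sqr_ge0 x); nra.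
Qed.

Let half (j : nat) : R := (2 ^ j)%:R^-1.
(** The affine map sends [X - 2 (j + 1), X] onto [-1, 1], so the right end stays at X and the left
    end goes to - oo. The factor 2^-j makes the value at x = X, where t = 1, tend to 1 instead of
    staying at 1/2. The exponent 2^(3j+1) makes the power of t = 1 + (x - X)/(j + 1) outgrow 2^j as
    soon as x > X. *)
Let h (X : R) j x := (1 + half j * q (X - j.+1%:R) j.+1%:R (3 * j).+1 x)^-1.

Let half_gt0 j : 0 < half j.
Proof. by rewrite invr_gt0 ltr0n expn_gt0. Qed.

Let q_ge0 x0 w k x : 0 <= q x0 w k.+1 x.
Proof. by rewrite /q expnSr exprM sqr_ge0. Qed.

Let h_denom X j x : 1 <= 1 + half j * q (X - j.+1%:R) j.+1%:R (3 * j).+1 x.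
Proof. by rewrite lerDl mulr_ge0 // ltW. Qed.

Let h_bound X j x : 0 <= h X j x <= 1.
Proof.
have d1 := h_denom X j x; have d0 := lt_le_trans ltr01 d1.
by rewrite /h invr_ge0 (ltW d0) invf_le1.
Qed.

Let h_transform0 X j : L (fun x => (h X j x)%:C) = 0.
Proof.
pose r := Num.sqrt (2 ^ j)%:R : R.
have j0 : 0 < (2 ^ j)%:R :> R by rewrite ltr0n expn_gt0.
have r0 : 0 < r by rewrite sqrtr_gt0.
have rr : r ^+ 2 = (2 ^ j)%:R by rewrite sqr_sqrtr // ltW.
(* [h] is 2^j / (t^(2^(3j+1)) + 2^j), whose pole - 2^j is real and not covered by
   [power_transform0]. One splitting by hand leads to the poles b and - b, which are purely
   imaginary. *)
pose b : R[i] := 0 +i* r.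
have b0 : Im b != 0 by rewrite /= gt_eqF.
have nb0 : Im (- b) != 0 by rewrite /= oppr_eq0 gt_eqF.
have bb : b ^+ 2 = - (2 ^ j)%:R%:C.
  apply: complex_ext; rewrite expr2 ?ReM ?ImM /= ?mulr0 ?mul0r ?addr0 ?oppr0 //.
  by rewrite sub0r -expr2 rr.
rewrite (L_ext (g := fun x => ((2 ^ j)%:R%:C * (2 * b)^-1) *
   (stieltjes_kernel b (q (X - j.+1%:R) j.+1%:R (3 * j) x) -
    stieltjes_kernel (- b) (q (X - j.+1%:R) j.+1%:R (3 * j) x)))); last first.
  move=> x; rewrite -mulrA -kernel_sqr //.
  rewrite bb /stieltjes_kernel opprK /h /half.
  have <- : q (X - j.+1%:R) j.+1%:R (3 * j).+1 x = q (X - j.+1%:R) j.+1%:R (3 * j) x ^+ 2.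
    by rewrite /q -exprM -expnSr.
  have := q_ge0 (X - j.+1%:R) j.+1%:R (3 * j) x; move: (q _ _ _ x) => Q Q0.
  rewrite -rmorphD /= -fmorphV -rmorphM /=; congr (_%:C).
  have := j0; move: (2 ^ j)%:R => e e0.
  have Qe : 0 < Q + e by rewrite ltr_wpDl.
  by field; rewrite !gt_eqF.
rewrite LZB; [|by move=> l; exact: kernel_integrable|by move=> l; exact: kernel_integrable].
by rewrite !power_transform0 // ?subr0 ?mulr0.
Qed.

Let half_cvg : half j @[j --> \oo] --> (0 : R).
Proof.
have -> : half = geometric 1 (2^-1).
  by apply/funext => j; rewrite /half /geometric /= mul1r natrX exprVn.
by apply: cvg_geometric; rewrite ger0_norm ?invr_ge0 // invf_lt1 // ltr1n.
Qed.

Let h_cvg X x : h X j x @[j --> \oo] --> (\1_(`]-oo, X]) x : R).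
Proof.
rewrite indicE; have [xX|xX] := leP x X.
  rewrite mem_set /=; last by rewrite in_itv.
  apply/cvgrPdist_le => e e0.
  move/cvgrPdist_le: (half_cvg) => /(_ e e0) hc; near=> j.
  have t1 : `|(x - (X - j.+1%:R)) / j.+1%:R| <= 1.
    rewrite normrM normfV normr_nat ler_pdivrMr ?ltr0n // mul1r ler_norml.
    have : X - x <= j.+1%:R.
      apply: (@le_trans _ _ j%:R); last by rewrite ler_nat.
      by near: j; exact: nbhs_infty_ger.
    by move: j.+1%:R => J hJ; apply/andP; split; lra.
  have q1 : q (X - j.+1%:R) j.+1%:R (3 * j).+1 x <= 1.
    rewrite -[leLHS]ger0_norm ?q_ge0 // /q normrX exprn_ile1 //.
  have d1 := h_denom X j x; have d0 := lt_le_trans ltr01 d1.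
  have -> : 1 - h X j x = half j * q (X - j.+1%:R) j.+1%:R (3 * j).+1 x * h X j x.
    by rewrite /h; move: d0; move: (half j * _) => s s0; field; rewrite gt_eqF.
  have /andP[h0 h1] := h_bound X j x.
  rewrite !normrM (ger0_norm h0) (gtr0_norm (half_gt0 j)) ger0_norm ?q_ge0 //.
  apply: (@le_trans _ _ (half j)); last first.
    rewrite -[half j]ger0_norm; last exact: ltW.
    rewrite -normrN -[- _]sub0r; near: j.
    exact: hc.
  rewrite -mulrA ger_pMr // mulr_ile1 //; exact: q_ge0.
rewrite memNset /=; last by rewrite in_itv /= lt_geF.
pose dl := x - X; have dl0 : 0 < dl by rewrite subr_gt0.
have : half j / dl @[j --> \oo] --> (0 : R).
  by rewrite -[X in _ --> X](mul0r dl^-1); apply: cvgM; [exact: half_cvg|exact: cvg_cst].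
apply: squeeze_cvgr; last exact: cvg_cst.
apply: nearW => j; have /andP[-> _] := h_bound X j x => /=.
have t1 : (x - (X - j.+1%:R)) / j.+1%:R = 1 + dl / j.+1%:R.
  by rewrite /dl; move: j.+1%:R (ltr0Sn R j) => J J0; field; rewrite gt_eqF.
have s0 : 0 <= dl / j.+1%:R by rewrite divr_ge0 // ltW.
(* Bernoulli bounds the power below by 2^(3j+1) (x - X)/(j + 1), and j + 1 <= 2^(j+1) leaves 2^(2j)
   (x - X). Hence [h] is at most 2^-j / (x - X). *)
have hq : (2 ^ (3 * j).+1)%:R * (dl / j.+1%:R) <= q (X - j.+1%:R) j.+1%:R (3 * j).+1 x.
  rewrite /q t1; apply: le_trans (bernoulli _ s0); by rewrite lerDr.
have hq2 : (2 ^ (2 * j))%:R * dl <= q (X - j.+1%:R) j.+1%:R (3 * j).+1 x.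
  apply: le_trans hq; rewrite mulrA -mulrA [dl / _]mulrC mulrA ler_pM2r //.
  rewrite ler_pdivlMr ?ltr0n // -natrM ler_nat.
  have -> : (3 * j).+1 = (2 * j + j.+1)%N by rewrite addnS -mulSnr.
  by rewrite expnD leq_mul2l ltnW ?orbT // ltn_expl.
have hd : half j * ((2 ^ (2 * j))%:R * dl) <= 1 + half j * q (X - j.+1%:R) j.+1%:R (3 * j).+1 x.
  by rewrite ler_wpDl // ler_pM2l.
have e1 : half j * ((2 ^ (2 * j))%:R * dl) = dl / half j.
  rewrite /half invrK mulrA mulrC; congr (_ * _).
  rewrite mul2n -addnn expnD natrM mulKf // pnatr_eq0 -lt0n expn_gt0 //.
have -> : half j / dl = (dl / half j)^-1 by rewrite invf_div.
rewrite -e1 /h lef_pV2 // posrE; first exact: lt_le_trans ltr01 (h_denom X j x).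
by rewrite e1 divr_gt0.
Unshelve. all: by end_near. Qed.

Let F (A : set R) := \sum_l c l * (fine (m l A))%:C.

Let cvg_sum (r : I -> R) (u : I -> nat -> R) (v : I -> R) :
  (forall l, u l n @[n --> \oo] --> v l) ->
  (\sum_l r l * u l n) @[n --> \oo] --> \sum_l r l * v l.
Proof.
move=> hu; apply: cvg_big => [|l _]; last by apply: cvgM; [exact: cvg_cst|exact: hu].
by move=> /= x; exact: add_continuous.
Qed.

Let sum_lim0 (u : I -> nat -> R) (v : I -> R) :
  (forall l, u l n @[n --> \oo] --> v l) ->
  (forall n, \sum_l c l * (u l n)%:C = 0) -> \sum_l c l * (v l)%:C = 0.
Proof.
move=> hu h0; apply: complex_ext; rewrite ?Re_sum ?Im_sum.
  rewrite (eq_bigr (fun l => Re (c l) * v l)) => [|l _]; last by rewrite ReM /= mulr0 subr0.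
  apply: (cvg_unique _ (cvg_sum (r := fun l => Re (c l)) hu)) => //.
  apply: cvg_near_cst; apply: nearW => n; rewrite -[RHS](congr1 (@Re R) (h0 n)) Re_sum.
  by apply: eq_bigr => l _; rewrite ReM /= mulr0 subr0.
rewrite (eq_bigr (fun l => Im (c l) * v l)) => [|l _]; last by rewrite ImM /= mulr0 add0r.
apply: (cvg_unique _ (cvg_sum (r := fun l => Im (c l)) hu)) => //.
apply: cvg_near_cst; apply: nearW => n; rewrite -[RHS](congr1 (@Im R) (h0 n)) Im_sum.
by apply: eq_bigr => l _; rewrite ImM /= mulr0 add0r.
Qed.

Let h_meas X j : measurable_fun setT (h X j).
Proof.
apply: measurable_invr; apply: measurable_funD; first exact: measurable_cst.
by apply: measurable_funM; [exact: measurable_cst|exact: q_meas].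
Qed.

Let F_ray X : F `]-oo, X]%classic = 0.
Proof.
rewrite /F; apply: (sum_lim0 (u := fun l j => \int[m l]_x h X j x)).
  move=> l; have -> : fine (m l `]-oo, X]%classic) = \int[m l]_x (\1_(`]-oo, X]%classic) x).
    by rewrite /Rintegral integral_indic // setIT.
  apply: (@bounded_cvg _ _ _ _ _ _ 1) => //.
  by move=> n x; have /andP[h0 h1] := h_bound X n x; rewrite ger0_norm.
move=> j; rewrite -[RHS](h_transform0 X j); apply: eq_bigr => l _; congr (_ * _).
by apply: complex_ext => //=; rewrite Rintegral_cst // mul0r.
Qed.

Let F_setT : F setT = 0.
Proof.
have e : \bigcup_n `]-oo, (n%:R : R)]%classic = setT.
  apply/seteqP; split => // x _; exists (Num.truncn `|x|).+1 => //=.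
  rewrite in_itv /=; apply: le_trans (ler_norm x) _; apply: ltW.
  exact: truncnS_gt.
rewrite /F; apply: (sum_lim0 (u := fun l n => fine (m l `]-oo, n%:R]%classic))).
  move=> l; apply: fine_cvg; rewrite fineK; last exact: fin_num_measure.
  rewrite -e; apply: nondecreasing_cvg_mu.
  - by move=> n; exact: measurable_itv.
  - by rewrite e.
  - move=> i j ij; apply/subsetPset => x /=; rewrite !in_itv /= => h1.
    by apply: le_trans h1 _; rewrite ler_nat.
by move=> n; exact: F_ray.
Qed.

(** The combination vanishes on closed half-lines and on the whole line, and Dynkin's theorem
    extends this to Borel sets. With arbitrary complex coefficients, the lemma compares any two
    combinations of finite measures once all terms are moved to one side. *)
Lemma stieltjes_injective A : measurable A ->
  \sum_l c l * (fine (m l A))%:C = 0.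
Proof.
pose G := [set B : set R | exists X, B = `]-oo, X]%classic].
have mG : @measurable _ R = <<s G >>.
  rewrite [LHS]RGenInftyO.measurableE; apply/seteqP; split; apply: smallest_sub.
  - exact: smallest_sigma_algebra.
  - move=> _ [x ->]; have -> : `]-oo, x[%classic = \bigcup_n `]-oo, x - n.+1%:R^-1]%classic.
      apply/seteqP; split => t /=; rewrite in_itv /=.
        move=> tx; exists (Num.truncn (x - t)^-1) => //=; rewrite in_itv /=.
        rewrite lerBrDr -lerBrDl; apply/ltW; rewrite -[X in _ < X]invrK.
        by rewrite ltf_pV2 ?posrE ?invr_gt0 ?subr_gt0 // truncnS_gt.
      move=> [n _] /=; rewrite in_itv /= => h1; apply: le_lt_trans h1 _.
      by rewrite ltrBlDr ltrDl invr_gt0.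
    apply: (@sigma_algebra_bigcup _ setT G) => n.
    by apply: sub_sigma_algebra; exists (x - n.+1%:R^-1).
  - exact: smallest_sigma_algebra.
  - by move=> _ [x ->]; exact: RGenInftyO.measurable_itv_bnd_infty.
rewrite mG; apply: (dynkin_induction (P := fun A => F A = 0)) => //.
- move=> _ _ [x ->] [y ->]; exists (Num.min x y).
  by apply/seteqP; split => t /=; rewrite !in_itv /= le_min => /andP.
- by move=> _ [x ->]; exact: F_ray.
- move=> S mS FS; have -> : F (~` S) = F setT - F S.
    rewrite /F -sumrB; apply: eq_bigr => l _; rewrite -mulrBr; congr (_ * _).
    rewrite -rmorphB /=; congr (_%:C).
    rewrite -setTD measureD ?setTI //; last exact: finite_measure_lty.
    by rewrite fineB // fin_num_measure.
  by rewrite F_setT FS subr0.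
- move=> Fn mF tF hF.
  apply: (sum_lim0 (u := fun l n => \sum_(0 <= i < n) fine (m l (Fn i)))).
    move=> l.
    rewrite (_ : (fun n => _) = (fun n => fine (\sum_(0 <= i < n) m l (Fn i))%E)); last first.
      apply/funext => n; rewrite sum_fine // => i _.
      exact: fin_num_measure.
    apply: fine_cvg; rewrite fineK; last exact/fin_num_measure/bigcup_measurable.
    by apply: measure_semi_sigma_additive => //; exact: bigcup_measurable.
  move=> n; rewrite (eq_bigr (fun l => \sum_(0 <= i < n) c l * (fine (m l (Fn i)))%:C)); last first.
    by move=> l _; rewrite rmorph_sum /= mulr_sumr.
  by rewrite exchange_big /= big1 // => i _; exact: hF.
Qed.

End StieltjesInjective.

(** * Helly's selection theorem for Stieltjes transforms *)

Section StieltjesTransforms.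
Variable R : realType.
Implicit Types (m : {measure set R -> \bar R}) (z : R[i]) (s : R[i] -> R[i]) (c : R).

Definition stieltjes_of c s := exists m,
  m setT = c%:E /\ forall z, 0 < Im z -> Cintegral m (stieltjes_kernel z) = s z.

Lemma kernel_int m c z : m setT = c%:E -> 0 < Im z -> Cintegrable m (stieltjes_kernel z).
Proof.
move=> mc z0; apply: (@Cintegrable_bounded _ _ _ _ _ (`|Im z|^-1)).
- by rewrite mc ltry.
- exact: kernel_meas.
- by move=> x; apply: kernel_bound; rewrite gt_eqF.
Qed.

Lemma stieltjes_of_ext c s s' : (forall z, 0 < Im z -> s z = s' z) ->
  stieltjes_of c s -> stieltjes_of c s'.
Proof. by move=> e [m [mc h]]; exists m; split => // z z0; rewrite h // e. Qed.

Lemma stieltjes_of0 : stieltjes_of 0 (fun=> 0).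
Proof.
exists mzero; split => // z _.
by apply: complex_ext => /=; rewrite /Rintegral integral_measure_zero.
Qed.

Lemma stieltjes_of_dirac x : stieltjes_of 1 (fun z => stieltjes_kernel z x).
Proof.
have dT : dirac x [set: R] = 1%E :> \bar R by exact: diracT.
exists (dirac x); split; first exact: dT.
move=> z z0; have [mr mi] := kernel_meas z (@measurable_id _ _ [set: R]).
apply: complex_ext => /=; rewrite /Rintegral integral_dirac //.
- by rewrite [X in (X * _)%E]dT mul1e.
- exact/measurable_EFinP.
- by rewrite [X in (X * _)%E]dT mul1e.
- exact/measurable_EFinP.
Qed.

Lemma stieltjes_ofD c c' s s' : stieltjes_of c s -> stieltjes_of c' s' ->
  stieltjes_of (c + c') (fun z => s z + s' z).
Proof.
move=> [m [mc hm]] [m' [mc' hm']]; exists (measure_add m m').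
split; first by rewrite [LHS]measure_addE mc mc'.
move=> z z0; rewrite -hm // -hm' //.
have [ir ii] := kernel_int mc z0; have [ir' ii'] := kernel_int mc' z0.
have mr := measurable_int _ ir; have mi := measurable_int _ ii.
by apply: complex_ext; rewrite ?ReD ?ImD /= /Rintegral integral_measure_add //
  fineD // integrable_fin_num.
Qed.

Lemma integral_mscale_real m (k : {nonneg R}) (f : R -> R) :
  m.-integrable setT (EFin \o f) ->
  \int[mscale k m]_x f x = k%:num * \int[m]_x f x.
Proof.
move=> fi; have mf := measurable_int _ fi.
rewrite /Rintegral integralE [in RHS]integralE.
rewrite !ge0_integral_mscale //; first last.
- exact: measurable_funepos.
- exact: measurable_funeneg.
rewrite -muleBr // ?fineM //.
  by rewrite fin_numB integrable_pos_fin_num // integrable_neg_fin_num.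
by rewrite fin_num_adde_defl // fin_numN integrable_neg_fin_num.
Qed.

Lemma stieltjes_ofZ k c s : 0 <= k -> stieltjes_of c s ->
  stieltjes_of (k * c) (fun z => k%:C * s z).
Proof.
move=> k0 [m [mc hm]]; exists (mscale (NngNum k0) m); split.
  by rewrite [LHS](_ : _ = (k%:E * m [set: R])%E) // mc EFinM.
move=> z z0; rewrite -hm //; have [ir ii] := kernel_int mc z0.
by apply: complex_ext; rewrite ?ReZ ?ImZ /= integral_mscale_real.
Qed.

Lemma stieltjes_of_sum (I : Type) (r : seq I) (c : I -> R) (s : I -> R[i] -> R[i]) :
  (forall i, stieltjes_of (c i) (s i)) ->
  stieltjes_of (\sum_(i <- r) c i) (fun z => \sum_(i <- r) s i z).
Proof.
move=> h; elim: r => [|i r IH].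
  rewrite big_nil; apply: stieltjes_of_ext stieltjes_of0 => z _.
  by rewrite big_nil.
rewrite big_cons; apply: stieltjes_of_ext (stieltjes_ofD (h i) IH) => z _.
by rewrite big_cons.
Qed.

Lemma stieltjes_of_atoms n (w lam : 'I_n -> R) : (forall k, 0 <= w k) ->
  stieltjes_of (\sum_k w k) (fun z => \sum_k (w k)%:C * stieltjes_kernel z (lam k)).
Proof.
move=> w0; apply: stieltjes_of_sum => k.
by have := stieltjes_ofZ (w0 k) (stieltjes_of_dirac (lam k)); rewrite mulr1.
Qed.

Lemma resolvent_stieltjes n (F : R[i] -> 'M[R[i]]_n) (v : 'cV[R[i]]_n) :
  unital_resolvent F -> stieltjes_of (rip v v) (fun z => ((map_mx Num.conj v^T) *m F z *m v) 0 0).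
Proof.
move=> [k [A [V [hA hV hF]]]].
have [w [lam [w0 sw h]]] := resolvent_atoms (V *m v) hA.
have -> : rip v v = \sum_k w k by rewrite sw rip_adj mulmxA hV mul1mx.
apply: stieltjes_of_ext (stieltjes_of_atoms lam w0) => z z0.
by rewrite -h // hF // adjM !mulmxA.
Qed.

End StieltjesTransforms.

(** * Riemann-Stieltjes sums and compactness of tight measures *)

Section Helly.
Variable R : realType.
Implicit Types (m : {measure set R -> \bar R}) (f : R -> R) (c : R).

Definition dist m t : R := fine (m `]-oo, t]%classic).

Definition riemann f (D : R -> R) (x : nat -> R) N : R :=
  \sum_(0 <= j < N) f (x j) * (D (x j.+1) - D (x j)).

Section OneMeasure.
Variables (m : {measure set R -> \bar R}) (c : R).
Hypothesis mc : m setT = c%:E.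

Let m_fin A : measurable A -> m A \is a fin_num.
Proof.
move=> mA; rewrite ge0_fin_numE //; apply: (@le_lt_trans _ _ (m setT)).
  by apply: le_measure; rewrite ?inE.
by rewrite mc ltry.
Qed.

Lemma dist_ge0 t : 0 <= dist m t. Proof. exact: fine_ge0. Qed.

Lemma dist_nd s t : s <= t -> dist m s <= dist m t.
Proof.
move=> st; apply: fine_le; rewrite ?m_fin //; apply: le_measure; rewrite ?inE //.
by apply: subset_itvl; rewrite bnd_simp.
Qed.

Lemma dist_le t : dist m t <= c.
Proof.
rewrite -lee_fin fineK ?m_fin // -mc.
by apply: le_measure; rewrite ?inE.
Qed.

Let r (t x : R) : R := \1_(`]-oo, t]%classic) x.

Lemma integral_ray t : \int[m]_x r t x = dist m t.
Proof. by rewrite /Rintegral /r integral_indic // setIT. Qed.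

Let c0 : 0 <= c. Proof. by rewrite -lee_fin -mc. Qed.
Let mlt : (m setT < +oo)%E. Proof. by rewrite mc ltry. Qed.

Let r_meas t : measurable_fun setT (r t).
Proof. by apply: measurable_indic; exact: measurable_itv. Qed.

Let r_int t : m.-integrable setT (EFin \o r t).
Proof.
apply: (@bounded_integrable _ _ _ _ _ 1) => // x.
by rewrite /r indicE; case: (_ \in _); rewrite ?normr1 ?normr0.
Qed.

(** The sum is the integral of a step function that differs from f by at most L dl on each cell
    ]x_j, x_(j+1)] and vanishes outside the mesh. There the error is at most b, on a set of mass c -
    (D(x_N) - D(x_0)). *)
Lemma riemann_estimate f (b L dl : R) (x : nat -> R) N :
  0 <= dl -> (forall j, x j.+1 = x j + dl) -> 0 <= L -> 0 <= b ->
  measurable_fun setT f -> (forall t, `|f t| <= b) ->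
  (forall s t, `|f s - f t| <= L * `|s - t|) ->
  `|\int[m]_t f t - riemann f (dist m) x N| <=
     L * dl * c + b * (c - (dist m (x N) - dist m (x 0%N))).
Proof.
move=> dl0 hx L0 b0 mf hb hL.
have fi : m.-integrable setT (EFin \o f) by exact: bounded_integrable.
pose g t := \sum_(0 <= j < N) f (x j) * (r (x j.+1) t - r (x j) t).
have iB s t : m.-integrable setT (EFin \o (fun y => r s y - r t y)).
  by rewrite /comp; under eq_fun do rewrite EFinB; exact: (integrableB _ (r_int s) (r_int t)).
have iZB k s t : m.-integrable setT (EFin \o (fun y => k * (r s y - r t y))).
  by rewrite /comp; under eq_fun do rewrite EFinM; exact: (integrableZl _ _ (iB s t)).
have gi : m.-integrable setT (EFin \o g).
  rewrite /comp /g; under eq_fun do rewrite -sumEFin.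
  by apply: integrable_sum => // j _; exact: iZB.
have ig : \int[m]_t g t = riemann f (dist m) x N.
  rewrite /riemann /g; elim: N {gi} @g => [|M IH] g0.
    rewrite big_nil; under eq_Rintegral do rewrite big_nil.
    by rewrite Rintegral_cst // mul0r.
  under eq_Rintegral do rewrite big_nat_recr //=.
  rewrite RintegralD //; first last.
    rewrite /comp; under eq_fun do rewrite -sumEFin.
    by apply: integrable_sum => // j _; exact: iZB.
  rewrite IH big_nat_recr //=; congr (_ + _).
  rewrite (RintegralZl _ measurableT (iB _ _)).
  by rewrite (RintegralB _ (r_int _) (r_int _)) // !integral_ray.
rewrite -ig -RintegralB //; apply: le_trans (le_normr_Rintegral _ _) _ => //.
  by rewrite /comp; under eq_fun do rewrite EFinB; exact: integrableB.
pose B t := L * dl + b * (1 - (r (x N) t - r (x 0%N) t)).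
have i1 : m.-integrable setT (EFin \o (fun=> 1 : R)).
  by apply: (@bounded_integrable _ _ _ _ _ 1) => // ?; rewrite normr1.
have i2 : m.-integrable setT (EFin \o (fun t => r (x N) t - r (x 0%N) t)).
  exact: iB.
have i3 : m.-integrable setT (EFin \o (fun t => 1 - (r (x N) t - r (x 0%N) t))).
  by rewrite /comp; under eq_fun do rewrite EFinB; exact: integrableB.
have i4 : m.-integrable setT (EFin \o (fun t => b * (1 - (r (x N) t - r (x 0%N) t)))).
  by rewrite /comp; under eq_fun do rewrite EFinM; exact: integrableZl.
have i5 : m.-integrable setT (EFin \o (fun=> L * dl : R)).
  by apply: (@bounded_integrable _ _ _ _ _ `|L * dl|).
have <- : \int[m]_t B t = L * dl * c + b * (c - (dist m (x N) - dist m (x 0%N))).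
  rewrite (RintegralD _ i5 i4) // (RintegralZl _ _ i3) // (RintegralB _ i1 i2) //.
  rewrite (RintegralB _ (r_int _) (r_int _)) // !integral_ray.
  by rewrite !Rintegral_cst // mc /= mul1r.
have ni : m.-integrable setT (EFin \o (fun t => `|f t - g t|)).
  apply: (@integrable_norm _ _ _ _ _ (fun t => f t - g t)).
  by rewrite /comp; under eq_fun do rewrite EFinB; exact: integrableB.
apply: le_Rintegral => //.
  by rewrite /comp; under eq_fun do rewrite EFinD; exact: integrableD.
move=> t _; rewrite /B.
have rnd s s' : s <= s' -> 0 <= r s' t - r s t.
  move=> ss; rewrite /r !indicE !mem_setE !in_itv /=.
  have [ts|ts] := leP t s; first by rewrite (le_trans ts ss) subrr.
  by rewrite subr0; case: (t <= s').
have xnd j : x j <= x j.+1 by rewrite hx lerDl.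
have tel : \sum_(0 <= j < N) (r (x j.+1) t - r (x j) t) = r (x N) t - r (x 0%N) t.
  by rewrite (telescope_sumr (fun j => r (x j) t)).
have r01 : r (x N) t - r (x 0%N) t <= 1.
  rewrite /r !indicE; case: (_ \in _); case: (_ \in _) => /=; lra.
have -> : f t - g t = \sum_(0 <= j < N) (f t - f (x j)) * (r (x j.+1) t - r (x j) t)
     + f t * (1 - (r (x N) t - r (x 0%N) t)).
  have -> : \sum_(0 <= j < N) (f t - f (x j)) * (r (x j.+1) t - r (x j) t) =
      f t * (r (x N) t - r (x 0%N) t) - g t.
    by rewrite -tel mulr_sumr -sumrB; apply: eq_bigr => j _; rewrite mulrBl.
  by move: (g t) (f t) (r _ t - r _ t) => g' f' r'; ring.
apply: le_trans (ler_normD _ _) _; apply: lerD; last first.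
  by rewrite normrM ler_pM // ger0_norm // subr_ge0.
apply: (@le_trans _ _ (\sum_(0 <= j < N) L * dl * (r (x j.+1) t - r (x j) t))); last first.
  by rewrite -mulr_sumr tel ler_piMr // mulr_ge0.
apply: le_trans (ler_norm_sum _ _ _) _; apply: ler_sum => j _.
rewrite normrM [X in _ * X]ger0_norm ?rnd //.
rewrite /r !indicE !mem_setE !in_itv /=.
have [ts|ts] := leP t (x j); first by rewrite (le_trans ts (xnd j)) subrr !mulr0.
have [ts'|ts'] := leP t (x j.+1); last by rewrite subr0 !mulr0.
rewrite subr0 !mulr1; apply: le_trans (hL _ _) _; rewrite ler_wpM2l //.
rewrite ger0_norm ?subr_ge0; last exact: ltW.
by move: ts'; rewrite hx; lra.
Qed.

End OneMeasure.

Lemma summation_by_parts (f E : nat -> R) N :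
  \sum_(0 <= j < N) f j * (E j.+1 - E j) =
  f N * E N - f 0%N * E 0%N - \sum_(0 <= j < N) (f j.+1 - f j) * E j.+1.
Proof.
elim: N => [|N IH]; first by rewrite !big_nil subr0 subrr.
by rewrite !big_nat_recr //= IH; ring.
Qed.

Lemma lebesgue_stieltjes_itv (f : cumulative R R) (a b : R) : a <= b ->
  lebesgue_stieltjes_measure f `]a, b]%classic = (f b - f a)%:E.
Proof.
move=> ab; rewrite /lebesgue_stieltjes_measure /measure_extension /=.
by rewrite measurable_mu_extE /= ?wlength_itv_bnd //; exact: is_ocitv.
Qed.

Lemma lebesgue_stieltjes_bounded (F : R -> R) c : {homo F : x y / x <= y} ->
  (forall x, F y @[y --> x^'+] --> F x) ->
  F (- n%:R) @[n --> \oo] --> (0 : R) -> F n%:R @[n --> \oo] --> c ->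
  exists m, m setT = c%:E /\ forall t, m `]-oo, t]%classic = (F t)%:E.
Proof.
move=> nd rc F0 Fc.
pose Fc' := HB.pack_for (cumulative R R) F (isCumulative.Build R _ R F nd rc).
pose lsf := lebesgue_stieltjes_measure Fc'.
(* The identity only transports the measure from the measurable structure [measurableTypeR R] to
   that of [R]. *)
pose idTR : measurableTypeR R -> R := idfun.
have mid : measurable_fun setT idTR by exact: measurable_id.
pose m' : {measure set R -> \bar R} := pushforward lsf idTR.
pose m := m' mid.
have mE A : m A = lsf A by [].
have moc a b : a <= b -> lsf `]a, b]%classic = (F b - F a)%:E.
  by move=> ab; exact: (lebesgue_stieltjes_itv Fc' ab).
have mray t : m `]-oo, t]%classic = (F t)%:E.
  rewrite mE itvNybndEbigcup.
  have h1 : lsf `]-n%:R, t]%classic @[n --> \oo] --> (F t)%:E.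
    have h : (F t - F (- n%:R))%:E @[n --> \oo] --> (F t)%:E.
      apply: cvg_EFin; first exact: nearW.
      rewrite -[X in _ --> X]subr0; apply: cvgB; [exact: cvg_cst|exact: F0].
    apply: cvg_trans h; apply: near_eq_cvg; near=> n.
    rewrite moc // lerNl; near: n; exact: nbhs_infty_ger.
  have h2 : lsf `]- n%:R, t]%classic @[n --> \oo] --> lsf (\bigcup_n `]-n%:R, t]%classic).
    apply: nondecreasing_cvg_mu => //; first exact: bigcup_measurable.
    by move=> *; apply/subsetPset/subset_itv; rewrite leBSide//= lerN2 ler_nat.
  exact: cvg_unique h2 h1.
exists m; split=> //.
have e : \bigcup_n `]-oo, (n%:R : R)]%classic = setT.
  apply/seteqP; split => // x _; exists (Num.truncn `|x|).+1 => //=.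
  rewrite in_itv /=; apply: le_trans (ler_norm x) _; apply: ltW.
  exact: truncnS_gt.
have h1 : m `]-oo, (n%:R : R)]%classic @[n --> \oo] --> c%:E.
  under eq_fun do rewrite mray.
  by apply: cvg_EFin; [exact: nearW|exact: Fc].
have h2 : m `]-oo, (n%:R : R)]%classic @[n --> \oo] --> m setT.
  rewrite -e; apply: nondecreasing_cvg_mu.
  - by move=> n; exact: measurable_itv.
  - by rewrite e.
  - move=> i j ij; apply/subsetPset => x /=; rewrite !in_itv /= => h.
    by apply: le_trans h _; rewrite ler_nat.
exact: cvg_unique h2 h1.
Unshelve. all: by end_near. Qed.

Lemma cvg_invn (C : R) : C / n%:R @[n --> \oo] --> (0 : R).
Proof.
rewrite -[X in _ --> X](mulr0 C); apply: cvgM; first exact: cvg_cst.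
by rewrite -(cvg_shiftS (fun n => n%:R^-1 : R)); exact: cvg_harmonic.
Qed.

Section Compactness.
Variables (mu : nat -> {measure set R -> \bar R}) (c K : R).
Hypothesis K0 : 0 <= K.
Hypothesis mass : forall n, mu n setT = c%:E.
Hypothesis tailN : forall n t, 1 <= t -> dist (mu n) (- t) <= K / t.
Hypothesis tailP : forall n t, 1 <= t -> c - dist (mu n) t <= K / t.

(** An ultrafilter finer than [\oo] gives limits of the distribution functions at all points at
    once, in place of a diagonal subsequence. Since the integrals of the test functions are assumed
    to converge along n, their limit along the ultrafilter is the same l. *)
Lemma helly : exists m, m setT = c%:E /\
  forall f b L l, 0 <= b -> 0 <= L -> measurable_fun setT f ->
    (forall t, `|f t| <= b) -> (forall s t, `|f s - f t| <= L * `|s - t|) ->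
    (\int[mu n]_t f t) @[n --> \oo] --> l -> \int[m]_t f t = l.
Proof.
have c0 : 0 <= c by rewrite -lee_fin -(mass 0%N).
have [U [UU sU]] := ultraFilterLemma (eventually_filter : ProperFilter \oo).
have PU : ProperFilter U by exact: ultra_proper.
have limU t : exists g : R, dist (mu n) t @[n --> U] --> g.
  have [|g [_ cl]] := @segment_compact R 0 c (fmap (fun n => dist (mu n) t) U).
    suff : U ((fun n => dist (mu n) t) @^-1` `[0, c]%classic) by [].
    apply: filterE => n /=; rewrite in_itv /=.
    by apply/andP; split; [exact: dist_ge0|exact: dist_le (mass n) t].
  exists g => V Vg; have [//|nV] := in_ultra_setVsetC ((fun n => dist (mu n) t) @^-1` V) UU.
  by have [y [/= nVy Vy]] := cl (~` V) V nV Vg.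
have [G hG] := choice limU.
have G0 t : 0 <= G t.
  by apply: (cvgr_to_ge (hG t)); apply: filterE => n; exact: dist_ge0.
have Gc t : G t <= c.
  by apply: (cvgr_to_le (hG t)); apply: filterE => n; exact: dist_le (mass n) t.
have Gnd s t : s <= t -> G s <= G t.
  move=> st; apply: (ler_cvg_to (hG s) (hG t)); apply: filterE => n.
  exact: dist_nd (mass n) _ _ st.
have GN t : 1 <= t -> G (- t) <= K / t.
  by move=> t1; apply: (cvgr_to_le (hG _)); apply: filterE => n; exact: tailN.
have GP t : 1 <= t -> c - K / t <= G t.
  move=> t1; apply: (cvgr_to_ge (hG _)); apply: filterE => n.
  by have := tailP n t1; lra.
(* The pointwise limit G is monotone but need not be right-continuous, as the Lebesgue-Stieltjes
   construction requires; F is its right-continuous version, with G(x) <= F(x) <= G(y) for x < y. *)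
pose F x := inf [set G y | y in [set y | x < y]].
have Finf x : has_inf [set G y | y in [set y | x < y]].
  split; first by exists (G (x + 1)), (x + 1) => //=; rewrite ltrDl.
  by exists 0 => _ [y _ <-].
have FG x y : x < y -> F x <= G y.
  by move=> xy; apply: ge_inf; [case: (Finf x)|exists y].
have GF x : G x <= F x.
  apply: lb_le_inf; first by case: (Finf x).
  by move=> _ [y /= xy <-]; apply: Gnd; exact: ltW.
have Fnd : {homo F : x y / x <= y}.
  move=> x y; rewrite le_eqVlt => /predU1P[->//|xy].
  exact: le_trans (FG _ _ xy) (GF y).
have Frc x : F y @[y --> x^'+] --> F x.
  apply/cvgrPdist_le => e e0.
  have [_ [y /= xy <-] hy] := inf_adherent e0 (Finf x).
  near=> t; have xt : x < t by near: t; exact: nbhs_right_gt.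
  have ty : t < y by near: t; exact: nbhs_right_lt.
  have h1 := Fnd _ _ (ltW xt); have h2 := FG _ _ ty.
  by rewrite ler0_norm ?subr_le0 // opprB; lra.
have Kn := cvg_invn K.
have F0 x : 0 <= F x by exact: le_trans (G0 x) (GF x).
have FcU x : F x <= c by apply: le_trans (FG x (x + 1) _) (Gc _); rewrite ltrDl.
have Fk (k : nat) : (2 <= k)%N -> F (- k%:R) <= 2 * K / k%:R.
  move=> k2; have kR : 2 <= k%:R :> R by rewrite ler_nat.
  have kp : 0 < k%:R :> R by exact: lt_le_trans kR.
  (* F at - k is bounded by G only at points further right; - k/2 costs a factor 2, and k >= 2 keeps
     k/2 in the range of [GN]. *)
  apply: (@le_trans _ _ (G (- (k%:R / 2)))).
    by apply: FG; move: kp; move: k%:R => x x0; lra.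
  apply: le_trans (GN _ _) _; first by rewrite ler_pdivlMr // mul1r.
  by rewrite invf_div mulrCA mulrA.
have FN : F (- n%:R) @[n --> \oo] --> (0 : R).
  have h : 2 * (K / n%:R) @[n --> \oo] --> (0 : R).
    by rewrite -[X in _ --> X](mulr0 2); apply: cvgM; [exact: cvg_cst|exact: Kn].
  apply: squeeze_cvgr h; last exact: cvg_cst.
  near=> n; rewrite F0 mulrA /=; apply: Fk; near: n; exact: nbhs_infty_ge.
have FP : F n%:R @[n --> \oo] --> c.
  have h : c - K / n%:R @[n --> \oo] --> c.
    by rewrite -[X in _ --> X]subr0; apply: cvgB; [exact: cvg_cst|exact: Kn].
  apply: (squeeze_cvgr _ h (cvg_cst c)).
  near=> n; rewrite FcU andbT; apply: le_trans (GF _); apply: GP.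
  by rewrite ler1n; near: n; exact: nbhs_infty_gt.
have [m [mc mF]] := lebesgue_stieltjes_bounded Fnd Frc FN FP.
have dF t : dist m t = F t by rewrite /dist mF.
exists m; split => // f b L l b0 L0 mf hb hL hl.
have hlU : (\int[mu n]_t f t) @[n --> U] --> l by move=> A /hl; exact: sU.
(* The mesh is 1/k on [- k, k]. Each of the errors [e1], [e2], [e3] contributes L c / k, and
   respectively 2, 3 and 3 times b K / k; the coefficient 10 leaves some room. *)
pose C := 3 * (L * c) + 10 * (b * K).
have C0 : 0 <= C by rewrite addr_ge0 // !mulr_ge0.
have key (k : nat) : (2 <= k)%N -> `|\int[m]_t f t - l| <= C / k%:R.
  move=> k2; have kR : 2 <= k%:R :> R by rewrite ler_nat.
  have kp : 0 < k%:R :> R by exact: lt_le_trans kR.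
  have k1 : 1 <= k%:R :> R by rewrite ler1n (leq_trans _ k2).
  pose dl : R := k%:R^-1; have dl0 : 0 < dl by rewrite invr_gt0.
  pose x (j : nat) : R := - k%:R + j%:R * dl.
  pose N := (2 * k * k)%N.
  have hx j : x j.+1 = x j + dl by rewrite /x -natr1 mulrDl mul1r addrA.
  have x0 : x 0%N = - k%:R by rewrite /x mul0r addr0.
  have xN : x N = k%:R.
    by rewrite /x /N /dl !natrM mulfK ?gt_eqF //; ring.
  have dKk : K * dl = K / k%:R by [].
  have e1 : `|l - riemann f G x N| <= L * dl * c + 2 * (b * (K * dl)).
    have cv : (`|\int[mu n]_t f t - riemann f (dist (mu n)) x N|) @[n --> U]
        --> `|l - riemann f G x N|.
      apply: cvg_norm; apply: cvgB => //; rewrite /riemann.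
      apply: cvg_big => [|j _]; first by move=> /= ?; exact: add_continuous.
      by apply: cvgM; [exact: cvg_cst|apply: cvgB; exact: hG].
    apply: (cvgr_to_le cv); apply: filterE => n.
    apply: le_trans (riemann_estimate (mass n) N (ltW dl0) hx L0 b0 mf hb hL) _.
    rewrite lerD2l mulrCA ler_wpM2l // x0 xN.
    by have := tailN n k1; have := tailP n k1; rewrite /= -dKk; lra.
  have Fk1 : F (- k%:R) <= 2 * (K * dl) by apply: le_trans (Fk _ k2) _; rewrite /dl mulrA.
  have Gk1 : c - K * dl <= G k%:R by exact: GP.
  have e2 : `|\int[m]_t f t - riemann f F x N| <= L * dl * c + 3 * (b * (K * dl)).
    have -> : riemann f F x N = riemann f (dist m) x N.
      by apply: eq_bigr => j _; rewrite !dF.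
    apply: le_trans (riemann_estimate mc N (ltW dl0) hx L0 b0 mf hb hL) _.
    rewrite lerD2l mulrCA ler_wpM2l // x0 xN !dF.
    by have := GF k%:R; lra.
  (* F and G may differ at mesh points. Summation by parts moves the increments to f, which varies
     by at most L dl per cell, and the sum of the gaps F - G telescopes because F(x_j) <=
     G(x_(j+1)). *)
  have e3 : `|riemann f F x N - riemann f G x N| <= L * dl * c + 3 * (b * (K * dl)).
    pose E j := F (x j) - G (x j).
    have -> : riemann f F x N - riemann f G x N =
        \sum_(0 <= j < N) f (x j) * (E j.+1 - E j).
      by rewrite /riemann -sumrB; apply: eq_bigr => j _; rewrite /E; ring.
    rewrite (summation_by_parts (fun j => f (x j))).
    have E0 j : 0 <= E j by rewrite subr_ge0 GF.
    have EG j : E j <= G (x j.+1) - G (x j).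
      by rewrite lerD2r FG // hx ltrDl.
    have hs : `|\sum_(0 <= j < N) (f (x j.+1) - f (x j)) * E j.+1| <= L * dl * c.
      apply: le_trans (ler_norm_sum _ _ _) _.
      apply: (@le_trans _ _ (\sum_(0 <= j < N) L * dl * (G (x j.+2) - G (x j.+1)))).
        apply: ler_sum => j _; rewrite normrM (ger0_norm (E0 _)).
        apply: ler_pM => //.
        by apply: le_trans (hL _ _) _; rewrite hx addrAC subrr add0r gtr0_norm.
      rewrite -mulr_sumr (telescope_sumr (fun j => G (x j.+1))) //.
      rewrite ler_wpM2l ?mulr_ge0 //; first exact: ltW.
      by have := G0 (x 1%N); have := Gc (x N.+1); lra.
    have EN : `|f (x N) * E N| <= b * (K * dl).
      rewrite normrM (ger0_norm (E0 _)); apply: ler_pM => //.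
      by rewrite /E xN; have := FcU k%:R; lra.
    have E00 : `|f (x 0%N) * E 0%N| <= b * (2 * (K * dl)).
      rewrite normrM (ger0_norm (E0 _)); apply: ler_pM => //.
      by rewrite /E x0; have := G0 (- k%:R); lra.
    move: hs EN E00; set s1 := \sum_(_ <= _ < _) _; move=> hs EN E00.
    apply: le_trans (ler_normB _ _) _.
    apply: le_trans (lerD (ler_normB _ _) (lexx _)) _.
    move: hs EN E00; move: `|s1| `|f (x N) * E N| `|f (x 0%N) * E 0%N| => u1 u2 u3.
    by move=> *; lra.
  have -> : \int[m]_t f t - l = (\int[m]_t f t - riemann f F x N) +
     (riemann f F x N - riemann f G x N) - (l - riemann f G x N) by ring.
  have -> : C / k%:R = 3 * (L * dl * c) + 10 * (b * (K * dl)).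
    by rewrite /C /dl; field; rewrite gt_eqF.
  have bK : 0 <= b * (K * dl) by rewrite mulr_ge0 // mulr_ge0 // ltW.
  have tri (u v w : R) : `|u + v - w| <= `|u| + `|v| + `|w|.
    by apply: le_trans (ler_normB _ _) _; rewrite lerD2r ler_normD.
  by have := tri (\int[m]_t f t - riemann f F x N)
    (riemann f F x N - riemann f G x N) (l - riemann f G x N); lra.
apply/eqP; rewrite -subr_eq0 -normr_le0.
have hC := cvg_invn C.
apply: (cvgr_to_ge hC); near=> n; apply: key; near: n; exact: nbhs_infty_ge.
Unshelve. all: by end_near. Qed.

End Compactness.

End Helly.

Section HellyTransforms.
Variable R : realType.
Implicit Types (m : {measure set R -> \bar R}) (z : R[i]) (c : R).

Lemma kernel_lipschitz z x t : Im z != 0 ->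
  `|Re (stieltjes_kernel z x) - Re (stieltjes_kernel z t)|
     <= 2 * `|Im z|^-1 ^+ 2 * `|x - t| /\
  `|Im (stieltjes_kernel z x) - Im (stieltjes_kernel z t)|
     <= 2 * `|Im z|^-1 ^+ 2 * `|x - t|.
Proof.
move=> z0; rewrite -ReB -ImB.
have -> : stieltjes_kernel z x - stieltjes_kernel z t =
    (t - x)%:C * (stieltjes_kernel z x * stieltjes_kernel z t).
  have hx := kernel_neq0 x z0; have ht := kernel_neq0 t z0.
  by rewrite rmorphB /stieltjes_kernel; field; rewrite hx ht.
have [rx ix] := kernel_bound x z0; have [rt it] := kernel_bound t z0.
have bnd2 (u v u' v' k : R) : `|u| <= k -> `|v| <= k -> `|u'| <= k -> `|v'| <= k ->
    `|u * v| + `|u' * v'| <= 2 * k ^+ 2.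
  move=> hu hv hu' hv'; rewrite !normrM mulr2n mulrDl mul1r expr2.
  by apply: lerD; apply: ler_pM.
rewrite ReZ ImZ !normrM distrC ![_ * `|x - t|]mulrC; split; apply: ler_wpM2l => //.
  by rewrite ReM; apply: le_trans (ler_normB _ _) (bnd2 _ _ _ _ _ _ _ _ _).
by rewrite ImM; apply: le_trans (ler_normD _ _) (bnd2 _ _ _ _ _ _ _ _ _).
Qed.

(** At z = i eta, 1 - eta Im (1/(x - z)) = x^2 / (x^2 + eta^2), which is at least 1/2 when |x| >=
    eta; hence the factor 2. *)
Lemma stieltjes_tail m c (s : R[i] -> R[i]) eta (f : R -> R) : m setT = c%:E ->
  (forall z, 0 < Im z -> Cintegral m (stieltjes_kernel z) = s z) -> 0 < eta ->
  measurable_fun setT f -> (forall x, 0 <= f x <= 1) ->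
  (forall x, f x != 0 -> eta ^+ 2 <= x ^+ 2) ->
  \int[m]_x f x <= 2 * (c - eta * Im (s ('i%C * eta%:C))).
Proof.
move=> mc hs e0 mf f01 hf.
have mlt : (m setT < +oo)%E by rewrite mc ltry.
have ez : Im ('i%C * eta%:C : R[i]) = eta by rewrite /=; ring.
have rz : Re ('i%C * eta%:C : R[i]) = 0 by rewrite /=; ring.
have z0 : 0 < Im ('i%C * eta%:C : R[i]) by rewrite ez.
have [_ ik] := kernel_int mc z0.
have i1 : m.-integrable setT (fun=> (2 : R)%:E).
  by apply: (@bounded_integrable _ _ _ _ (fun=> 2) 2) => // x; rewrite ger0_norm.
have i2 : m.-integrable setT (fun x => (2 * eta * Im (stieltjes_kernel ('i%C * eta%:C) x))%:E).
  by apply: (@eq_integrable _ _ _ _ _ _ _ _ _ (integrableZl measurableT (2 * eta) ik)).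
have -> : 2 * (c - eta * Im (s ('i%C * eta%:C))) =
    \int[m]_x (2 - 2 * eta * Im (stieltjes_kernel ('i%C * eta%:C) x)).
  rewrite RintegralB // RintegralZl // Rintegral_cst // mc -hs //=.
  by ring.
apply: le_Rintegral => //.
- apply: (@bounded_integrable _ _ _ _ _ 1) => // x.
  by have /andP[h1 h2] := f01 x; rewrite ger0_norm.
- exact: (integrableB measurableT i1 i2).
move=> x _; rewrite Im_kernel ez rz subr0.
have D0 : 0 < x ^+ 2 + eta ^+ 2 by rewrite ltr_wpDl ?sqr_ge0 ?exprn_gt0.
have -> : 2 - 2 * eta * (eta / (x ^+ 2 + eta ^+ 2)) = 2 * x ^+ 2 / (x ^+ 2 + eta ^+ 2).
  by field; rewrite gt_eqF.
have [->|/hf h] := eqVneq (f x) 0.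
  by apply: divr_ge0; [rewrite mulr_ge0 ?sqr_ge0|exact: ltW].
have /andP[_ h2] := f01 x; apply: le_trans h2 _.
by rewrite ler_pdivlMr // mul1r; lra.
Qed.

Lemma stieltjes_helly c (K : R) (s : nat -> R[i] -> R[i]) (s0 : R[i] -> R[i]) : 0 <= K ->
  (forall n, stieltjes_of c (s n)) ->
  (forall z, 0 < Im z -> Re (s n z) @[n --> \oo] --> Re (s0 z)) ->
  (forall z, 0 < Im z -> Im (s n z) @[n --> \oo] --> Im (s0 z)) ->
  (forall n eta, 1 <= eta -> c - eta * Im (s n ('i%C * eta%:C)) <= K / eta) ->
  stieltjes_of c s0.
Proof.
move=> K0 /choice[mu /all_and2[mass hmu]] hRe hIm tight.
have fin n : (mu n setT < +oo)%E by rewrite mass ltry.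
have tail n t (f : R -> R) : 1 <= t -> measurable_fun setT f -> (forall x, 0 <= f x <= 1) ->
    (forall x, f x != 0 -> t ^+ 2 <= x ^+ 2) -> \int[mu n]_x f x <= 2 * K / t.
  move=> t1 mf f01 hf; have t0 : 0 < t by exact: lt_le_trans t1.
  apply: le_trans (stieltjes_tail (mass n) (hmu n) t0 mf f01 hf) _.
  by rewrite -mulrA ler_wpM2l // tight.
pose r (t : R) : R -> R := \1_(`]-oo, t]%classic).
have mr t : measurable_fun setT (r t).
  by apply: measurable_indic; exact: measurable_itv.
have rE t x : r t x = (x <= t)%R%:R :> R.
  rewrite /r indicE; congr (nat_of_bool _)%:R.
  by apply/idP/idP; rewrite inE /= in_itv.
have tailN n t : 1 <= t -> dist (mu n) (- t) <= 2 * K / t.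
  move=> t1; rewrite -integral_ray; apply: (tail _ _ (r (- t))) => // x; rewrite rE.
    by case: (x <= - t); rewrite lexx ler01.
  have [h _|_] := leP; last by rewrite eqxx.
  by rewrite -(sqrrN x) ler_sqr ?nnegrE; lra.
have tailP n t : 1 <= t -> c - dist (mu n) t <= 2 * K / t.
  move=> t1; have -> : c - dist (mu n) t = \int[mu n]_x (1 - r t x).
    rewrite RintegralB // ?Rintegral_cst // ?mass ?mul1r -?integral_ray //.
      by apply: (@bounded_integrable _ _ _ _ (fun=> 1) 1) => // x; rewrite ger0_norm.
    apply: (@bounded_integrable _ _ _ _ _ 1) => // x; rewrite /= rE.
    by case: (x <= t); rewrite ?normr1 ?normr0.
  apply: tail => //; first by apply: measurable_funB.
    by move=> x; rewrite rE; case: (x <= t); rewrite ?subrr ?subr0 lexx ler01.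
  move=> x; rewrite rE; have [_|h _] := leP; first by rewrite subrr eqxx.
  by rewrite ler_sqr ?nnegrE; lra.
have [|m [mc hm]] := helly _ mass tailN tailP; first by rewrite mulr_ge0.
exists m; split => // z z0.
have nz0 : Im z != 0 by rewrite gt_eqF.
have mk := kernel_meas z (@measurable_id _ _ setT).
apply: complex_ext => /=.
- apply: (hm _ (`|Im z|^-1) (2 * `|Im z|^-1 ^+ 2)) => //.
  + by case: mk.
  + by move=> t; have [] := kernel_bound t nz0.
  + by move=> u v; have [] := kernel_lipschitz u v nz0.
  + have e n : \int[mu n]_t Re (stieltjes_kernel z t) = Re (s n z) by rewrite -hmu.
    by under eq_fun do rewrite e; exact: hRe.
- apply: (hm _ (`|Im z|^-1) (2 * `|Im z|^-1 ^+ 2)) => //.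
  + by case: mk.
  + by move=> t; have [] := kernel_bound t nz0.
  + by move=> u v; have [] := kernel_lipschitz u v nz0.
  + have e n : \int[mu n]_t Im (stieltjes_kernel z t) = Im (s n z) by rewrite -hmu.
    by under eq_fun do rewrite e; exact: hIm.
Qed.

End HellyTransforms.

(** * The fixed point as a matrix-valued Stieltjes transform *)

Section FixedPointTransform.
Context d (Omega : measurableType d) (R : realType) (P : probability Omega R).
Variables (p : nat) (a : R).
Hypothesis a_gt0 : 0 < a.
Local Notation C := R[i].
Implicit Types (S : Omega -> 'M[R]_p) (c : R) (z : C).

Lemma regular_le S c c' : c <= c' -> regular S c -> regular S c'.
Proof. by move=> cc' [h1 h2 h3]; split=> // w; exact: bnd_le cc' (h3 w). Qed.

Lemma regular_entry S c w i j : regular S c -> `|S w i j| <= c.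
Proof. by move=> rS; have := bnd_Re i j (reg_bnd rS w); rewrite mxE. Qed.

Lemma real_bnd_entries (X Y : 'M[R]_p) (e : R) : 0 <= e ->
  (forall i j, `|X i j - Y i j| <= e) ->
  bnd (complexmx X - complexmx Y) (p%:R * p%:R * (2 * e)).
Proof.
move=> e0 h; apply: bnd_entries => // i j; rewrite !mxE ReB ImB /= subrr normr0.
by split.
Qed.

Lemma discretisation S c k : regular S c -> 0 <= c ->
  let dl := p%:R * p%:R * (2 * k.+1%:R^-1) in
  exists Sk, [/\ regular Sk (c + p%:R * p%:R * 2),
    forall w, bnd (complexmx (Sk w) - complexmx (S w)) dl &
    forall n, unital_resolvent (fun z => iterate P a Sk z n)].
Proof.
move=> rS c0 dl; pose K : R := k.+1%:R; have K0 : 0 < K by rewrite ltr0n.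
pose g ij w := K * (S w ij.1 ij.2 + c).
have gE ij w : 0 <= g ij w <= K * (2 * c).
  have := regular_entry w ij.1 ij.2 rS; rewrite ler_norml => /andP[h1 h2].
  by rewrite /g ler_wpM2l ?mulr_ge0 ?(ltW K0) //; lra.
pose N := Num.truncn (K * (2 * c)).
have gN ij w : (Num.truncn (g ij w) < N.+1)%N.
  by rewrite ltnS; apply: le_truncn; have /andP[] := gE ij w.
pose code w : {ffun 'I_p * 'I_p -> 'I_N.+1} :=
  [ffun ij => inord (Num.truncn (g ij w))].
(* Each entry is rounded down to a multiple of 1/K after a shift by c that makes it nonnegative.
   Averaging the codes of (k, l) and (l, k) makes every value symmetric, even for codes that no
   symmetric matrix produces. *)
pose tau (i : {ffun 'I_p * 'I_p -> 'I_N.+1}) : 'M[R]_p :=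
  \matrix_(k, l) (((i (k, l))%:R + (i (l, k))%:R) / (2 * K) - c).
have codeE w ij : code w ij = Num.truncn (g ij w) :> nat.
  by rewrite ffunE inordK.
have code_meas i : measurable (code @^-1` [set i]).
  have -> : code @^-1` [set i] = \bigcap_(ij in setT) [set w | Num.truncn (g ij w) = i ij].
    apply/seteqP; split => w /=.
      by move=> <- ij _ /=; rewrite codeE.
    by move=> h; apply/ffunP => ij; apply: val_inj; rewrite /= codeE; exact: h.
  apply: fin_bigcap_measurable => // ij _.
  have -> : [set w | Num.truncn (g ij w) = i ij] =
      setT `&` g ij @^-1` `[(i ij)%:R, (i ij).+1%:R[%classic.
    rewrite setTI; apply/seteqP; split => w /=; rewrite in_itv /=.
      by move=> <-; apply: truncn_itv; have /andP[] := gE ij w.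
    exact: truncn_def.
  suff mg : measurable_fun setT (g ij) by apply: mg => //; exact: measurable_itv.
  apply: measurable_funM; first exact: measurable_cst.
  by apply: measurable_funD; [exact: reg_meas rS _ _|exact: measurable_cst].
have tau_sym i : (tau i)^T = tau i.
  by apply/matrixP => x y; rewrite !mxE [_%:R + _]addrC.
have err w x y : `|tau (code w) x y - S w x y| <= K^-1.
  have e : g (y, x) w = g (x, y) w.
    by rewrite /g /= -[in LHS](reg_sym rS w) mxE.
  rewrite mxE !codeE e.
  have /andP[h0 _] := gE (x, y) w; have /andP[] := truncn_itv h0.
  set t : R := (Num.truncn _)%:R; rewrite -natr1 -/t /g /= => h1 h2.
  have -> : (t + t) / (2 * K) - c - S w x y = (t - K * (S w x y + c)) / K.
    by field; rewrite gt_eqF.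
  rewrite normrM normfV (gtr0_norm K0) ler_pdivrMr // mulVf ?gt_eqF // ler_norml.
  by lra.
have hb w : bnd (complexmx (tau (code w)) - complexmx (S w)) dl.
  by apply: real_bnd_entries; [rewrite invr_ge0 ltW|move=> i j; exact: err].
have rSk : regular (fun w => tau (code w)) (c + p%:R * p%:R * 2).
  split => // [i j|w].
    have -> : (fun w => tau (code w) i j) =
       (fun w => ((code w (i, j))%:R + (code w (j, i))%:R) / (2 * K) - c).
      by apply/funext => w; rewrite mxE.
    apply: measurable_funB; last exact: measurable_cst.
    apply: measurable_funM; last exact: measurable_cst.
    have mc ij : measurable_fun setT (fun w => (code w ij)%:R : R).
      move=> _ Y _; rewrite setTI.
      have -> : (fun w => (code w ij)%:R : R) @^-1` Y =
          \bigcup_(i in [set i : {ffun 'I_p * 'I_p -> 'I_N.+1} | Y (i ij)%:R]) (code @^-1` [set i]).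
        apply/seteqP; split => [w /= h|w [s /= Ys e]]; last by rewrite e.
        by exists (code w).
      by apply: fin_bigcup_measurable => //; exact: finite_finset.
    by apply: measurable_funD.
  have -> : complexmx (tau (code w)) =
    (complexmx (S w)) + (complexmx (tau (code w)) - complexmx (S w)).
    by rewrite addrC subrK.
  apply: bndD; first exact: reg_bnd rS w.
  apply: bnd_le (hb w); rewrite /dl ler_wpM2l ?mulr_ge0 // ger_pMr //.
  by rewrite invf_le1 ?ltr0n // ler1n.
exists (fun w => tau (code w)); split => // n.
by apply: iterate_resolvent rSk _ => //; rewrite addr_ge0 // !mulr_ge0.
Qed.

Definition sform (v : 'cV[C]_p) (X : 'M[C]_p) : C := (v^t* *m X *m v) 0 0.

Lemma Re_sform v X : Re (sform v X) = rip v (X *m v).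
Proof. by rewrite rip.unlock /sform mulmxA. Qed.

Lemma Im_sform v X : Im (sform v X) = iip v (X *m v).
Proof. by rewrite iip.unlock /sform mulmxA. Qed.

Lemma sform_sum v X : sform v X =
  \sum_i \sum_j (Num.conj (v i 0) * v j 0) * X i j.
Proof.
rewrite /sform mxE exchange_big; apply: eq_bigr => j _ /=.
rewrite mxE mulr_suml; apply: eq_bigr => i _.
by rewrite !mxE mulrAC.
Qed.

Lemma tends_sform v (X : nat -> 'M[C]_p) L : tends X L ->
  (Re (sform v (X n)) @[n --> \oo] --> Re (sform v L)) /\
  (Im (sform v (X n)) @[n --> \oo] --> Im (sform v L)).
Proof.
move=> hX; have bd (f : 'cV[C]_p -> 'cV[C]_p -> R) :
    (forall u w, `|f u w| <= nv u * nv w) ->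
    (forall u x y, f u (x - y) = f u x - f u y) ->
    f v (X n *m v) @[n --> \oo] --> f v (L *m v).
  move=> hf fB; apply/cvgrPdist_le => e e0.
  have v0 : 0 < 1 + nv v ^+ 2 by rewrite ltr_wpDr ?sqr_ge0.
  have [N hN] := hX (e / (1 + nv v ^+ 2)) (divr_gt0 e0 v0).
  exists N => // n /= Nn; rewrite distrC -fB -mulmxBl.
  apply: le_trans (hf _ _) _.
  apply: le_trans (ler_wpM2l (nv_ge0 _) (hN n Nn v)) _.
  rewrite mulrCA -expr2 mulrAC ler_pdivrMr // ler_pM2l // lerDr //.
split.
  under eq_fun do rewrite Re_sform; rewrite Re_sform; apply: bd.
    exact: norm_rip_le.
  by move=> *; rewrite ripBr.
under eq_fun do rewrite Im_sform; rewrite Im_sform; apply: bd.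
  exact: norm_iip_le.
by move=> *; rewrite iipBr.
Qed.

(** Multiplying Phi (- z + E) = 1 out gives 1 + z Phi = Phi E. Besides tightness, this yields the
    normalisation of M at i eta. *)
Lemma Phi_residue S c y z M : regular S c -> 0 <= c -> 0 < y -> 0 < Im z -> Qy y M ->
  bnd (1%:M + z *: Phi P a S z M) ((Im z)^-1 * Kbound a c y).
Proof.
move=> rS c0 y0 z0 hM.
have u := Phi_unit P a_gt0 rS c0 y0 z0 hM.
have -> : 1%:M + z *: Phi P a S z M = Phi P a S z M *m ES P a S M.
  have := mulVmx u; rewrite -/(Phi P a S z M) mulmxDr mulmxN mul_mx_scalar => <-.
  by rewrite addrAC addNr add0r.
apply: bndM; first by rewrite invr_ge0 ltW.
  exact (Phi_bnd P a_gt0 rS c0 y0 z0 hM).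
exact (ES_bnd P a_gt0 rS c0 y0 hM).
Qed.

(** [Kbound] decreases in its last argument, so its value at 1 serves all eta >= 1 and the tightness
    constant depends neither on eta nor on the iterate. *)
Definition tail_const c (v : 'cV[C]_p) := Kbound a c 1 * nv v ^+ 2.

Lemma Phi_tail S c (eta : R) M z (v : 'cV[C]_p) : regular S c -> 0 <= c -> 1 <= eta -> Qy eta M ->
  z = 'i%C * eta%:C ->
  rip v v - eta * Im (sform v (Phi P a S z M)) <= tail_const c v / eta.
Proof.
move=> rS c0 e1 hM zE; have e0 : 0 < eta by exact: lt_le_trans e1.
have ez : Im z = eta by rewrite zE /=; ring.
have hz : 0 < Im z by rewrite ez.
have hb := Phi_residue rS c0 e0 hz hM.
have -> : rip v v - eta * Im (sform v (Phi P a S z M)) =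
    rip v ((1%:M + z *: Phi P a S z M) *m v).
  rewrite mulmxDl mul1mx ripDr -scalemxAl Im_sform; congr (_ + _).
  rewrite rip.unlock iip.unlock -scalemxAr [in RHS]mxE ReM ez zE /=; ring.
apply: le_trans (rip_le _ _) _.
apply: le_trans (ler_wpM2l (nv_ge0 _) (hb v)) _.
have -> : nv v * ((Im z)^-1 * Kbound a c eta * nv v) =
    Kbound a c eta * (nv v ^+ 2 / eta) by rewrite ez; ring.
rewrite /tail_const -mulrA; apply: ler_wpM2r.
  by rewrite divr_ge0 ?sqr_ge0 // ltW.
rewrite /Kbound lerD2l ler_wpM2l ?mulr_ge0 ?sqr_ge0 ?(ltW a_gt0) //.
by rewrite invr1 invf_le1.
Qed.

Lemma iterate_tail S c (eta : R) z v n : regular S c -> 0 <= c -> 1 <= eta -> z = 'i%C * eta%:C ->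
  rip v v - eta * Im (sform v (iterate P a S z n)) <= tail_const c v / eta.
Proof.
move=> rS c0 e1 zE; have e0 : 0 < eta by exact: lt_le_trans e1.
have ez : Im z = eta by rewrite zE /=; ring.
have hz : 0 < Im z by rewrite ez.
case: n => [|n]; last first.
  apply: Phi_tail => //; rewrite -ez; exact (iterate_Qy P a_gt0 rS c0 hz n).
rewrite /iterate /= Im_sform mul_scalar_mx iip_scalar ImN ImV ez.
have -> : Re z = 0 by rewrite zE /=; ring.
have -> : rip v v - eta * (- (- eta / (0 ^+ 2 + eta ^+ 2)) * rip v v) = 0.
  by field; rewrite gt_eqF // expr0n add0r exprn_gt0.
apply: divr_ge0; last exact: ltW.
by rewrite mulr_ge0 ?sqr_ge0 ?Kbound_ge0.
Qed.

Lemma iterate_stieltjes S c v n : regular S c -> 0 <= c ->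
  stieltjes_of (rip v v) (fun z => sform v (iterate P a S z n)).
Proof.
move=> rS c0; pose c' := c + p%:R * p%:R * 2.
have c'0 : 0 <= c' by rewrite addr_ge0 // !mulr_ge0.
have rS' : regular S c' by apply: regular_le rS; rewrite lerDl !mulr_ge0.
have /choice[Sk /all_and3[rSk hSk hres]] := fun k => discretisation k rS c0.
pose dl k : R := p%:R * p%:R * (2 * k.+1%:R^-1).
have dl0 k : 0 <= dl k by rewrite !mulr_ge0.
have dlc : dl k @[k --> \oo] --> (0 : R).
  rewrite -[X in _ --> X](mulr0 (p%:R * p%:R * 2)) /dl.
  under eq_fun do rewrite mulrA.
  by apply: cvgM; [exact: cvg_cst|exact: cvg_harmonic].
have hlim z : 0 < Im z ->
    tends (fun k => iterate P a (Sk k) z n) (iterate P a S z n).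
  by move=> z0; exact (iterate_approx P a_gt0 n rS' rSk c'0 z0 dl0 dlc hSk).
apply: (@stieltjes_helly _ _ (tail_const c' v)
    (fun k z => sform v (iterate P a (Sk k) z n))).
- by rewrite mulr_ge0 ?sqr_ge0 ?Kbound_ge0.
- by move=> k; exact: resolvent_stieltjes (hres k n).
- by move=> z /hlim /(tends_sform v)[].
- by move=> z /hlim /(tends_sform v)[].
- by move=> k eta e1; exact: (iterate_tail v n (rSk k) c'0 e1 erefl).
Qed.

Lemma fixed_point_stieltjes S c v (M : C -> 'M[C]_p) : regular S c -> 0 <= c ->
  (forall z, 0 < Im z -> tends (iterate P a S z) (M z)) ->
  stieltjes_of (rip v v) (fun z => sform v (M z)).
Proof.
move=> rS c0 hM; apply: (@stieltjes_helly _ _ (tail_const c v)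
    (fun n z => sform v (iterate P a S z n))).
- by rewrite mulr_ge0 ?sqr_ge0 ?Kbound_ge0.
- by move=> k; exact: iterate_stieltjes rS c0.
- by move=> z /hM /(tends_sform v)[].
- by move=> z /hM /(tends_sform v)[].
- by move=> k eta e1; exact: (iterate_tail v k rS c0 e1 erefl).
Qed.

End FixedPointTransform.

(** * Convergence of complex matrices and transforms of finite measures *)

Section ComplexConvergence.
Variable R : realType.
Local Notation C := R[i].

(** Convergence by real and imaginary parts keeps the arguments over the reals; [mx_Ccvg] translates
    it to the topology of matrices over [R[i]^o]. *)
Definition Ccvg (T : Type) (F : set_system T) (u : T -> C) (l : C) :=
  (Re (u t) @[t --> F] --> Re l) /\ (Im (u t) @[t --> F] --> Im l).

Section Filter.
Context (T : Type) (F : set_system T) {FF : Filter F}.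
Implicit Types (u : T -> C) (l : C).

Lemma eq_Ccvg u u' l : u =1 u' -> Ccvg F u l -> Ccvg F u' l.
Proof. by move=> /funext ->. Qed.

Lemma CcvgZ c u l : Ccvg F u l -> Ccvg F (fun t => c * u t) (c * l).
Proof.
move=> [hr hi]; split.
  rewrite ReM; under eq_fun do rewrite ReM.
  by apply: cvgB; (apply: cvgM; first exact: cvg_cst).
rewrite ImM; under eq_fun do rewrite ImM.
by apply: cvgD; (apply: cvgM; first exact: cvg_cst).
Qed.

Lemma CcvgD u v k l : Ccvg F u k -> Ccvg F v l -> Ccvg F (fun t => u t + v t) (k + l).
Proof.
move=> [hr hi] [hr' hi']; split.
  by rewrite ReD; under eq_fun do rewrite ReD; exact: cvgD.
by rewrite ImD; under eq_fun do rewrite ImD; exact: cvgD.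
Qed.

Lemma Ccvg_cst c : Ccvg F (fun=> c) c.
Proof. by split; exact: cvg_cst. Qed.

Lemma Ccvg_sum (I : Type) (r : seq I) (u : I -> T -> C) (l : I -> C) :
  (forall i, Ccvg F (u i) (l i)) ->
  Ccvg F (fun t => \sum_(i <- r) u i t) (\sum_(i <- r) l i).
Proof.
move=> h; elim: r => [|i r IH].
  by rewrite big_nil; apply: eq_Ccvg (Ccvg_cst 0) => t; rewrite big_nil.
rewrite big_cons; apply: eq_Ccvg (CcvgD (h i) IH) => t.
by rewrite big_cons.
Qed.

Lemma mx_Ccvg p (X : T -> 'M[C]_p) (L : 'M[C]_p) :
  (forall i j, Ccvg F (fun t => X t i j) (L i j)) ->
  (X : T -> 'M[C^o]_p) @ F --> (L : 'M[C^o]_p).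
Proof.
move=> h; apply/cvg_ballP => e e0.
have [r eE r0] : exists2 r : R, e = r%:C & 0 < r.
  by case: e e0 => r s; rewrite ltcE /= => /andP[/eqP -> r0]; exists r.
suff hij : forall ij : 'I_p * 'I_p, \forall t \near F,
    ball (L ij.1 ij.2 : C^o) e (X t ij.1 ij.2 : C^o).
  have := @filter_forall _ _ _ F FF hij.
  by apply: filterS => t ht; split => // i j; exact: (ht (i, j)).
move=> [i j] /=; have [hr hi] := h i j; have r2 : 0 < r / 2 by rewrite divr_gt0.
move/cvgrPdist_lt: hr => /(_ _ r2) hr; move/cvgrPdist_lt: hi => /(_ _ r2) hi.
near=> t; rewrite /ball /= eE.
have hr2 : `|Re (L i j) - Re (X t i j)| < r / 2.
  by near: t.
have hi2 : `|Im (L i j) - Im (X t i j)| < r / 2.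
  by near: t.
change ((Normc.normc (L i j - X t i j))%:C < r%:C); rewrite ltcR; apply: le_lt_trans (normc_le _) _.
by rewrite ReB ImB; lra.
Unshelve. all: by end_near. Qed.

End Filter.
End ComplexConvergence.

Section FiniteOfMeasure.
Context (R : realType) (m : {measure set R -> \bar R}) (fm : fin_num_fun m).
(** A copy of m under its own name, to which the instance of a finite measure can be attached. *)
Definition finite_of_measure_def of fin_num_fun m : set R -> \bar R := m.
Local Notation n := (finite_of_measure_def fm).
HB.instance Definition _ := Measure.on n.
Let n_fin : fin_num_fun n. Proof. exact: fm. Qed.
HB.instance Definition _ := Measure_isFinite.Build _ _ _ n n_fin.
Definition finite_of_measure : {finite_measure set R -> \bar R} := n.
End FiniteOfMeasure.

Section FiniteMeasures.
Variable R : realType.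
Local Notation C := R[i].
Implicit Types (m : {finite_measure set R -> \bar R}) (z : C).

Lemma stieltjes_of_finite c s : stieltjes_of c s ->
  exists m, m setT = c%:E /\ forall z, 0 < Im z -> Cintegral m (stieltjes_kernel z) = s z.
Proof.
move=> [m [mc hm]].
have fm : fin_num_fun m.
  move=> A mA; rewrite ge0_fin_numE //; apply: (@le_lt_trans _ _ (m setT)).
    by apply: le_measure; rewrite ?inE.
  by rewrite mc ltry.
by exists (finite_of_measure fm).
Qed.

Lemma kernel_conj z x : stieltjes_kernel (Num.conj z) x = Num.conj (stieltjes_kernel z x).
Proof. by rewrite /stieltjes_kernel [in RHS]fmorphV [in RHS]rmorphB /= conj_real. Qed.

Lemma transform_conj m z : Im z != 0 ->
  Cintegral m (stieltjes_kernel (Num.conj z)) =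
  Num.conj (Cintegral m (stieltjes_kernel z)).
Proof.
move=> z0; have [_ ik] := kernel_integrable m z0 (@measurable_id _ _ setT).
apply: complex_ext; rewrite ?Re_conj ?Im_conj /=.
  by apply: eq_Rintegral => x _; rewrite kernel_conj Re_conj.
rewrite -mulN1r -RintegralZl //; apply: eq_Rintegral => x _.
by rewrite kernel_conj Im_conj mulN1r.
Qed.

Lemma normc_ge0 (x : C) : 0 <= Normc.normc x.
Proof. by case: x => ? ?; exact: sqrtr_ge0. Qed.

Lemma normc_ge_Re (x : C) : `|Re x| <= Normc.normc x.
Proof. by rewrite -lecR; exact: Re_normr_le. Qed.

Lemma normc_ge_Im (x : C) : `|Im x| <= Normc.normc x.
Proof. by case: x => s t /=; rewrite -sqrtr_sqr ler_sqrt ?addr_ge0 ?sqr_ge0 // lerDr sqr_ge0. Qed.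

Lemma normcX (x : C) n : Normc.normc (x ^+ n) = Normc.normc x ^+ n.
Proof. by elim: n => [|n IH]; rewrite ?expr0 ?Normc.normc1 // !exprS Normc.normcM IH. Qed.

Lemma normc_kernel z x : Im z != 0 -> Normc.normc (stieltjes_kernel z x) <= `|Im z|^-1.
Proof.
move=> z0; rewrite /stieltjes_kernel.
have h : `|Im z| <= Normc.normc (x%:C - z).
  by apply: le_trans (normc_ge_Im _); rewrite ImB /= sub0r normrN.
have n0 : 0 < `|Im z| by rewrite normr_gt0.
rewrite -(ler_pM2r (lt_le_trans n0 h)) -Normc.normcM mulVf ?kernel_neq0 // Normc.normc1.
by rewrite mulrC ler_pdivlMr // mul1r.
Qed.

Lemma Cintegral_le m (f : R -> C) (b : R) : Cmeas f -> (forall x, Normc.normc (f x) <= b) ->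
  `|Re (Cintegral m f)| <= b * fine (m setT) /\ `|Im (Cintegral m f)| <= b * fine (m setT).
Proof.
move=> mf hb.
have bd (h : R -> R) : measurable_fun setT h -> (forall x, `|h x| <= b) ->
    `|\int[m]_x h x| <= b * fine (m setT).
  move=> mh hh; have ih := bounded_integrable (finite_measure_lty m) mh hh.
  apply: le_trans (le_normr_Rintegral measurableT ih) _.
  rewrite -Rintegral_cst //; apply: le_Rintegral => //.
    by have := integrable_abse ih.
  apply: (@bounded_integrable _ _ _ _ _ `|b|) => //; exact: finite_measure_lty.
have [mr mi] := mf.
split; apply: bd => // x; apply: le_trans (hb x).
  exact: normc_ge_Re.
exact: normc_ge_Im.
Qed.

Lemma CmeasX (f : R -> C) n : Cmeas f -> Cmeas (fun x => f x ^+ n).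
Proof.
move=> mf; elim: n => [|n IH]; first exact: Cmeas_cst.
by apply: eq_Cmeas (CmeasM mf IH) => x; rewrite exprS.
Qed.

(* The Neumann series 1/(x - z) = sum_n (z - z0)^n / (x - z0)^(n+1), integrated. *)
Lemma transform_series m z0 z : 0 < Im z0 -> Normc.normc (z - z0) < Im z0 ->
  Ccvg \oo (fun N => \sum_(0 <= n < N)
      (z - z0) ^+ n * Cintegral m (fun x => stieltjes_kernel z0 x ^+ n.+1))
    (Cintegral m (stieltjes_kernel z)).
Proof.
move=> y0 hz; set y := Im z0.
have z0n : Im z0 != 0 by rewrite gt_eqF.
have zn : Im z != 0.
  have := normc_ge_Im (z - z0); rewrite ImB ler_norml => /andP[h _].
  by rewrite gt_eqF //; lra.
pose k0 := stieltjes_kernel z0; pose k := stieltjes_kernel z; pose w := z - z0.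
have mk0 : Cmeas k0 := kernel_meas z0 (@measurable_id _ _ setT).
have mk : Cmeas k := kernel_meas z (@measurable_id _ _ setT).
have ik0 n : Cintegrable m (fun x => k0 x ^+ n.+1).
  apply: (@Cintegrable_bounded _ _ _ _ _ (`|Im z0|^-1 ^+ n.+1)).
  - exact: finite_measure_lty.
  - exact: CmeasX.
  - move=> x; have h : Normc.normc (k0 x ^+ n.+1) <= `|Im z0|^-1 ^+ n.+1.
      by rewrite normcX lerXn2r ?nnegrE ?normc_ge0 ?invr_ge0 // normc_kernel.
    by split; apply: le_trans h; [exact: normc_ge_Re|exact: normc_ge_Im].
pose r := Normc.normc w / y.
have r0 : 0 <= r by rewrite divr_ge0 ?normc_ge0 // ltW.
have r1 : r < 1 by rewrite ltr_pdivrMr // mul1r.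
(* The finite geometric sum with its exact remainder, from k0 = k (1 - w k0). The remainder decays
   like r^N because |k0| <= 1 / Im z0. *)
have geo x N : \sum_(0 <= n < N) w ^+ n * k0 x ^+ n.+1 = k x - k x * (w * k0 x) ^+ N.
  have hx := kernel_neq0 x zn; have hx0 := kernel_neq0 x z0n.
  have e : k0 x = k x * (1 - w * k0 x).
    by rewrite /k /k0 /w /stieltjes_kernel; field; rewrite hx hx0.
  elim: N => [|N IH]; first by rewrite big_nil expr0 mulr1 subrr.
  rewrite big_nat_recr //= IH [(w * _) ^+ N.+1]exprS !exprMn.
  have -> : k0 x ^+ N.+1 = k x * (1 - w * k0 x) * k0 x ^+ N by rewrite -e exprS.
  by ring.
pose D N := Cintegral m (fun x => - k x * (w * k0 x) ^+ N).
have mD N : Cmeas (fun x => - k x * (w * k0 x) ^+ N).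
  apply: CmeasM; first exact: CmeasN.
  by apply: CmeasX; apply: CmeasM mk0; exact: Cmeas_cst.
have nD N x : Normc.normc (- k x * (w * k0 x) ^+ N) <= `|Im z|^-1 * r ^+ N.
  rewrite Normc.normcM normcX Normc.normcM; apply: ler_pM.
  - exact: normc_ge0.
  - by rewrite exprn_ge0 // mulr_ge0 // normc_ge0.
  - rewrite -mulN1r Normc.normcM -[Normc.normc (-1)]/(Num.sqrt _) /=.
    by rewrite oppr0 expr0n sqrrN expr1n addr0 sqrtr1 mul1r normc_kernel.
  - rewrite lerXn2r ?nnegrE ?mulr_ge0 ?normc_ge0 ?invr_ge0 ?(ltW y0) //.
    rewrite ler_wpM2l ?normc_ge0 //.
    by apply: le_trans (normc_kernel x z0n) _; rewrite gtr0_norm.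
have iD N : Cintegrable m (fun x => - k x * (w * k0 x) ^+ N).
  apply: (@Cintegrable_bounded _ _ _ _ _ (`|Im z|^-1 * r ^+ N)) => //.
    exact: finite_measure_lty.
  move=> x; split; apply: le_trans (nD N x); [exact: normc_ge_Re|exact: normc_ge_Im].
have ik := kernel_integrable m zn (@measurable_id _ _ setT).
have sumE N : \sum_(0 <= n < N) w ^+ n * Cintegral m (fun x => k0 x ^+ n.+1) =
    Cintegral m k + D N.
  under eq_bigr do rewrite -CintegralZ //.
  rewrite -Cintegral_sum => [|n _]; last exact: CintegrableZ.
  rewrite -CintegralD //; apply: eq_Cintegral => x.
  by rewrite geo mulNr.
have D0 : Ccvg \oo D 0.
  have hr : `|Im z|^-1 * r ^+ N * fine (m setT) @[N --> \oo] --> (0 : R).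
    rewrite -[X in _ --> X](mul0r (fine (m setT))); apply: cvgM; last exact: cvg_cst.
    rewrite -[X in _ --> X](mulr0 (`|Im z|^-1)); apply: cvgM; first exact: cvg_cst.
    by apply: cvg_expr; rewrite ger0_norm.
  split; apply/norm_cvg0P; apply: squeeze_cvgr (cvg_cst 0) hr; apply: nearW => N.
    by rewrite normr_ge0; have [] := Cintegral_le m (mD N) (nD N).
  by rewrite normr_ge0; have [] := Cintegral_le m (mD N) (nD N).
rewrite -[Cintegral m k]addr0.
have hc : Ccvg \oo (fun=> Cintegral m k) (Cintegral m k) by exact: Ccvg_cst.
have : Ccvg \oo (fun N => Cintegral m k + D N) (Cintegral m k + 0) by exact: CcvgD.
by apply: eq_Ccvg => N; rewrite -sumE.
Qed.

Lemma fine_sigma_additive m (F : nat -> set R) : (forall n, measurable (F n)) ->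
  trivIset setT F ->
  Ccvg \oo (fun N => \sum_(0 <= n < N) (fine (m (F n)))%:C) (fine (m (\bigcup_n F n)))%:C.
Proof.
move=> mF tF; have mU : measurable (\bigcup_n F n) by exact: bigcup_measurable.
have h : \sum_(0 <= n < N) fine (m (F n)) @[N --> \oo] --> fine (m (\bigcup_n F n)).
  have e : (fun N => \sum_(0 <= n < N) fine (m (F n))) =
      (fun N => fine (\sum_(0 <= n < N) m (F n))%E).
    apply/funext => N; rewrite -[LHS]/(fine (_%:E)) -sumEFin; congr fine.
    by apply: eq_bigr => n _; rewrite fineK ?fin_num_measure.
  rewrite e; apply: fine_cvg; rewrite fineK ?fin_num_measure //.
  exact: measure_semi_sigma_additive.
split=> /=.
  by under eq_fun do rewrite Re_sum /=.
by under eq_fun do rewrite Im_sum /= big1 //; exact: cvg_cst.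
Qed.

End FiniteMeasures.

(** * Polarisation and the matrix measure *)

Section Polarisation.
Context (R : realType) (p : nat).
Local Notation C := R[i].
Implicit Types (X : 'M[C]_p) (v : 'cV[C]_p).

Lemma sform_adj v X : sform v (X^t*) = Num.conj (sform v X).
Proof.
rewrite !sform_sum exchange_big rmorph_sum; apply: eq_bigr => j _ /=.
rewrite rmorph_sum; apply: eq_bigr => i _.
by rewrite !mxE !rmorphM /= conjCK; ring.
Qed.

(* [X i j] is the combination of the values of the quadratic form of [X] at
   [e_j + i^k e_i], [k < 4], with coefficients [i^k / 4]. *)
Definition pol (i j : 'I_p) (k : 'I_4) : 'cV[C]_p :=
  delta_mx j 0 + 'i%C ^+ k *: delta_mx i 0.

Lemma sform_delta X i : sform (delta_mx i 0) X = X i i.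
Proof.
rewrite sform_sum (bigD1 i) //= [X in _ + X]big1 => [|j ji]; last first.
  by rewrite big1 // => l _; rewrite !mxE (negbTE ji) /= conjC0 !mul0r.
rewrite (bigD1 i) //= big1 => [|j ji]; last first.
  by rewrite !mxE (negbTE ji) /= mulr0 mul0r.
by rewrite !mxE !eqxx /= conjC1 !mul1r !addr0.
Qed.

Lemma sform_pol X i j k : sform (pol i j k) X = X j j + 'i%C ^+ k * X j i +
  Num.conj ('i%C ^+ k) * X i j + Num.conj ('i%C ^+ k) * 'i%C ^+ k * X i i.
Proof.
have E l s : ((delta_mx l 0 : 'cV[C]_p)^t* *m X *m delta_mx s 0) 0 0 = X l s.
  have -> : (delta_mx l 0 : 'cV[C]_p)^t* = delta_mx 0 l.
    apply/matrixP => x y; rewrite !mxE [(y == l) && _]andbC.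
    by case: (_ && _); rewrite ?conjC1 ?conjC0.
  by rewrite -rowE mxE (bigD1 s) //= big1 => [|t ts];
    rewrite !mxE ?eqxx ?mulr1 ?addr0 // (negbTE ts) mulr0.
have eD (Y Z : 'M[C]_1) : (Y + Z) 0 0 = Y 0 0 + Z 0 0 by rewrite mxE.
have eZ (c : C) (Y : 'M[C]_1) : (c *: Y) 0 0 = c * Y 0 0 by rewrite mxE.
have hl (u u' : 'rV[C]_p) (Y : 'cV[C]_p) c :
    ((u + c *: u') *m X *m Y) 0 0 = (u *m X *m Y) 0 0 + c * (u' *m X *m Y) 0 0.
  by rewrite mulmxDl mulmxDl -scalemxAl -scalemxAl eD eZ.
have hr (u : 'rV[C]_p) (Y Y' : 'cV[C]_p) c :
    (u *m (Y + c *: Y')) 0 0 = (u *m Y) 0 0 + c * (u *m Y') 0 0.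
  by rewrite mulmxDr -scalemxAr eD eZ.
by rewrite /sform /pol adjD adjZ hl !hr !E; ring.
Qed.

Lemma polarisation X i j :
  \sum_(k < 4) 'i%C ^+ k * ((4^-1)%:C * sform (pol i j k) X) = X i j.
Proof.
under eq_bigr do rewrite sform_pol.
rewrite !big_ord_recl big_ord0 /= /bump /= !expr0 ?expr1 !exprS !expr0.
case: (X i j) (X j i) (X i i) (X j j) => [a1 a2] [b1 b2] [c1 c2] [d1 d2].
by apply: complex_ext => /=; field.
Qed.

Lemma sform_eq0 X : (forall v, sform v X = 0) -> X = 0.
Proof.
move=> h; apply/matrixP => i j; rewrite -polarisation mxE big1 // => k _.
by rewrite h !mulr0.
Qed.

Lemma sformB v X Y : sform v (X - Y) = sform v X - sform v Y.
Proof. by rewrite /sform mulmxBr mulmxBl !mxE. Qed.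

Lemma sform1 v : sform v 1%:M = (rip v v)%:C.
Proof.
apply: complex_ext; first by rewrite Re_sform mul1mx.
by rewrite Im_sform mul1mx /= -[X in iip _ X]mul1mx iip_herm // adj1.
Qed.

End Polarisation.

Section Representation.
Context (R : realType) (p : nat).
Local Notation C := R[i].
Variable M : C -> 'M[C]_p.
Hypothesis hM : forall v, stieltjes_of (rip v v) (fun z => sform v (M z)).
Implicit Types (v : 'cV[C]_p) (z : C) (m : {finite_measure set R -> \bar R}).

(* The extension of [M] to the lower half-plane by the symmetry of Stieltjes
   transforms of Hermitian measures. *)
Let N z : 'M[C]_p := if 0 < Im z then M z else (M (Num.conj z))^t*.

Let transformN m v c : (forall z, 0 < Im z ->
    Cintegral m (stieltjes_kernel z) = c%:C * sform v (M z)) ->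
  forall z, Im z != 0 -> Cintegral m (stieltjes_kernel z) = c%:C * sform v (N z).
Proof.
move=> h z z0; rewrite /N; case: ifPn => [|zn]; first exact: h.
have zc : 0 < Im (Num.conj z) by rewrite Im_conj oppr_gt0 lt_neqAle z0 leNgt.
by rewrite sform_adj -(conj_real c) -rmorphM /= -h // -transform_conj ?gt_eqF // conjCK.
Qed.

Lemma exists_form_measures : exists nu : 'cV[C]_p -> {finite_measure set R -> \bar R},
  (forall v, nu v setT = (rip v v)%:E) /\
  forall v z, Im z != 0 -> Cintegral (nu v) (stieltjes_kernel z) = sform v (N z).
Proof.
have /choice[nu hnu] := fun v => stieltjes_of_finite (hM v).
exists nu; split => [v|v z z0]; first by case: (hnu v).
rewrite -[RHS]mul1r -[1]/(1%:C : C); apply: transformN z0 => z' z'0.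
by rewrite mul1r; have [_ ->] := hnu v.
Qed.

(** [has_complex_integral] only admits the coefficients i^k, so the factor 1/4 of the polarisation
    identity is absorbed into the measures. *)
Lemma exists_quarter_measures : exists q : 'cV[C]_p -> {finite_measure set R -> \bar R},
  forall v z, Im z != 0 ->
    Cintegral (q v) (stieltjes_kernel z) = (4^-1)%:C * sform v (N z).
Proof.
have q0 : 0 <= 4^-1 :> R by rewrite invr_ge0.
have /choice[q hq] := fun v => stieltjes_of_finite (stieltjes_ofZ q0 (hM v)).
exists q => v z z0; apply: transformN z0 => z' z'0.
by have [_ ->] := hq v.
Qed.

End Representation.

Section MatrixMeasure.
Context (R : realType) (p : nat).
Local Notation C := R[i].
Variables (N : C -> 'M[C]_p) (nu q : 'cV[C]_p -> {finite_measure set R -> \bar R}).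
Hypothesis nuT : forall v, nu v setT = (rip v v)%:E.
Hypothesis nu_tr : forall v z, Im z != 0 ->
  Cintegral (nu v) (stieltjes_kernel z) = sform v (N z).
Hypothesis q_tr : forall v z, Im z != 0 ->
  Cintegral (q v) (stieltjes_kernel z) = (4^-1)%:C * sform v (N z).
Implicit Types (v : 'cV[C]_p) (z : C) (A : set R).

Definition mxmeasure A : 'M[C]_p :=
  \matrix_(i, j) \sum_(k < 4) 'i%C ^+ k * (fine (q (pol R i j k) A))%:C.

Lemma sform_mxmeasure v A : measurable A -> sform v (mxmeasure A) = (fine (nu v A))%:C.
Proof.
move=> mA; pose T : finType := ('I_p * 'I_p * 'I_4)%type.
pose c (t : T) : C := Num.conj (v t.1.1 0) * v t.1.2 0 * 'i%C ^+ t.2.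
have E (f : 'cV[C]_p -> C) :
    \sum_i \sum_j Num.conj (v i 0) * v j 0 * (\sum_(k < 4) 'i%C ^+ k * f (pol R i j k)) =
    \sum_(t : T) c t * f (pol R t.1.1 t.1.2 t.2).
  rewrite pair_bigA /=; under eq_bigr do rewrite mulr_sumr.
  by rewrite pair_bigA; apply: eq_bigr => t _; rewrite /c mulrA.
have -> : sform v (mxmeasure A) =
    \sum_(t : T) c t * (fine (q (pol R t.1.1 t.1.2 t.2) A))%:C.
  rewrite -(E (fun u => (fine (q u A))%:C)) sform_sum.
  by apply: eq_bigr => i _; apply: eq_bigr => j _; rewrite mxE.
(* The extra index carries [nu v] with coefficient - 1, which makes the claim the vanishing of a
   single combination. *)
pose c' (t : T + 'I_1) : C := match t with inl t => c t | inr _ => -1 end.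
pose m (t : T + 'I_1) := match t with
  inl t => q (pol R t.1.1 t.1.2 t.2) | inr _ => nu v end.
have := @stieltjes_injective _ _ c' m _ _ mA.
rewrite !big_sumType /= big_ord1 mulN1r => /(_ _)/eqP; rewrite subr_eq0 => h.
apply/eqP/h => z z0; rewrite big_sumType /= big_ord1 mulN1r nu_tr //.
under eq_bigr do rewrite q_tr //.
rewrite -(E (fun u => (4^-1)%:C * sform u (N z))); apply/eqP; rewrite subr_eq0; apply/eqP.
rewrite [RHS]sform_sum; apply: eq_bigr => i _; apply: eq_bigr => j _.
by rewrite polarisation.
Qed.

Lemma mxmeasure_psd : psd_mxmeasure mxmeasure.
Proof.
split.
- apply/matrixP => i j; rewrite !mxE big1 // => k _.
  by rewrite measure0 mulr0.
- move=> A mA; split.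
    apply/eqP; rewrite -subr_eq0; apply/eqP; apply: sform_eq0 => v.
    by rewrite sformB sform_adj sform_mxmeasure // conj_real subrr.
  move=> v; rewrite -/(sform _ _) sform_mxmeasure //.
  by rewrite lecR fine_ge0.
- move=> F mF tF; apply: mx_Ccvg => i j; rewrite mxE.
  have h (k : 'I_4) : Ccvg \oo (fun n => 'i%C ^+ k *
     \sum_(0 <= l < n) (fine (q (pol R i j k) (F l)))%:C)
     ('i%C ^+ k * (fine (q (pol R i j k) (\bigcup_n F n)))%:C).
    by apply: CcvgZ; exact: fine_sigma_additive.
  have : Ccvg \oo (fun n => \sum_(k < 4) 'i%C ^+ k *
       \sum_(0 <= l < n) (fine (q (pol R i j k) (F l)))%:C)
     (\sum_(k < 4) 'i%C ^+ k * (fine (q (pol R i j k) (\bigcup_n F n)))%:C).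
    exact: Ccvg_sum.
  apply: eq_Ccvg => n.
  rewrite /series /= summxE; under [RHS]eq_bigr do rewrite mxE.
  rewrite exchange_big; apply: eq_bigr => k _; exact: mulr_sumr.
Qed.

Lemma mxmeasureT : mxmeasure setT = 1%:M.
Proof.
apply/eqP; rewrite -subr_eq0; apply/eqP; apply: sform_eq0 => v.
by rewrite sformB sform_mxmeasure // nuT sform1 subrr.
Qed.

Lemma mxmeasure_transform z : Im z != 0 ->
  has_mxintegral mxmeasure (stieltjes_kernel z) (N z).
Proof.
move=> z0 i j; exists (fun k => q (pol R i j k)); split.
- by move=> A mA; rewrite mxE.
- by move=> k; exact: (kernel_integrable _ z0 (@measurable_id _ _ setT)).
- by under eq_bigr do rewrite q_tr //; rewrite polarisation.
Qed.

Lemma transform_analytic (M : C -> 'M[C]_p) : (forall z, 0 < Im z -> N z = M z) ->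
  analytic_on (@upper_half R) M.
Proof.
move=> NM z0 /= y0; exists (Im z0) => //.
pose a n : 'M[C]_p := \matrix_(i, j) \sum_(k < 4) 'i%C ^+ k *
  Cintegral (q (pol R i j k)) (fun x => stieltjes_kernel z0 x ^+ n.+1).
exists a => z; rewrite ltcR => hz.
have yz : 0 < Im z.
  have := normc_ge_Im (z - z0); rewrite ImB ler_norml => /andP[h _].
  have {}hz : Normc.normc (z - z0) < Im z0 := hz.
  lra.
apply: mx_Ccvg => i j.
have -> : M z i j = \sum_(k < 4) 'i%C ^+ k * Cintegral (q (pol R i j k)) (stieltjes_kernel z).
  by under eq_bigr do rewrite q_tr ?gt_eqF //; rewrite polarisation NM.
have : Ccvg \oo (fun n => \sum_(k < 4) 'i%C ^+ k * \sum_(0 <= l < n) (z - z0) ^+ l *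
      Cintegral (q (pol R i j k)) (fun x => stieltjes_kernel z0 x ^+ l.+1))
    (\sum_(k < 4) 'i%C ^+ k * Cintegral (q (pol R i j k)) (stieltjes_kernel z)).
  by apply: Ccvg_sum => k; apply: CcvgZ; exact: transform_series.
apply: eq_Ccvg => n.
rewrite /series /= summxE; under [RHS]eq_bigr do rewrite !mxE mulr_sumr.
rewrite exchange_big; apply: eq_bigr => k _; rewrite mulr_sumr.
by apply: eq_bigr => l _; rewrite mulrCA.
Qed.

End MatrixMeasure.

(** * Uniqueness of the matrix measure, and its normalised trace *)

Section Decompositions.
Variable R : realType.
Local Notation C := R[i].
Implicit Types (a b c d : {finite_measure set R -> \bar R}) (f : R -> C).

(** Moving the subtracted measures across, a + d and c + b are equal positive measures, so no signed
    integral is needed. *)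
Lemma Rintegral_diff a b c d (h : R -> R) :
  (forall A, measurable A -> fine (a A) - fine (b A) = fine (c A) - fine (d A)) ->
  a.-integrable setT (EFin \o h) -> b.-integrable setT (EFin \o h) ->
  c.-integrable setT (EFin \o h) -> d.-integrable setT (EFin \o h) ->
  \int[a]_x h x - \int[b]_x h x = \int[c]_x h x - \int[d]_x h x.
Proof.
move=> e ia ib ic id; have mh := measurable_int _ ia.
suff : \int[measure_add a d]_x h x = \int[measure_add c b]_x h x.
  have add (m m' : {measure set R -> \bar R}) : m.-integrable setT (EFin \o h) ->
      m'.-integrable setT (EFin \o h) ->
      \int[measure_add m m']_x h x = \int[m]_x h x + \int[m']_x h x.
    by move=> im im'; rewrite /Rintegral integral_measure_add // fineD // integrable_fin_num.
  by rewrite !add //; lra.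
congr fine; apply: eq_measure_integral => A mA _; rewrite [LHS]measure_addE [RHS]measure_addE.
rewrite -[LHS]fineK ?fin_numD ?fin_num_measure //.
rewrite -[RHS]fineK ?fin_numD ?fin_num_measure //.
by congr EFin; rewrite !fineD ?fin_num_measure //; have := e _ mA; lra.
Qed.

Lemma sum_powers_i (x : 'I_4 -> C) : \sum_(k < 4) 'i%C ^+ k * x k =
  (x 0 - x 2) + 'i%C * (x 1 - x 3).
Proof.
rewrite !big_ord_recl big_ord0 /= /bump /= !exprS !expr0.
have -> : lift ord0 ord0 = 1 :> 'I_4 by apply: val_inj.
have -> : lift ord0 (lift ord0 ord0) = 2 :> 'I_4 by apply: val_inj.
have -> : lift ord0 (lift ord0 (lift ord0 ord0)) = 3 :> 'I_4 by apply: val_inj.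
have -> : ord0 = 0 :> 'I_4 by [].
case: (x 0) (x 1) (x 2) (x 3) => [a1 a2] [b1 b2] [c1 c2] [d1 d2].
by apply: complex_ext => /=; ring.
Qed.

(** The even indices carry the real part and the odd ones the imaginary part; on each,
    [Rintegral_diff] compares the two differences. *)
Lemma decomposition_unique (m m' : 'I_4 -> {finite_measure set R -> \bar R}) f :
  (forall A, measurable A -> \sum_(k < 4) 'i%C ^+ k * (fine (m k A))%:C =
                             \sum_(k < 4) 'i%C ^+ k * (fine (m' k A))%:C :> C) ->
  (forall k, Cintegrable (m k) f) -> (forall k, Cintegrable (m' k) f) ->
  \sum_(k < 4) 'i%C ^+ k * Cintegral (m k) f =
  \sum_(k < 4) 'i%C ^+ k * Cintegral (m' k) f.
Proof.
move=> e im im'; rewrite !sum_powers_i.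
have e02 A : measurable A -> fine (m 0 A) - fine (m 2 A) = fine (m' 0 A) - fine (m' 2 A).
  move=> mA; have := e _ mA; rewrite !sum_powers_i => /(congr1 (@complex.Re R)).
  by rewrite !(ReD, ReN, ReM) /=; lra.
have e13 A : measurable A -> fine (m 1 A) - fine (m 3 A) = fine (m' 1 A) - fine (m' 3 A).
  move=> mA; have := e _ mA; rewrite !sum_powers_i => /(congr1 (@complex.Im R)).
  by rewrite !(ImD, ImN, ImM) /=; lra.
congr (_ + 'i%C * _); apply: complex_ext; rewrite ?ReB ?ImB /=; apply: Rintegral_diff => //;
  by [case: (im 0)|case: (im 1)|case: (im 2)|case: (im 3)|case: (im' 0)|case: (im' 1)
     |case: (im' 2)|case: (im' 3)].
Qed.

(** [- k] is the opposite in ['I_4], that is, modulo 4. *)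
Lemma conj_power_i (k : 'I_4) : Num.conj ('i%C ^+ k) = 'i%C ^+ (- k : 'I_4)%R :> C.
Proof.
by case: k => [[|[|[|[|//]]]] hk]; rewrite /= ?exprS ?expr0; apply: complex_ext => /=; ring.
Qed.

Lemma conj_sum_powers_i (x : 'I_4 -> C) :
  Num.conj (\sum_(k < 4) 'i%C ^+ k * x k) = \sum_(k < 4) 'i%C ^+ k * Num.conj (x (- k)).
Proof.
rewrite [RHS](reindex_inj oppr_inj) /= rmorph_sum; apply: eq_bigr => k _.
by rewrite rmorphM /= conj_power_i opprK.
Qed.

End Decompositions.

Section ProbabilityOfMeasure.
Context (R : realType) (m : {measure set R -> \bar R}) (m1 : m setT = 1%E).
Definition probability_of_measure_def of m setT = 1%E : set R -> \bar R := m.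
Local Notation n := (probability_of_measure_def m1).
HB.instance Definition _ := Measure.on n.
Let n_setT : n setT = 1%E. Proof. exact: m1. Qed.
HB.instance Definition _ := Measure_isProbability.Build _ _ _ n n_setT.
Definition probability_of_measure : probability R R := n.
End ProbabilityOfMeasure.

Section Uniqueness.
Context (R : realType) (p : nat).
Local Notation C := R[i].
Variables (M N : C -> 'M[C]_p) (nu q : 'cV[C]_p -> {finite_measure set R -> \bar R}).
Hypothesis NM : forall z, 0 < Im z -> N z = M z.
Hypothesis N_adj : forall z, Im z < 0 -> N z = (N (Num.conj z))^t*.
Hypothesis nuT : forall v, nu v setT = (rip v v)%:E.
Hypothesis nu_tr : forall v z, Im z != 0 ->
  Cintegral (nu v) (stieltjes_kernel z) = sform v (N z).
Hypothesis q_tr : forall v z, Im z != 0 ->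
  Cintegral (q v) (stieltjes_kernel z) = (4^-1)%:C * sform v (N z).
Implicit Types (v : 'cV[C]_p) (z : C) (A : set R).

(** The decomposition supplied by the representation may change with z; [decomposition_unique]
    replaces it by one fixed m. *)
Lemma representation_transform W (i j : 'I_p) (m : 'I_4 -> {finite_measure set R -> \bar R}) :
  stieltjes_representation M W ->
  (forall A, measurable A -> W A i j = \sum_(k < 4) 'i%C ^+ k * (fine (m k A))%:C) ->
  forall z, 0 < Im z ->
    \sum_(k < 4) 'i%C ^+ k * Cintegral (m k) (stieltjes_kernel z) = M z i j.
Proof.
move=> [_ _ tr] hm z z0; have [m' [hm' im' ->]] := tr z z0 i j.
apply: decomposition_unique => // [A mA|k]; first by rewrite -hm // -hm'.
by apply: (kernel_integrable _ _ (@measurable_id _ _ setT)); rewrite gt_eqF.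
Qed.

Lemma representation_unique W : stieltjes_representation M W ->
  forall A, measurable A -> W A = mxmeasure q A.
Proof.
move=> hW A mA; have [[_ psd _] _ tr] := hW; apply/matrixP => i j.
(* Any point of the upper half-plane would do: only the decomposition of the entry (i, j) of W is
   kept. *)
have z1 : upper_half ('i%C : C) by rewrite /upper_half /= ltr01.
have [m [hm _ _]] := tr _ z1 i j.
(* [stieltjes_injective] needs both half-planes, while the representation concerns the upper one. As
   W A is Hermitian, the entry (j, i) is decomposed by the measures m (- k), and conjugation then
   gives the transform of the entry (i, j) below the real line. *)
have hm' A' : measurable A' ->
    W A' j i = \sum_(k < 4) 'i%C ^+ k * (fine (m (- k) A'))%:C.
  move=> mA'; have [h _] := psd _ mA'; rewrite -[in LHS]h !mxE hm //.
  by rewrite conj_sum_powers_i; apply: eq_bigr => k _; rewrite conj_real.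
have mtr z : Im z != 0 ->
    \sum_(k < 4) 'i%C ^+ k * Cintegral (m k) (stieltjes_kernel z) = N z i j.
  move=> z0; have [zp|zn] := ltP 0 (Im z).
    by rewrite NM // (representation_transform hW hm).
  have {}zn : Im z < 0 by rewrite lt_neqAle z0.
  have zc : 0 < Im (Num.conj z) by rewrite Im_conj oppr_gt0.
  rewrite N_adj // NM // !mxE -(representation_transform hW hm') //.
  rewrite conj_sum_powers_i; apply: eq_bigr => k _.
  by rewrite opprK -transform_conj ?conjCK // gt_eqF.
rewrite mxE hm //.
pose c' (t : 'I_4 + 'I_4) : C := match t with inl k => 'i%C ^+ k | inr k => - 'i%C ^+ k end.
pose m' (t : 'I_4 + 'I_4) := match t with inl k => m k | inr k => q (pol R i j k) end.
have := @stieltjes_injective _ _ c' m' _ _ mA.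
rewrite !big_sumType /=; under [X in _ + X]eq_bigr do rewrite mulNr.
rewrite sumrN => /(_ _)/eqP; rewrite subr_eq0 => h; apply/eqP/h => z z0.
rewrite big_sumType /=; under [X in _ + X]eq_bigr do rewrite mulNr q_tr //.
by rewrite sumrN mtr // polarisation subrr.
Qed.

Lemma mxtrace_sform (X : 'M[C]_p) : \tr X = \sum_i sform (delta_mx i 0) X.
Proof. by apply: eq_bigr => i _; rewrite sform_delta. Qed.

(** The measure is built from the quadratic forms at the basis vectors with weights 1/p, which makes
    it positive from the start; injectivity then identifies it with the normalised trace. *)
Lemma trace_probability : (0 < p)%N -> exists mu : probability R R,
  (forall A, measurable A -> (fine (mu A))%:C = p%:R^-1 * \tr (mxmeasure q A)) /\
  (forall z, 0 < Im z -> Cintegrable mu (stieltjes_kernel z) /\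
     Cintegral mu (stieltjes_kernel z) = p%:R^-1 * \tr (M z)).
Proof.
move=> p0; pose e i : 'cV[C]_p := delta_mx i 0.
have pp : 0 <= p%:R^-1 :> R by rewrite invr_ge0.
have pC : (p%:R^-1)%:C = p%:R^-1 :> C by rewrite fmorphV rmorph_nat.
have re i : rip (e i) (e i) = 1 by rewrite -[X in rip _ X]mul1mx rip_delta mxE eqxx.
have hs i : stieltjes_of (rip (e i) (e i)) (fun z => sform (e i) (N z)).
  by exists (nu (e i)); split; [exact: nuT|move=> z z0; rewrite nu_tr // gt_eqF].
have [m0 [m0T m0tr]] := stieltjes_of_sum (index_enum 'I_p) (fun i => stieltjes_ofZ pp (hs i)).
have m01 : m0 setT = 1%E.
  rewrite m0T; under eq_bigr do rewrite re mulr1.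
  by rewrite sumr_const card_ord -(mulr_natl (p%:R^-1 : R)) mulfV // pnatr_eq0 -lt0n.
pose mu := probability_of_measure m01.
have mutr z : Im z != 0 -> Cintegral mu (stieltjes_kernel z) =
    \sum_i (p%:R^-1)%:C * sform (e i) (N z).
  move=> z0; have [zp|zn] := ltP 0 (Im z); first by rewrite -m0tr.
  have {}zn : Im z < 0 by rewrite lt_neqAle z0.
  have zc : 0 < Im (Num.conj z) by rewrite Im_conj oppr_gt0.
  rewrite -[z in LHS]conjCK transform_conj ?gt_eqF // [Cintegral _ _]m0tr //.
  rewrite (N_adj zn) rmorph_sum; apply: eq_bigr => i _.
  by rewrite rmorphM /= conj_real sform_adj.
exists mu; split => [A mA|z z0].
  rewrite mxtrace_sform mulr_sumr.
  under eq_bigr do rewrite (sform_mxmeasure nu_tr q_tr) // -pC.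
  pose c' (t : 'I_p + 'I_1) : C := match t with inl k => - (p%:R^-1)%:C | inr k => 1 end.
  pose m' (t : 'I_p + 'I_1) : {finite_measure set R -> \bar R} :=
    match t with inl k => nu (e k) | inr k => mu end.
  have := @stieltjes_injective _ _ c' m' _ _ mA.
  rewrite !big_sumType /= big_ord1 mul1r; under eq_bigr do rewrite mulNr.
  rewrite sumrN addrC => /(_ _)/eqP; rewrite subr_eq0 => h; apply/eqP/h => z z0.
  rewrite big_sumType /= big_ord1 mul1r mutr //.
  under eq_bigr do rewrite mulNr nu_tr //.
  by rewrite sumrN addNr.
split; first by apply: (kernel_integrable _ _ (@measurable_id _ _ setT)); rewrite gt_eqF.
by rewrite mutr ?gt_eqF // NM // mxtrace_sform mulr_sumr pC.
Qed.

End Uniqueness.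

(** * Solutions of the equation *)

Section OperatorNorm.
Variable R : realType.

Lemma l2norm_ge_entry n (x : 'cV[R]_n) i : `|x i 0| <= l2norm x.
Proof.
rewrite /l2norm -sqrtr_sqr ler_sqrt; last by apply: sumr_ge0 => k _; exact: sqr_ge0.
by rewrite (bigD1 i) //= lerDl; apply: sumr_ge0 => k _; exact: sqr_ge0.
Qed.

Lemma opnorm_ge_entry m n (A : 'M[R]_(m, n)) i j : `|A i j| <= opnorm A.
Proof.
pose x : 'cV[R]_n := delta_mx j 0.
have x1 : l2norm x = 1.
  rewrite /l2norm (bigD1 j) //= big1 => [|k kj]; last first.
    by rewrite mxE (negbTE kj) /= expr0n.
  by rewrite mxE !eqxx expr1n addr0 sqrtr1.
have -> : A i j = (A *m x) i 0 by rewrite -colE mxE.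
apply: le_trans (l2norm_ge_entry _ _) _.
apply: ub_le_sup; last by exists x => //=; rewrite x1.
(* A supremum in the reals bounds its set from above only if the set is bounded; the absolute row
   sums provide such a bound. *)
pose b k := \sum_(l < n) `|A k l|.
exists (Num.sqrt (\sum_(k < m) b k ^+ 2)) => _ [u /= hu <-].
rewrite /l2norm ler_sqrt; last by apply: sumr_ge0 => k _; exact: sqr_ge0.
apply: ler_sum => k _.
rewrite -[X in X <= _]real_normK ?num_real // lerXn2r ?nnegrE ?sumr_ge0 //.
rewrite mxE; apply: le_trans (ler_norm_sum _ _ _) _; apply: ler_sum => l _.
rewrite normrM ler_piMr //.
exact: le_trans (l2norm_ge_entry _ _) hu.
Qed.

End OperatorNorm.

Section ClippedField.
Context d (Omega : measurableType d) (R : realType) (P : probability Omega R) (p : nat).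
Implicit Types (S : Omega -> 'M[R]_p).

(* [opnorm (S w) <= b] only holds almost everywhere; clipping the entries makes the
   bound hold everywhere without changing the almost sure class. *)
Definition clip (b x : R) : R := Num.max (- b) (Num.min b x).

Lemma clip_norm b x : 0 <= b -> `|clip b x| <= b.
Proof.
move=> b0; rewrite ler_norml /clip le_max lexx /= ge_max ge_min lexx /= andbT.
by lra.
Qed.

Lemma clip_id b x : `|x| <= b -> clip b x = x.
Proof.
by rewrite ler_norml => /andP[h1 h2]; rewrite /clip min_r // max_r.
Qed.

Definition clipmx b S w : 'M[R]_p := \matrix_(i, j) clip b (S w i j).

Lemma clipmx_regular b S : 0 <= b -> (forall w, (S w)^T = S w) ->
  (forall i j, measurable_fun setT (fun w => S w i j)) ->
  regular (clipmx b S) (p%:R * p%:R * (2 * b)).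
Proof.
move=> b0 symS mS; split.
- by move=> w; apply/matrixP => i j; rewrite !mxE -[in LHS](symS w) mxE.
- move=> i j.
  have -> : (fun w => clipmx b S w i j) = (fun w => clip b (S w i j)).
    by apply/funext => w; rewrite mxE.
  apply: measurable_maxr; first exact: measurable_cst.
  by apply: measurable_minr; [exact: measurable_cst|exact: mS].
- move=> w; apply: bnd_entries => // i j; rewrite !mxE /= normr0; split => //.
  exact: clip_norm.
Qed.

Lemma clipmx_ae b S : {ae P, forall w, opnorm (S w) <= b} ->
  {ae P, forall w, clipmx b S w = S w}.
Proof.
apply: filterS => w hw; apply/matrixP => i j; rewrite mxE clip_id //.
exact: le_trans (opnorm_ge_entry _ _ _) hw.
Qed.

End ClippedField.

Section Solutions.
Context d (Omega : measurableType d) (R : realType) (P : probability Omega R) (p : nat).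
Variable alpha : R.
Hypothesis alpha_gt0 : 0 < alpha.
Local Notation C := R[i].
Local Notation a := (alpha^-1).
Implicit Types (S : Omega -> 'M[R]_p) (z : C) (X : 'M[C]_p).

Let a_gt0 : 0 < a. Proof. by rewrite invr_gt0. Qed.

Lemma solves_atP S z X : solves_at P alpha S z X <->
  [/\ X \in unitmx, {ae P, forall w, Bmx a X (complexmx (S w)) \in unitmx},
      mxintegrable P (GS a S X) & invmx X = - z%:M + ES P a S X].
Proof. by rewrite /solves_at /ES /GS Gmx.unlock Bmx.unlock. Qed.

Lemma Cintegrable_ae (f g : Omega -> C) : Cmeas g -> {ae P, forall w, f w = g w} ->
  Cintegrable P f -> Cintegrable P g.
Proof.
have real (u v : Omega -> R) : measurable_fun setT v -> {ae P, forall w, u w = v w} ->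
    P.-integrable setT (EFin \o u) -> P.-integrable setT (EFin \o v).
  move=> mv e iu; have mu := measurable_int _ iu.
  have mv' : measurable_fun setT (EFin \o v) by exact/measurable_EFinP.
  apply/integrableP; split => //.
  have /integrableP[_] := iu; congr (_ < _)%E; apply: ae_eq_integral => //.
  - exact: measurableT_comp.
  - exact: measurableT_comp.
  - by apply: filterS e => w /= -> _.
move=> [gr gi] e [fr fi]; split; [apply: real gr _ fr|apply: real gi _ fi];
  by apply: filterS e => w ->.
Qed.

Lemma solves_at_ae S S' z X : (forall i j, measurable_fun setT (fun w => S w i j)) ->
  (forall i j, measurable_fun setT (fun w => S' w i j)) ->
  {ae P, forall w, S w = S' w} -> solves_at P alpha S z X -> solves_at P alpha S' z X.
Proof.
move=> mS mS' e /solves_atP[uX uB iG eq]; apply/solves_atP.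
have eG i j : {ae P, forall w, GS a S X w i j = GS a S' X w i j}.
  by apply: filterS e => w; rewrite /GS => ->.
split; first exact: uX.
- by apply: filterS2 e uB => w ->.
- move=> i j; exact: Cintegrable_ae (GS_meas a X mS' i j) (eG i j) (iG i j).
- rewrite eq; congr (_ + _); apply/matrixP => i j; rewrite !mxE.
  exact: Cintegral_ae (GS_meas a X mS i j) (GS_meas a X mS' i j) (eG i j).
Qed.

Lemma fixed_point_solves S c z X : regular S c -> 0 <= c -> 0 < Im z ->
  Qy (Im z) X -> Phi P a S z X = X -> solves_at P alpha S z X.
Proof.
move=> rS c0 z0 hX e; apply/solves_atP; split.
- rewrite -e /Phi unitmx_inv; exact (Phi_unit P a_gt0 rS c0 z0 z0 hX).
- apply: aeW => w; exact (GS_unit a_gt0 rS z0 hX w).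
- exact (GS_int P a_gt0 rS c0 z0 hX).
- by rewrite -[in LHS]e invmxK.
Qed.

Lemma sform_mxIm v X : sform v (mxIm X) = (iip v (X *m v))%:C.
Proof.
rewrite -Im_sform /sform /mxIm -scalemxAr -scalemxAl mxE -/(sform v (X - X^t*)).
rewrite sformB sform_adj; set s := sform v X.
have -> : s - Num.conj s = 2 * 'i%C * (Im s)%:C.
  by case: s => x y; apply: complex_ext => /=; ring.
rewrite mulKf // mulf_neq0 //.
by rewrite eq_complex /= oner_eq0 andbF.
Qed.

(** A solution is only known to have Im X >= 0. By [iip_G] this already makes the form of E
    nonpositive, and [phi_Qy] upgrades it to [Qy], where fixed points are unique. *)
Lemma solves_at_fixed S c z X : regular S c -> 0 < Im z -> psdmx (mxIm X) ->
  solves_at P alpha S z X -> Qy (Im z) X /\ Phi P a S z X = X.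
Proof.
move=> rS z0 [_ psd] /solves_atP[uX uB iG eq].
have e : Phi P a S z X = X by rewrite /Phi -eq invmxK.
split => //; rewrite -e; apply: phi_Qy => // u.
have X_ge0 w : 0 <= iip w (X *m w).
  by have := psd w; rewrite -/(sform w _) sform_mxIm lecR.
rewrite iip_mxintegral //.
have ii := iip_integrable u u iG; have mi := measurable_int _ ii.
have mi' : measurable_fun setT (fun w => -1 * iip u (GS a S X w *m u)).
  by apply: measurable_funM; [exact: measurable_cst|exact/measurable_EFinP].
rewrite -oppr_ge0 -mulN1r -RintegralZl //.
(* The sign of the integrand is known only where B is invertible, hence almost everywhere; the
   maximum with 0 is nonnegative at every point and has the same integral. *)
have -> : \int[P]_w (-1 * iip u (GS a S X w *m u)) =
    \int[P]_w Num.max (-1 * iip u (GS a S X w *m u)) 0.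
  congr fine; apply: ae_eq_integral => //.
  - exact/measurable_EFinP.
  - by apply/measurable_EFinP; apply: measurable_maxr => //; exact: measurable_cst.
  - apply: filterS uB => w hw _; rewrite max_l // mulN1r /GS iip_G //.
      by rewrite opprK mulr_ge0 // ltW.
    by rewrite complexmx_adj (reg_sym rS).
by apply: Rintegral_ge0 => w _; rewrite le_max lexx orbT.
Qed.

Lemma fixed_point_posdef S c z X : regular S c -> 0 <= c -> 0 < Im z ->
  Qy (Im z) X -> Phi P a S z X = X -> posdefmx (mxIm X).
Proof.
move=> rS c0 z0 hX e; split.
  apply/eqP; rewrite -subr_eq0; apply/eqP; apply: sform_eq0 => v.
  by rewrite sformB sform_adj sform_mxIm conj_real subrr.
move=> v v0; rewrite -/(sform v _) sform_mxIm ltcR.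
have := Phi_lower P a_gt0 rS c0 z0 z0 v hX; rewrite e; apply: lt_le_trans.
rewrite mulr_gt0 ?rip_gt0 // divr_gt0 // exprn_gt0 //.
by rewrite normc_K_gt0.
Qed.

Lemma fixed_point_normalized S c (M : C -> 'M[C]_p) : regular S c -> 0 <= c ->
  (forall z, 0 < Im z -> Qy (Im z) (M z)) ->
  (forall z, 0 < Im z -> Phi P a S z (M z) = M z) ->
  ((fun eta : R => ('i%C * eta%:C) *: M ('i%C * eta%:C)) : R -> 'M[C^o]_p)
    @ +oo --> (- 1%:M : 'M[C^o]_p).
Proof.
move=> rS c0 hQ hP; pose z (eta : R) : C := 'i%C * eta%:C.
have Imz eta : Im (z eta) = eta by rewrite /z /=; ring.
pose K := Kbound a c 1.
have est eta : 1 <= eta -> bnd (1%:M + z eta *: M (z eta)) (eta^-1 * K).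
  move=> e1; have e0 : 0 < eta by exact: lt_le_trans e1.
  have z0 : 0 < Im (z eta) by rewrite Imz.
  have Q1 : Qy 1 (M (z eta)).
    move=> u; apply: le_trans (hQ _ z0 u); rewrite Imz.
    by rewrite ler_wpM2r // rip_ge0.
  have := Phi_residue P a_gt0 rS c0 ltr01 z0 Q1.
  by rewrite (hP _ z0) Imz.
have K0 : 0 <= K by exact: Kbound_ge0.
have lim (f : R -> R) l : (forall eta, 1 <= eta -> `|l - f eta| <= eta^-1 * K) ->
    f eta @[eta --> +oo] --> l.
  move=> h; apply/cvgrPdist_le => e e0; near=> eta.
  have e1 : 1 <= eta by near: eta; exact: nbhs_pinfty_ge.
  have e2 : K / e <= eta by near: eta; apply: nbhs_pinfty_ge; exact: num_real.
  have ep : 0 < eta by exact: lt_le_trans e1.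
  apply: le_trans (h _ e1) _; rewrite mulrC ler_pdivrMr //.
  by rewrite mulrC -ler_pdivrMr.
apply: mx_Ccvg => i j; split; apply: lim => eta e1.
  have := bnd_Re i j (est eta e1); rewrite !mxE ReD -normrN opprD.
  by rewrite ReN.
have := bnd_Im i j (est eta e1); rewrite !mxE ImD -normrN opprD.
by rewrite ImN.
Unshelve. all: by end_near. Qed.

End Solutions.

Theorem proposition3p2 (R : realType) (p q r : nat)
    (d : measure_display) (Omega : measurableType d) (P : probability Omega R)
    (s : {RV P >-> r.-tuple R}) (y : {RV P >-> q.-tuple R})
    (Pstar : R.-pker (r.-tuple R) ~> (q.-tuple R))
    (T : q.-tuple R -> 'M[R]_p) (alpha CT : R)
    (p_gt0 : (0 < p)%N) (q_gt0 : (0 < q)%N) (r_gt0 : (0 < r)%N)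
    (s_gaussian : standard_gaussian s)
    (y_law : has_conditional_law s y Pstar)
    (alpha_gt0 : 0 < alpha)
    (T_sym : forall u, (T u)^T = T u)
    (T_meas : forall i j, measurable_fun setT (fun u => T u i j))
    (T_neq0 : (0 < P [set w | T (y w) != 0%R])%E)
    (CT_gt0 : 0 < CT)
    (T_bounded : {ae P, forall w, opnorm (T (y w)) <= CT}) :
  let Ty := fun w => T (y w) in
  exists M : R[i] -> 'M[R[i]]_p,
    [/\ herglotz_solution P alpha Ty M,
        forall M', herglotz_solution P alpha Ty M' ->
          forall z, upper_half z -> M' z = M z,
        forall z, upper_half z -> posdefmx (mxIm (M z)) &
        exists W : set R -> 'M[R[i]]_p,
          [/\ stieltjes_representation M W,
              forall W', stieltjes_representation M W' ->
                forall A, measurable A -> W' A = W A &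
              exists mu : probability R R,
                (forall A, measurable A ->
                   (fine (mu A))%:C = p%:R^-1 * \tr (W A)) /\
                (forall z, upper_half z ->
                   Cintegrable mu (stieltjes_kernel z) /\
                   Cintegral mu (stieltjes_kernel z) = p%:R^-1 * \tr (M z))]].
Proof.
move=> Ty; pose a := alpha^-1.
have a0 : 0 < a by rewrite invr_gt0.
have Ty_meas i j : measurable_fun setT (fun w => Ty w i j).
  by apply: (measurableT_comp (T_meas i j)); exact: measurable_funP.
pose S := clipmx CT Ty; pose c := p%:R * p%:R * (2 * CT).
have c0 : 0 <= c by rewrite !mulr_ge0 // ltW.
have rS : regular S c by apply: clipmx_regular => //; [exact: ltW|move=> w; exact: T_sym].
have STy : {ae P, forall w, S w = Ty w} by exact: clipmx_ae.
have TyS : {ae P, forall w, Ty w = S w} by apply: filterS STy => w ->.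
(* Off the upper half-plane the required property is vacuous, so 0 serves as witness there. *)
have /choice[M hM] : forall z : R[i], exists L, 0 < Im z -> tends (iterate P a S z) L.
  move=> z; have [z0|z0] := ltP 0 (Im z); last by exists 0.
  by have [L hL] := iterate_cvg P a0 rS c0 z0; exists L.
have hQ z (z0 : 0 < Im z) := (iterate_lim_fixed a0 rS c0 z0 (hM z z0)).1.
have hP z (z0 : 0 < Im z) := (iterate_lim_fixed a0 rS c0 z0 (hM z z0)).2.
have pos z : upper_half z -> posdefmx (mxIm (M z)).
  by move=> z0; exact: (fixed_point_posdef alpha_gt0 rS c0 z0 (hQ z z0) (hP z z0)).
have hst v := fixed_point_stieltjes a0 v rS c0 hM.
have [nu [nuT nu_tr]] := exists_form_measures hst.
have [Q Q_tr] := exists_quarter_measures hst.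
pose N z := if 0 < Im z then M z else (M (Num.conj z))^t*%sesqui.
have NM z : 0 < Im z -> N z = M z by rewrite /N => ->.
exists M; split => //.
- split.
  + exact: (transform_analytic Q_tr NM).
  + move=> z z0; apply: (solves_at_ae (reg_meas rS) Ty_meas STy).
    exact: (fixed_point_solves alpha_gt0 rS c0 z0 (hQ z z0) (hP z z0)).
  + split; last exact: (fixed_point_normalized alpha_gt0 rS c0 hQ hP).
    move=> z /pos[h1 h2]; split => // v.
    have [->|v0] := eqVneq v 0; first by rewrite mulmx0 mxE.
    exact/ltW/h2.
- move=> M' [_ sol [psd _]] z z0.
  have sol' := solves_at_ae Ty_meas (reg_meas rS) TyS (sol z z0).
  have [Q1 P1] := solves_at_fixed alpha_gt0 rS z0 (psd z z0) sol'.
  exact: (Phi_fixed_unique a0 rS c0 z0 Q1 (hQ z z0) P1 (hP z z0)).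
have N_adj z : Im z < 0 -> N z = (N (Num.conj z))^t*%sesqui.
  move=> zn; rewrite [in RHS]/N Im_conj oppr_gt0 zn /N.
  by rewrite ltNge (ltW zn).
exists (mxmeasure Q); split.
- split; first exact: (mxmeasure_psd nu_tr Q_tr).
    exact: (mxmeasureT nuT nu_tr Q_tr).
  move=> z z0; rewrite -NM //; apply: (mxmeasure_transform Q_tr).
  by rewrite gt_eqF.
- move=> W' hW'; exact: (representation_unique NM N_adj Q_tr hW').
- exact: (trace_probability NM N_adj nuT nu_tr Q_tr p_gt0).
Qed.
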